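(* Let $R$ be a noetherian ring, let $n>0$ be an integer, and let $\kappa$ be an infinite cardinal with $\kappa\ge{\rm Card}(R)$. Then $({\rm ex}\widetilde{\mathcal{P}_n},({\rm ex}\widetilde{\mathcal{P}_n})^\perp)$ is a complete cotorsion pair in ${\rm Ch}(R\text{-}{\rm Mod})$, cogenerated by ${\rm ex}\widetilde{\mathcal{P}_n^{\leq\kappa}}$.
   Context: Modules are left $R$-modules; noetherian means left and right noetherian. ${\rm Ch}(R\text{-}{\rm Mod})$ is the category of (unbounded) chain complexes of left $R$-modules. $\mathcal{P}_n$ is the class of modules of projective dimension at most $n$. By Kaplansky's theorem every projective module is a direct sum of countably generated projective modules, so each $M\in\mathcal{P}_n$ has a projective resolution $0\to\bigoplus_{i\in I_n}P^i_n\to\cdots\to\bigoplus_{i\in I_0}P^i_0\to M\to 0$ with every $P^i_k$ countably generated projective; such a resolution is small if ${\rm Card}(I_k)\le\kappa$ for all $0\le k\le n$. $\mathcal{P}_n^{\leq\kappa}$ is the class (a set up to isomorphism) of modules in $\mathcal{P}_n$ having a small projective resolution of this form. For a class $\mathcal{A}$ of modules, ${\rm ex}\widetilde{\mathcal{A}}$ is the class of exact complexes $X$ with $X_m\in\mathcal{A}$ for all $m\in\mathbb{Z}$. Orthogonals are with respect to ${\rm Ext}^1$ in ${\rm Ch}(R\text{-}{\rm Mod})$: $\mathcal{X}^\perp=\{Z:{\rm Ext}^1(X,Z)=0\ \forall X\in\mathcal{X}\}$ and ${}^\perp\mathcal{X}=\{Z:{\rm Ext}^1(Z,X)=0\ \forall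 X\in\mathcal{X}\}$. A pair $(\mathcal{X},\mathcal{Y})$ is a cotorsion pair if $\mathcal{X}={}^\perp\mathcal{Y}$ and $\mathcal{Y}=\mathcal{X}^\perp$. It is complete if for every object $Z$ there are short exact sequences $0\to B\to A\to Z\to 0$ and $0\to Z\to B'\to A'\to 0$ with $A,A'\in\mathcal{X}$ and $B,B'\in\mathcal{Y}$. It is cogenerated by a set $\mathcal{S}\subseteq\mathcal{X}$ if $\mathcal{Y}=\mathcal{S}^\perp$ (here a class with only a set of isomorphism classes is treated as a set). *)

(* Defs.v *)
From HB Require Import structures.
From mathcomp Require Import all_boot all_order all_algebra.
From mathcomp Require Import boolp classical_sets functions cardinality.

Set Implicit Arguments.
Unset Strict Implicit.
Unset Printing Implicit Defensive.

Import GRing.Theory.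

Local Open Scope ring_scope.
Local Open Scope classical_set_scope.
Local Open Scope card_scope.

(* The universe in which the carriers of [lmodType R] live. Its members play
   the role of sets: R-Mod and Ch(R-Mod) live strictly above it, so a family
   indexed by a [smallType] is a set of objects, and not just a class. *)
Definition smallType := Type@{GRing.Lmodule.axioms_.u0}.

Definition noetherian_module (R : pzRingType) (M : lmodType R) : Prop :=
  forall S : {pred M}, GRing.submod_closed S ->
  exists (m : nat) (g : 'I_m -> M),
    forall x, x \in S <-> exists c : 'I_m -> R, x = \sum_(j < m) c j *: g j.

(* [R^o] is R as a left module over itself, and [R^c^o] is the left module
   over the opposite ring that corresponds to R as a right module. *)
Definition noetherian_ring (R : pzRingType) : Prop :=
  noetherian_module (R^o : lmodType R) /\
  noetherian_module (R^c^o : lmodType R^c).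

Section Modules.
Variable R : pzRingType.

Definition projective (P : lmodType R) : Prop :=
  forall (A B : lmodType R) (p : {linear A -> B}) (f : {linear P -> B}),
    (forall b, exists a, p a = b) ->
  exists g : {linear P -> A}, forall x, p (g x) = f x.

Definition countably_generated (M : lmodType R) : Prop :=
  exists g : nat -> M, forall x, exists (m : nat) (c : 'I_m -> R),
    x = \sum_(j < m) c j *: g j.

(* M is the direct sum of the P i, with canonical injections inj i. *)
Definition is_direct_sum (I : smallType) (P : I -> lmodType R) (M : lmodType R)
    (inj : forall i, {linear P i -> M}) : Prop :=
  (forall x, exists (m : nat) (i : 'I_m -> I) (v : forall j, P (i j)),
     x = \sum_(j < m) inj (i j) (v j)) /\
  (forall (m : nat) (i : 'I_m -> I) (v : forall j, P (i j)), injective i ->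
     \sum_(j < m) inj (i j) (v j) = 0 -> forall j, v j = 0).

Definition small_sum_cg_projective (K : smallType) (M : lmodType R) : Prop :=
  exists (I : smallType) (P : I -> lmodType R)
         (inj : forall i, {linear P i -> M}),
    [/\ [set: I] #<= [set: K],
        forall i, projective (P i) /\ countably_generated (P i)
      & is_direct_sum inj].

(* An exact sequence 0 -> P_n -> ... -> P_0 -> M -> 0, extended by P_k = 0 for
   k > n. *)
Record resolution (n : nat) (M : lmodType R) := Resolution {
  res_obj :> nat -> lmodType R;
  res_diff : forall k, {linear res_obj k.+1 -> res_obj k};
  res_aug : {linear res_obj 0%N -> M};
  res_aug_surj : forall x, exists y, res_aug y = x;
  res_exact0 : forall y, res_aug y = 0 <-> exists z, res_diff 0%N z = y;
  res_exactS : forall k (y : res_obj k.+1),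
    res_diff k y = 0 <-> exists z, res_diff k.+1 z = y;
  res_length : forall k, (n < k)%N -> forall y : res_obj k, y = 0 }.

Definition projdim_le (n : nat) (M : lmodType R) : Prop :=
  exists F : resolution n M, forall k, (k <= n)%N -> projective (F k).

Definition projdim_le_small (K : smallType) (n : nat) (M : lmodType R) : Prop :=
  projdim_le n M /\
  exists F : resolution n M,
    forall k, (k <= n)%N -> small_sum_cg_projective K (F k).

End Modules.

Section Complexes.
Variable R : pzRingType.

(* [cdiff i] is the differential from degree i + 1 to degree i. *)
Record complex := Complex {
  cobj :> int -> lmodType R;
  cdiff : forall i : int, {linear cobj (i + 1) -> cobj i};
  cdiffK : forall i x, cdiff i (cdiff (i + 1) x) = 0 }.

Record chain_map (X Y : complex) := ChainMap {
  cmap :> forall i : int, {linear X i -> Y i};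
  cmap_diff : forall i x, cmap i (cdiff X i x) = cdiff Y i (cmap (i + 1) x) }.

Definition isomorphic (X Y : complex) : Prop :=
  exists (f : chain_map X Y) (g : chain_map Y X),
    (forall i x, g i (f i x) = x) /\ (forall i y, f i (g i y) = y).

Definition exact_complex (X : complex) : Prop :=
  forall i (x : X (i + 1)),
    cdiff X i x = 0 -> exists y, cdiff X (i + 1) y = x.

(* The class ex~A. *)
Definition ex_tilde (A : lmodType R -> Prop) (X : complex) : Prop :=
  exact_complex X /\ forall i, A (X i).

Definition short_exact (A B C : complex)
    (f : chain_map A B) (g : chain_map B C) : Prop :=
  [/\ forall i, injective (f i),
      forall i z, exists y, g i y = z
    & forall i y, g i y = 0 <-> exists x, f i x = y].

Record extension (X Z : complex) := Extension {
  ext_mid : complex;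
  ext_inj : chain_map Z ext_mid;
  ext_proj : chain_map ext_mid X;
  ext_exact : short_exact ext_inj ext_proj }.

Definition ext_equiv (X Z : complex) (E E' : extension X Z) : Prop :=
  exists f : chain_map (ext_mid E) (ext_mid E'),
    (forall i z, f i (ext_inj E i z) = ext_inj E' i z) /\
    (forall i e, ext_proj E' i (f i e) = ext_proj E i e).

Section Split.
Variables X Z : complex.

Definition dsum_diff (i : int) (u : (Z (i + 1)%R * X (i + 1)%R)%type) :
  (Z i * X i)%type := (cdiff Z i u.1, cdiff X i u.2).

Lemma dsum_diff_is_linear i : linear (@dsum_diff i).
Proof. by move=> a u v; rewrite /dsum_diff /= !linearP. Qed.

HB.instance Definition _ i := GRing.isLinear.Build R _ _ _ (@dsum_diff i)
  (@dsum_diff_is_linear i).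

Lemma dsum_diffK i u : dsum_diff (@dsum_diff (i + 1) u) = 0.
Proof. by rewrite /dsum_diff /= !cdiffK. Qed.

Definition dsum : complex :=
  @Complex (fun i => (Z i * X i)%type) (fun i => @dsum_diff i) dsum_diffK.

Definition dsum_inl (i : int) (z : Z i) : dsum i := (z, 0).

Lemma dsum_inl_is_linear i : linear (@dsum_inl i).
Proof.
move=> a u v; rewrite /dsum_inl.
by apply: injective_projections => //=; rewrite scaler0 addr0.
Qed.

HB.instance Definition _ i := GRing.isLinear.Build R _ _ _ (@dsum_inl i)
  (@dsum_inl_is_linear i).

Definition dsum_snd (i : int) (u : dsum i) : X i := u.2.

Lemma dsum_snd_is_linear i : linear (@dsum_snd i).
Proof. by []. Qed.

HB.instance Definition _ i := GRing.isLinear.Build R _ _ _ (@dsum_snd i)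
  (@dsum_snd_is_linear i).

Lemma dsum_inl_diff i z :
  dsum_inl (cdiff Z i z) = cdiff dsum i (dsum_inl z).
Proof. by rewrite /dsum_inl /= /dsum_diff /= linear0. Qed.

Lemma dsum_snd_diff i u :
  dsum_snd (cdiff dsum i u) = cdiff X i (dsum_snd u).
Proof. by []. Qed.

Definition dsum_inj : chain_map Z dsum :=
  @ChainMap Z dsum (fun i => @dsum_inl i) dsum_inl_diff.

Definition dsum_proj : chain_map dsum X :=
  @ChainMap dsum X (fun i => @dsum_snd i) dsum_snd_diff.

Lemma dsum_exact : short_exact dsum_inj dsum_proj.
Proof.
split=> [i z z' []//|i x|i [z x]]; first by exists (0, x).
by split=> [/= -> |[z' [_ <-]]//]; exists z.
Qed.

Definition split_extension : extension X Z := Extension dsum_exact.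

End Split.

(* Yoneda Ext: Ext^1(X, Z) is the group of equivalence classes of extensions of
   X by Z, whose zero is the class of the split extension. *)
Definition Ext1_eq0 (X Z : complex) : Prop :=
  forall E : extension X Z, ext_equiv E (split_extension X Z).

Definition right_orth (S : complex -> Prop) (Z : complex) : Prop :=
  forall X, S X -> Ext1_eq0 X Z.

Definition left_orth (S : complex -> Prop) (Z : complex) : Prop :=
  forall X, S X -> Ext1_eq0 Z X.

Definition cotorsion_pair (X Y : complex -> Prop) : Prop :=
  (forall Z, X Z <-> left_orth Y Z) /\ (forall Z, Y Z <-> right_orth X Z).

Definition complete_pair (X Y : complex -> Prop) : Prop :=
  forall Z,
    (exists (B A : complex) (f : chain_map B A) (g : chain_map A Z),
       [/\ X A, Y B & short_exact f g]) /\
    (exists (B' A' : complex) (f : chain_map Z B') (g : chain_map B' A'),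
       [/\ X A', Y B' & short_exact f g]).

Definition essentially_small (S : complex -> Prop) : Prop :=
  exists (J : smallType) (F : J -> complex),
    (forall j, S (F j)) /\ (forall X, S X -> exists j, isomorphic X (F j)).

Definition cogenerated_by (X Y S : complex -> Prop) : Prop :=
  [/\ essentially_small S,
      forall Z, S Z -> X Z
    & forall Z, Y Z <-> right_orth S Z].

End Complexes.

(* Main.v *)
(* Let X be the class of exact complexes with terms of projective dimension at
   most n, S the subclass of those with small resolutions.

   S and X have the same right orthogonal. As n > 0, Eilenberg's swindle shows
   that a module of projective dimension at most n and of cardinality at most
   that of K has a small resolution, so only cardinalities matter. Choosing a
   free resolution of each term of a complex L of X, any small set of
   generators is contained in a small set that spans an exact subcomplex and
   subresolutions, and the same holds relatively to such a spanned subcomplex.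
   An extension of L by an object of the right orthogonal of S can then be
   retracted step by step along spanned subcomplexes, by Zorn's lemma.

   Every object of S is a quotient of one complex P of free modules, so S is
   essentially small, and the small object argument embeds each Z into an
   object of the right orthogonal, with a cokernel that is filtered by objects
   of S. X is closed under such filtrations (Auslander's lemma), extensions
   and retracts. Salce's trick gives the special precovers, hence also that X
   is the left orthogonal of its right orthogonal. *)
Require Import Defs.
From HB Require Import structures.
From mathcomp Require Import all_boot all_order all_algebra.
From mathcomp Require Import boolp classical_sets functions cardinality.

Set Implicit Arguments.
Unset Strict Implicit.
Unset Printing Implicit Defensive.

Import GRing.Theory.
Local Open Scope ring_scope.
Local Open Scope classical_set_scope.
Local Open Scope card_scope.

(** * Submodules and quotient modules *)

(** No ordinals occur. A transfinite filtration is a family of submodules [N D] indexed by sets [D],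
    taken in a class closed under unions of chains in which each [D] short of the top can be
    enlarged by one layer.

    Projective dimension is measured on canonical syzygies, the kernels of the covers by the free
    modules on all elements. A set of elements then fixes both a submodule and a piece of its
    resolution, so that subresolutions become closure conditions on sets.

    The obstacle in the relative spanning is that the set [D] already treated may be large while
    only a small set may be added. What must be adjoined is therefore chosen once for each formal
    combination of new generators, modulo what [D] spans.

    The swindle adds one and the same free module in two consecutive degrees of a resolution; this
    is where n > 0 enters. An infinite [K] absorbs its square, which makes countable closures of
    small sets small, and Card(R) <= Card(K) keeps the span of a small set small. *)

Section SubmoduleSets.
Variables (R : pzRingType) (M : lmodType R).

Definition submod (N : set M) :=
  N 0 /\ forall a x y, N x -> N y -> N (a *: x + y).

Lemma submodD N x y : submod N -> N x -> N y -> N (x + y).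
Proof. by move=> [_ h] Nx Ny; rewrite -[x]scale1r; apply: h. Qed.

Lemma submodZ N a x : submod N -> N x -> N (a *: x).
Proof. by move=> [h0 h] Nx; rewrite -[_ *: x]addr0; apply: h. Qed.

Lemma submodN N x : submod N -> N x -> N (- x).
Proof. by move=> hN Nx; rewrite -scaleN1r; apply: submodZ. Qed.

Lemma submodB N x y : submod N -> N x -> N y -> N (x - y).
Proof. by move=> hN Nx Ny; apply: submodD => //; apply: submodN. Qed.

Lemma submod_sum (I : Type) (s : seq I) (P : pred I) (F : I -> M) N :
  submod N -> (forall i, P i -> N (F i)) -> N (\sum_(i <- s | P i) F i).
Proof.
move=> hN NF; elim/big_ind: _ => //; first by case: hN.
by move=> x y; apply: submodD.
Qed.

Lemma submodT : submod setT. Proof. by []. Qed.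
Lemma submod0 : submod [set 0].
Proof. by split=> // a x y -> ->; rewrite /= scaler0 addr0. Qed.

End SubmoduleSets.

Section SubType.
Variables (R : pzRingType) (M : lmodType R) (N : set M) (hN : submod N).

Let P : {pred M} := fun x => `[< N x >].

Let P_closed : submod_closed P.
Proof.
case: hN => h0 h; split; first exact/asboolP.
by move=> a x y /asboolP Nx /asboolP Ny; apply/asboolP; apply: h.
Qed.

HB.instance Definition _ := GRing.isSubmodClosed.Build R M P P_closed.

Let S := {x : M | P x}.
HB.instance Definition _ := SubType.on S.
HB.instance Definition _ := [Choice of S by <:].
HB.instance Definition _ := [SubChoice_isSubLmodule of S by <:].

Lemma submod_lmod : exists (L : lmodType R) (j : {linear L -> M}),
  injective j /\ (forall x, N x <-> exists y, j y = x).
Proof.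
exists S, (val : S -> M); split; first exact: val_inj.
move=> x; split=> [Nx|[y <-]]; last exact/asboolP/(valP y).
by exists (exist _ x (asboolT Nx)).
Qed.

End SubType.

Section QuoType.
Variables (R : pzRingType) (M : lmodType R) (N : set M) (hN : submod N).

(** [xget] depends on the set alone, and congruent elements have extensionally equal cosets, so one
    representative per coset is picked; the fixed points of [rep] carry the quotient. *)
Let rep (x : M) : M := xget 0 [set y | N (x - y)].

Let repP x : N (x - rep x).
Proof. by apply: (@xgetPex _ 0 [set y | N (x - y)]); exists x; rewrite /= subrr;
    case: hN. Qed.

Let rep_eq x y : N (x - y) -> rep x = rep y.
Proof.
move=> Nxy; congr (xget 0 _); apply/predeqP => z /=; split=> h.
  by rewrite (_ : y - z = (x - z) - (x - y));
      [exact: submodB | rewrite opprB [RHS]addrC addrA subrK].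
by rewrite (_ : x - z = (x - y) + (y - z)); [exact: submodD | rewrite addrA subrK].
Qed.

Let repK x : rep (rep x) = rep x.
Proof. by apply/esym/rep_eq/repP. Qed.

Let Q := {x : M | rep x == x}.
Let pi (x : M) : Q := exist _ (rep x) (introT eqP (repK x)).

Let pi_val (u : Q) : pi (val u) = u.
Proof. by apply: val_inj => /=; apply/eqP; case: u. Qed.

Let pi_eq x y : N (x - y) -> pi x = pi y.
Proof. by move=> h; apply: val_inj => /=; apply: rep_eq. Qed.

HB.instance Definition _ := SubType.on Q.
HB.instance Definition _ := [Choice of Q by <:].

Let add (u v : Q) := pi (val u + val v).
Let opp (u : Q) := pi (- val u).
Let scale (a : R) (u : Q) := pi (a *: val u).

Let piD x y : pi (x + y) = add (pi x) (pi y).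
Proof.
apply: pi_eq; rewrite /= opprD addrACA.
by apply: submodD => //; apply: repP.
Qed.
Let piN x : pi (- x) = opp (pi x).
Proof. by apply: pi_eq; rewrite /= -opprD; apply: submodN => //; apply: repP. Qed.
Let piZ a x : pi (a *: x) = scale a (pi x).
Proof. by apply: pi_eq; rewrite /= -scalerBr; apply: submodZ => //; apply: repP. Qed.

Let addA : associative add.
Proof. by move=> u v w; rewrite -(pi_val u) -(pi_val v) -(pi_val w) -!piD addrA. Qed.
Let addC : commutative add.
Proof. by move=> u v; rewrite -(pi_val u) -(pi_val v) -!piD addrC. Qed.
Let add0 : left_id (pi 0) add.
Proof. by move=> u; rewrite -(pi_val u) -!piD add0r. Qed.
Let addN : left_inverse (pi 0) opp add.
Proof. by move=> u; rewrite -(pi_val u) -piN -!piD addNr. Qed.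

HB.instance Definition _ := GRing.isZmodule.Build Q addA addC add0 addN.

Let pi_add x y : pi (x + y) = pi x + pi y.
Proof. exact: piD. Qed.
Let scaleA a b v : scale a (scale b v) = scale (a * b) v.
Proof. by rewrite -(pi_val v) -!piZ scalerA. Qed.
Let scale1 : left_id 1 scale.
Proof. by move=> v; rewrite -(pi_val v) -!piZ scale1r. Qed.
Let scaleDr : right_distributive scale +%R.
Proof.
have h a x y : scale a (pi x + pi y) = scale a (pi x) + scale a (pi y).
  by rewrite -pi_add -!piZ -pi_add scalerDr.
by move=> a u v; rewrite -(pi_val u) -(pi_val v); apply: h.
Qed.
Let scaleDl v : {morph scale^~ v : a b / a + b}.
Proof.
have h a b x : scale (a + b) (pi x) = scale a (pi x) + scale b (pi x).
  by rewrite -!piZ -pi_add scalerDl.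
by move=> a b; rewrite -(pi_val v); apply: h.
Qed.

HB.instance Definition _ :=
  GRing.Zmodule_isLmodule.Build R Q scaleA scale1 scaleDr scaleDl.

Let pi_linear : linear pi.
Proof. by move=> a x y; rewrite piD piZ. Qed.
HB.instance Definition _ := GRing.isLinear.Build R M Q _ pi pi_linear.

Lemma quo_lmod : exists (L : lmodType R) (p : {linear M -> L}),
  (forall y, exists x, p x = y) /\ (forall x, p x = 0 <-> N x).
Proof.
exists Q, (pi : M -> Q); split; first by move=> y; exists (val y); apply: pi_val.
move=> x; split=> [h|Nx]; last by apply: pi_eq; rewrite subr0.
have e : rep x = rep 0 by have := congr1 val h.
have := repP x; rewrite e => h1.
by rewrite -[x](subrK (rep 0)); apply: submodD => //; have := submodN hN (repP 0);
    rewrite sub0r opprK.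
Qed.

End QuoType.

(** * Maps that are linear on a submodule, and subquotients *)

Section LinearOn.
Variable R : pzRingType.
Implicit Types M L : lmodType R.

Section MkLinear.
Variables (M L : lmodType R) (f : M -> L) (hf : linear f).
HB.instance Definition _ := GRing.isLinear.Build R M L _ f hf.
Lemma mk_linear : exists F : {linear M -> L}, forall x, F x = f x.
Proof. by exists f. Qed.
End MkLinear.

(** A partial linear map is kept as a total function with arbitrary values off [B]: all stages of an
    extension process then have one type, and gluing along a chain transports no domains. *)
Definition linear_on M L (B : set M) (f : M -> L) :=
  forall a x y, B x -> B y -> f (a *: x + y) = a *: f x + f y.

Lemma linear_onT M L (f : {linear M -> L}) B : linear_on B f.
Proof. by move=> a x y _ _; rewrite linearP. Qed.

Section LinearOnTheory.
Variables (M L : lmodType R) (B : set M) (f : M -> L).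
Hypotheses (hB : submod B) (hf : linear_on B f).

Lemma linear_on0 : f 0 = 0.
Proof.
case: hB => B0 _; have := hf 1 B0 B0; rewrite scaler0 addr0 scale1r.
by move=> /eqP; rewrite -subr_eq0 opprD addrA subrr sub0r oppr_eq0 => /eqP.
Qed.

Lemma linear_onD x y : B x -> B y -> f (x + y) = f x + f y.
Proof. by move=> Bx By; rewrite -[x]scale1r hf // !scale1r. Qed.

Lemma linear_onZ a x : B x -> f (a *: x) = a *: f x.
Proof.
case: hB => B0 _ Bx; rewrite -[X in f X]addr0 hf //.
by rewrite linear_on0 addr0.
Qed.

Lemma linear_onN x : B x -> f (- x) = - f x.
Proof. by move=> Bx; rewrite -scaleN1r linear_onZ // scaleN1r. Qed.

Lemma linear_onB x y : B x -> B y -> f (x - y) = f x - f y.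
Proof. by move=> Bx By; rewrite linear_onD ?linear_onN //; apply: submodN. Qed.

End LinearOnTheory.

Lemma submod_image M L (f : M -> L) B : submod B -> linear_on B f ->
  submod (f @` B).
Proof.
move=> hB hf; split; first by exists 0; [case: hB | apply: linear_on0 hf].
move=> a _ _ [x Bx <-] [y By <-]; exists (a *: x + y); last exact: hf.
by case: hB => _; apply.
Qed.

Lemma submod_preimage M L (f : {linear M -> L}) B : submod B ->
  submod (f @^-1` B).
Proof.
move=> [h0 h]; split; rewrite /preimage /= ?linear0 //.
by move=> a x y Bx By; rewrite linearP; apply: h.
Qed.

(* [q] exhibits [Q] as the subquotient B / (A `&` B); its values outside [B]
   are irrelevant. *)
Definition is_subquo M (A B : set M) (Q : lmodType R) (q : M -> Q) :=
  [/\ linear_on B q, forall z, exists2 x, B x & q x = z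
    & forall x, B x -> (q x = 0 <-> A x)].

Lemma is_subquo_exists M (A B : set M) : submod A -> submod B ->
  exists (Q : lmodType R) (q : M -> Q), is_subquo A B q.
Proof.
move=> hA hB; have [L [p [_ kerp]]] := quo_lmod hA.
have hC : submod (p @` B) by apply: submod_image => //; apply: linear_onT.
have [Q [j [j_inj jP]]] := submod_lmod hC.
have /choice[q qP] : forall x, exists z, B x -> j z = p x.
  move=> x; have [Bx|nBx] := pselect (B x); last by exists 0.
  by have /jP[z <-] : (p @` B) (p x) by [exists x]; exists z.
exists Q, q; split.
- move=> a x y Bx By; apply: j_inj; rewrite linearP !qP ?linearP //.
  by case: hB => _; apply.
- move=> z; have /jP[x Bx xz] : exists y, j y = j z by exists z.
  by exists x => //; apply: j_inj; rewrite qP.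
- move=> x Bx; rewrite -kerp -qP //; split=> [->|]; first by rewrite linear0.
  by rewrite -(linear0 j) => /j_inj.
Qed.

Lemma is_subquo_eq M (A B : set M) (Q : lmodType R) (q : M -> Q) x y :
  submod B -> is_subquo A B q -> B x -> B y -> (q x = q y <-> A (x - y)).
Proof.
move=> hB [ql _ qk] Bx By; rewrite -qk; last exact: submodB.
rewrite (linear_onB hB ql) //; split=> [->|/eqP]; first by rewrite subrr.
by rewrite subr_eq0 => /eqP.
Qed.

Lemma is_subquo_lift M (A B : set M) (Q L : lmodType R) (q : M -> Q)
    (g : M -> L) : submod B -> is_subquo A B q -> linear_on B g ->
  (forall x, B x -> A x -> g x = 0) ->
  exists G : {linear Q -> L}, forall x, B x -> G (q x) = g x.
Proof.
move=> hB hq hg gA; have [ql qs qk] := hq.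
have /choice[s sP] : forall z, exists x, B x /\ q x = z.
  by move=> z; have [x Bx <-] := qs z; exists x.
have gP x y : B x -> B y -> q x = q y -> g x = g y.
  move=> Bx By; rewrite (is_subquo_eq hB hq) // => Axy.
  by apply/eqP; rewrite -subr_eq0 -(linear_onB hB hg) // gA //; apply: submodB.
have glin : linear (g \o s).
  move=> a z w /=; have [[Bz z1] [Bw w1]] := (sP z, sP w).
  have [Bzw zw1] := sP (a *: z + w); have [_ hB2] := hB.
  by rewrite -hg //; apply: gP => //; [apply: hB2 | rewrite zw1 ql // z1 w1].
have [G GE] := mk_linear glin; exists G => x Bx; rewrite GE /=.
by have [Bs s1] := sP (q x); apply: gP.
Qed.

(** A subquotient of images under [q] is recognised before taking images: [r] descends along [q] as
    soon as it kills what [q] kills. This identifies the layers of a cokernel in the cell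
    construction. *)
Lemma is_subquo_image M (Q L : lmodType R) (q : M -> Q)
    (N N' : set M) (r : M -> L) :
  submod N' -> linear_on N' q -> linear_on N' r ->
  (forall z, exists2 x, N' x & r x = z) ->
  (forall v, N' v -> q v = 0 -> r v = 0) ->
  (forall v, N' v -> (r v = 0 <-> (q @` N) (q v))) ->
  exists r' : Q -> L, is_subquo (q @` N) (q @` N') r'
    /\ forall v, N' v -> r' (q v) = r v.
Proof.
move=> hN' ql rl rs qr rk.
have /choice[s sP] : forall z, exists x, (q @` N') z -> N' x /\ q x = z.
  move=> z; have [[x Nx <-]|nz] := pselect ((q @` N') z); first by exists x.
  by exists 0.
have rP x y : N' x -> N' y -> q x = q y -> r x = r y.
  move=> Nx Ny e; apply/eqP; rewrite -subr_eq0 -(linear_onB hN' rl) //.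
  rewrite qr //; first exact: submodB.
  by rewrite (linear_onB hN' ql) // e subrr.
have rsP v : N' v -> r (s (q v)) = r v.
  by move=> Nv; have [|? ?] := sP (q v); [exists v | apply: rP].
exists (r \o s); split=> //; split=> /=.
- move=> a _ _ [x Nx <-] [y Ny <-]; have [_ h] := hN'.
  by rewrite /= -ql // !rsP // ?rl //; apply: h.
- by move=> z; have [x Nx <-] := rs z; exists (q x); [exists x | apply: rsP].
- by move=> _ [x Nx <-]; rewrite /= rsP // rk.
Qed.

End LinearOn.

(** * Finitely supported functions: direct sums of copies of a module *)

Section Fsup.
Variables (R : pzRingType) (X : smallType) (M : lmodType R).

Definition finsupp (f : X -> M) :=
  exists s : seq {classic X}, forall x, f x <> 0 -> (x : {classic X}) \in s.

Lemma finsupp_submod : submod (finsupp : set (X -> M)).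
Proof.
split; first by exists [::] => x.
move=> a f g [s sP] [t tP]; exists (s ++ t) => x; rewrite mem_cat => h.
have [fx|/sP->//] := pselect (f x = 0).
have [gx|/tP->] := pselect (g x = 0); last by rewrite orbT.
have e : (a *: f + g) x = a *: f x + g x by [].
by case: h; rewrite e fx gx scaler0 addr0.
Qed.

Let fsup_sig := cid (submod_lmod finsupp_submod).
Let fv_sig := cid (projT2 fsup_sig).

Definition fsup : lmodType R := projT1 fsup_sig.
Definition fval (u : fsup) (x : X) : M := projT1 fv_sig u x.

Lemma fval_lin a u v x : fval (a *: u + v) x = a *: fval u x + fval v x.
Proof. by rewrite /fval linearP. Qed.

Lemma fval0 x : fval 0 x = 0.
Proof. by rewrite /fval linear0. Qed.

Lemma fvalD u v x : fval (u + v) x = fval u x + fval v x.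
Proof. by rewrite /fval linearD. Qed.

Lemma fvalB u v x : fval (u - v) x = fval u x - fval v x.
Proof. by rewrite /fval linearB. Qed.

Lemma fsupP u v : (forall x, fval u x = fval v x) -> u = v.
Proof. by move=> h; apply: (projT2 fv_sig).1; apply/funext. Qed.

Lemma fsup_finsupp u : finsupp (fval u).
Proof. by apply/(projT2 fv_sig).2; exists u. Qed.

Lemma mk_fsup (f : X -> M) : finsupp f -> exists u, forall x, fval u x = f x.
Proof. by move=> /(projT2 fv_sig).2[u e]; exists u => x; rewrite -e. Qed.

Lemma fsum_val (I : Type) (s : seq I) (F : I -> fsup) x :
  fval (\sum_(i <- s) F i) x = \sum_(i <- s) fval (F i) x.
Proof.
by elim/big_rec2: _ => [|i y z _ <-]; rewrite ?fval0 ?fvalD.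
Qed.

Lemma delta_subproof (x : X) (m : M) :
  exists u, forall y, fval u y = if `[< x = y >] then m else 0.
Proof. by apply: mk_fsup; exists [:: x] => y; case: asboolP => //= e _;
    rewrite e inE eqxx. Qed.

Definition delta x m := projT1 (cid (delta_subproof x m)).

Lemma deltaE x m y : fval (delta x m) y = if `[< x = y >] then m else 0.
Proof. exact: (projT2 (cid (delta_subproof x m))). Qed.

Lemma delta_same x m : fval (delta x m) x = m.
Proof. by rewrite deltaE; case: asboolP. Qed.

Lemma delta_diff x y m : x <> y -> fval (delta x m) y = 0.
Proof. by rewrite deltaE; case: asboolP. Qed.

Lemma delta_lin x : linear (delta x).
Proof.
move=> a m m'; apply: fsupP => y; rewrite fval_lin !deltaE.
by case: asboolP => //; rewrite scaler0 addr0.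
Qed.

Definition on (D : set X) (u : fsup) := forall x, fval u x <> 0 -> D x.

Lemma on_submod D : submod (on D).
Proof.
split; first by move=> x; rewrite fval0.
move=> a u v uD vD x; rewrite fval_lin => h.
have [u0|/uD//] := pselect (fval u x = 0).
by apply: vD => v0; apply: h; rewrite u0 v0 scaler0 addr0.
Qed.

Lemma onS (D D' : set X) u : D `<=` D' -> on D u -> on D' u.
Proof. by move=> DD' uD x /uD/DD'. Qed.

Lemma on_delta (D : set X) x m : D x -> on D (delta x m).
Proof. by move=> Dx y; rewrite deltaE; case: asboolP => // <-. Qed.

Lemma on_notin (D : set X) u x : on D u -> ~ D x -> fval u x = 0.
Proof. by move=> uD nD; apply: contrapT => /uD. Qed.

Lemma fsup_sum u : exists2 s : seq {classic X},
  uniq s & (forall x : X, fval u x <> 0 <-> (x : {classic X}) \in s) /\ u =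
      \sum_(x <- s) delta x (fval u x).
Proof.
have [s0 s0P] := fsup_finsupp u.
pose s := undup [seq x : {classic X} <- s0 | fval u x != 0].
have sP (x : X) : fval u x <> 0 <-> (x : {classic X}) \in s.
  rewrite mem_undup mem_filter; split=> [h|/andP[/eqP]//].
  by rewrite (introN eqP h) s0P.
exists s; first exact: undup_uniq.
split=> //; apply: fsupP => x; rewrite fsum_val.
have [xs|xs] := boolP ((x : {classic X}) \in s).
  rewrite (bigD1_seq (x : {classic X})) ?undup_uniq //=
      delta_same big1 ?addr0 // => y /eqP yx.
  exact: delta_diff.
rewrite big_seq big1.
  by apply: contrapT => /sP h; rewrite h in xs.
by move=> y ys; rewrite delta_diff // => yx; rewrite -yx ys in xs.
Qed.

(** The induction principle for finite sums. Its hypothesis concerns only the components of [u]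
    itself, so a support condition on [u] is available at each of them. *)
Lemma fsup_ind_sub u (N : set fsup) : submod N ->
  (forall x, fval u x <> 0 -> N (delta x (fval u x))) -> N u.
Proof.
move=> hN h; have [s _ [sP ->]] := fsup_sum u; rewrite big_seq.
by apply: submod_sum => // x /sP; apply: h.
Qed.

End Fsup.

Section FsupLift.
Variables (R : pzRingType) (X : smallType) (M L : lmodType R).

Lemma linear_eq_submod (U V : lmodType R) (f g : {linear U -> V}) :
  submod [set u | f u = g u].
Proof. by split=> [|a x y /= e e']; rewrite /= ?linear0 // !linearP e e'. Qed.

Lemma fsup_eq (f g : {linear fsup X M -> L}) :
  (forall x m, f (delta x m) = g (delta x m)) -> forall u, f u = g u.
Proof.
move=> h u; apply: (fsup_ind_sub (N := [set u | f u = g u]));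
    first exact: linear_eq_submod.
by move=> x _; apply: h.
Qed.

Lemma fsup_lift (g : X -> M -> L) : (forall x, linear (g x)) ->
  exists G : {linear fsup X M -> L}, forall x m, G (delta x m) = g x m.
Proof.
move=> gl; have g0 x : g x 0 = 0 by have [f <-] := mk_linear (gl x); rewrite linear0.
pose covers (s : seq {classic X}) (u : fsup X M) :=
  forall x : X, fval u x <> 0 -> (x : {classic X}) \in s.
have /choice[S SP] : forall u, exists s, uniq s /\ covers s u.
  by move=> u; have [s us [sP _]] := fsup_sum u; exists s; split=> // x /sP.
pose G u := \sum_(x <- S u) g x (fval u x).
(* The sum may run over any duplicate-free list that covers the support; linearity follows by taking
   one list common to all the elements involved. *)
have GE u s : uniq s -> covers s u -> G u = \sum_(x <- s) g x (fval u x).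
  move=> us sP; have [uS SuP] := SP u.
  rewrite /G (bigID (fun x : {classic X} => fval u x == 0)) /= big1 ?add0r;
      last by move=> x /eqP ->.
  rewrite [RHS](bigID (fun x : {classic X} => fval u x == 0)) /= [X in _ =
      X + _]big1 ?add0r; last first.
    by move=> x /eqP ->.
  rewrite -[LHS]big_filter -[RHS]big_filter; apply: perm_big; apply: uniq_perm;
      rewrite ?filter_uniq //.
  by move=> x; rewrite !mem_filter; case: eqP => //= h; rewrite sP // SuP.
have Gl : linear G.
  move=> a u v; pose s := undup (S u ++ S v).
  have us : uniq s by apply: undup_uniq.
  have [[_ uP] [_ vP]] := (SP u, SP v).
  rewrite (GE u s) ?(GE v s) ?(GE (a *: u + v) s) //.
  - by rewrite scaler_sumr -big_split /=; apply: eq_bigr => x _; rewrite fval_lin gl.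
  - move=> x; rewrite fval_lin mem_undup mem_cat => h.
    have [ux|/uP->//] := pselect (fval u x = 0).
    rewrite vP ?orbT // => vx; apply: h.
    by rewrite ux vx scaler0 addr0.
  - by move=> x /vP; rewrite mem_undup mem_cat orbC => ->.
  - by move=> x /uP; rewrite mem_undup mem_cat => ->.
have [F FE] := mk_linear Gl; exists F => x m; rewrite FE (GE _ [:: x]) //.
  by rewrite big_seq1 delta_same.
by move=> y; rewrite deltaE; case: asboolP => //= e _; rewrite e inE eqxx.
Qed.

End FsupLift.

Section FsupMap.
Variables (R : pzRingType).

Lemma fsup_map (X : smallType) (M L : lmodType R) (f : {linear M -> L}) :
  exists F : {linear fsup X M -> fsup X L}, forall u x, fval (F u) x = f (fval u x).
Proof.
have h (u : fsup X M) : exists v : fsup X L, forall x, fval v x = f (fval u x).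
  apply: mk_fsup; have [s sP] := fsup_finsupp u; exists s => x fx.
  by apply: sP => ux; apply: fx; rewrite ux linear0.
have [F FE] := choice h.
have Fl : linear F by move=> a u v; apply: fsupP => x;
    rewrite fval_lin !FE fval_lin linearP.
by have [G GE] := mk_linear Fl; exists G => u x; rewrite GE FE.
Qed.

Lemma fsup_restr (X : smallType) (M : lmodType R) (D : set X) :
  exists F : {linear fsup X M -> fsup {x | D x} M},
    forall u x, fval (F u) x = fval u (sval x).
Proof.
have h (u : fsup X M) : exists v : fsup {x | D x} M, forall x, fval v x = fval u (sval x).
  apply: mk_fsup; have [s _ [sP _]] := fsup_sum u.
  pose f (x : {classic X}) : option {classic {x | D x}} :=
    match pselect (D x) with left p => Some (exist _ x p) | right _ => None end.
  exists (pmap f s) => -[x Dx] /= /sP xs.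
  rewrite mem_pmap; apply/mapP; exists (x : {classic X}) => //.
  by rewrite /f; case: pselect => // p; congr Some; apply: eq_exist.
have [F FE] := choice h.
have Fl : linear F by move=> a u v; apply: fsupP => x; rewrite fval_lin !FE fval_lin.
by have [G GE] := mk_linear Fl; exists G => u x; rewrite GE FE.
Qed.

Lemma fsup_ext (X : smallType) (M : lmodType R) (D : set X) :
  exists F : {linear fsup {x | D x} M -> fsup X M},
    (forall u (x : {x | D x}), fval (F u) (sval x) = fval u x) /\
    (forall u, on D (F u)).
Proof.
have [F FE] := fsup_lift (fun x : {x | D x} => @delta_lin R X M (sval x)).
exists F; split=> u.
  apply: (fsup_ind_sub (N := [set u | forall x : {x | D x}, fval (F u) (sval x) =
      fval u x])).
    split=> [x|a v w hv hw x] /=; first by rewrite linear0 !fval0.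
    by rewrite linearP !fval_lin hv hw.
  move=> x _ y /=; rewrite FE !deltaE; case: asboolP => [e|ne]; case: asboolP => //.
    by move=> ne; case: ne; case: x y e => [x Dx] [y Dy] /= e; apply: eq_exist.
  by move=> e; case: ne; rewrite e.
apply: (fsup_ind_sub (N := F @^-1` on D)); first exact/submod_preimage/on_submod.
by move=> [x Dx] _; rewrite /preimage /= FE; apply: on_delta.
Qed.

End FsupMap.

(** * Free modules, syzygies and projective dimension *)

Section Pdim.
Variable R : pzRingType.
Implicit Types M L A B P Q F U V : lmodType R.

Definition freemod (X : smallType) : lmodType R := fsup X R^o.

Lemma gen_subproof (X : smallType) M (g : X -> M) :
  exists G : {linear freemod X -> M}, forall x r, G (delta x r) = (r : R) *: g x.
Proof.
by apply: (@fsup_lift R X R^o M (fun x r => (r : R) *: g x)) => x a r s;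
    rewrite scalerDl scalerA.
Qed.

Definition gen (X : smallType) M (g : X -> M) := projT1 (cid (gen_subproof g)).

Lemma gen_delta (X : smallType) M (g : X -> M) x r : gen g (delta x r) = (r : R) *: g x.
Proof. exact: (projT2 (cid (gen_subproof g))). Qed.

Definition bas (X : smallType) (x : X) : freemod X := delta x (1 : R^o).

Lemma gen_bas (X : smallType) M (g : X -> M) x : gen g (bas x) = g x.
Proof. by rewrite /bas gen_delta scale1r. Qed.

Lemma delta_bas (X : smallType) x (r : R^o) : delta x r = (r : R) *: bas x :> freemod X.
Proof.
have [f fE] := mk_linear (@delta_lin R X R^o x).
by rewrite /bas -!fE -linearZ; congr (f _); apply/esym/(mulr1 (r : R)).
Qed.

Lemma free_eq (X : smallType) M (f g : {linear freemod X -> M}) :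
  (forall x, f (bas x) = g (bas x)) -> forall u, f u = g u.
Proof.
by move=> h; apply: fsup_eq => x r; rewrite delta_bas !linearZ h.
Qed.

Definition ses L F M (j : {linear L -> F}) (p : {linear F -> M}) :=
  [/\ injective j, forall y, exists x, p x = y
    & forall x, p x = 0 <-> exists y, j y = x].

Lemma ses_lift L F M (j : {linear L -> F}) (p : {linear F -> M}) A (f : {linear A -> F}) :
  ses j p -> (forall u, p (f u) = 0) ->
  exists h : {linear A -> L}, forall u, j (h u) = f u.
Proof.
move=> [ji _ jk] pf; have /choice[h hE] : forall u, exists y, j y = f u.
  by move=> u; apply/jk.
have hl : linear h by move=> a u v; apply: ji; rewrite linearP !hE linearP.
by have [H HE] := mk_linear hl; exists H => u; rewrite HE.
Qed.

Lemma ker_ses F M (p : {linear F -> M}) : (forall y, exists x, p x = y) ->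
  exists L (j : {linear L -> F}), ses j p.
Proof.
move=> ps; have hk : submod (p @^-1` [set 0]) by apply: submod_preimage; apply: submod0.
by have [L [j [ji jk]]] := submod_lmod hk; exists L, j.
Qed.

(** Taking all elements as generators makes the cover functorial in [M], and lets every set of
    elements of [M] cut out a submodule of the cover and of its kernel. *)
Definition eps M : {linear freemod M -> M} := gen (id : M -> M).

Lemma eps_surj M y : exists x, eps M x = y.
Proof. by exists (bas y); rewrite /eps gen_bas. Qed.

Let om_sig M := cid (ker_ses (@eps_surj M)).
Definition om M : lmodType R := projT1 (om_sig M).
Definition om_in M : {linear om M -> freemod M} := projT1 (cid (projT2 (om_sig M))).
Lemma om_ses M : ses (om_in M) (eps M).
Proof. exact: (projT2 (cid (projT2 (om_sig M)))). Qed.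

Definition retract A B :=
  exists (i : {linear A -> B}) (r : {linear B -> A}), forall x, r (i x) = x.

Lemma retract_trans A B L : retract A B -> retract B L -> retract A L.
Proof.
move=> [i [r ri]] [i' [r' ri']].
exists (i' \o i : {linear A -> L}), (r \o r' : {linear L -> A}) => x /=.
by rewrite ri' ri.
Qed.

Lemma projective_free (X : smallType) : projective (freemod X).
Proof.
move=> A B p f ps; have /choice[s sP] : forall x, exists a, p a = f (bas x).
  by move=> x; apply: ps.
exists (gen s) => u.
apply: (free_eq (f := p \o gen s : {linear freemod X -> B}) (g := f)) => x /=.
by rewrite gen_bas.
Qed.

Lemma projective_retract A B : retract A B -> projective B -> projective A.
Proof.
move=> [i [r ri]] hB U V p f ps.
have [g gE] := hB U V p (f \o r : {linear B -> V}) ps.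
by exists (g \o i : {linear A -> U}) => x /=; rewrite gE /= ri.
Qed.

Lemma inl_linear A B : exists f : {linear A -> (A * B)%type}, forall x, f x = (x, 0).
Proof.
apply: (@mk_linear R A (A * B)%type (fun x => (x, 0))) => a x y;
    apply: injective_projections => //=.
by rewrite scaler0 addr0.
Qed.

Lemma inr_linear A B : exists f : {linear B -> (A * B)%type}, forall x, f x = (0, x).
Proof.
apply: (@mk_linear R B (A * B)%type (fun x => (0, x))) => a x y;
    apply: injective_projections => //=.
by rewrite scaler0 addr0.
Qed.

Lemma pair_linear U A B (f : {linear U -> A}) (g : {linear U -> B}) :
  exists h : {linear U -> (A * B)%type}, forall x, h x = (f x, g x).
Proof.
have hl : linear (fun x => (f x, g x) : (A * B)%type).
  by move=> a x y; apply: injective_projections => /=; rewrite linearP.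
by have [h hE] := mk_linear hl; exists h.
Qed.

Lemma copair_linear U A B (f : {linear A -> U}) (g : {linear B -> U}) :
  exists h : {linear (A * B)%type -> U}, forall x, h x = f x.1 + g x.2.
Proof.
by apply: (@mk_linear R (A * B)%type U (fun x => f x.1 + g x.2)) => a x y /=;
    rewrite !linearP scalerDr addrACA.
Qed.

Lemma fst_linear A B : exists f : {linear (A * B)%type -> A}, forall x, f x = x.1.
Proof. by apply: (@mk_linear R (A * B)%type A (fun x => x.1)). Qed.

Lemma snd_linear A B : exists f : {linear (A * B)%type -> B}, forall x, f x = x.2.
Proof. by apply: (@mk_linear R (A * B)%type B (fun x => x.2)). Qed.

Lemma projective_prod A B : projective A -> projective B -> projective (A * B)%type.
Proof.
move=> hA hB U V p f ps.
have [i iE] := inl_linear A B; have [k kE] := inr_linear A B.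
have [g gE] := hA U V p (f \o i : {linear A -> V}) ps.
have [h hE] := hB U V p (f \o k : {linear B -> V}) ps.
have [q qE] := copair_linear g h; exists q => -[x y].
rewrite qE linearD gE hE /= iE kE -linearD; congr (f _).
by apply: injective_projections; rewrite /= ?addr0 ?add0r.
Qed.

(** With comparison maps [phi] and [psi] as in Schanuel's lemma, y - psi (phi y) lies in the kernel
    of [p]. The section is x |-> (a x, j x), where [a] is induced by [phi], and the retraction is
    (l, y) |-> psi (j' l) + (y - psi (phi y)), read in [L]. *)
Lemma schanuel_retract L F M L' F' (j : {linear L -> F}) (p : {linear F -> M})
    (j' : {linear L' -> F'}) (p' : {linear F' -> M}) :
  ses j p -> ses j' p' -> projective F -> projective F' ->
  retract L (L' * F)%type.
Proof.
move=> s s' hF hF'; have [[ji ps jk] [ji' ps' jk']] := (s, s').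
have [phi phiE] := hF _ _ p' p ps'; have [psi psiE] := hF' _ _ p p' ps.
have pj x : p (j x) = 0 by apply/jk; exists x.
have pj' x : p' (j' x) = 0 by apply/jk'; exists x.
have [a aE] : exists h : {linear L -> L'}, forall u, j' (h u) = phi (j u).
  by apply: (ses_lift (f := phi \o j : {linear L -> F'}) s') => u; rewrite /= phiE.
have [i iE] := pair_linear a j.
have [f fE] : exists f : {linear (L' * F)%type -> F},
    forall x, f x = psi (j' x.1) + (x.2 - psi (phi x.2)).
  apply: (@mk_linear R (L' * F)%type F (fun x => psi (j' x.1) + (x.2 - psi (phi x.2))))
      => c x y /=.
  rewrite !scalerDr !linearP [RHS]addrACA; congr (_ + _); exact: addrACA.
have [r rE] : exists h : {linear (L' * F)%type -> L}, forall u, j (h u) = f u.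
  by apply: (ses_lift s) => u; rewrite fE linearD linearB !psiE phiE pj' subrr addr0.
exists i, r => x; apply: ji; rewrite rE fE iE /= aE addrC subrK //.
Qed.
End Pdim.

Arguments bas {R X} x.

Section Pdim2.
Variable R : pzRingType.
Local Notation freemod := (freemod R).
Implicit Types M L A B P Q F U V : lmodType R.

Lemma om_map A B (f : {linear A -> B}) : exists g : {linear om A -> om B},
  forall u, om_in B (g u) = gen (fun x => bas (f x)) (om_in A u).
Proof.
pose F : {linear freemod A -> freemod B} := gen (fun x : A => bas (f x)).
apply: (ses_lift (f := F \o om_in A : {linear om A -> freemod B}) (om_ses B)) => u /=.
have -> : eps B (F (om_in A u)) = f (eps A (om_in A u)).
  apply: (free_eq (f := eps B \o F : {linear _ -> _}) (g := f \o eps A : {linear _ ->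
      _})) => x /=.
  by rewrite /F /eps !gen_bas.
have [_ _ h] := om_ses A; have -> : eps A (om_in A u) = 0 by apply/h; exists u.
exact: linear0.
Qed.

Lemma om_retract A B : retract A B -> retract (om A) (om B).
Proof.
move=> [i [r ri]]; have [f fE] := om_map i; have [g gE] := om_map r.
exists f, g => x; have [ji _ _] := om_ses A; apply: ji; rewrite gE fE.
apply: (free_eq (f := gen (fun x => bas (r x)) \o gen (fun x => bas (i x)) :
    {linear _ -> _})
  (g := idfun : {linear freemod A -> freemod A})) => y /=.
by rewrite !gen_bas ri.
Qed.

(** Syzygies are determined up to projective summands. This relation is preserved by [om] and
    carries projectivity from [B] to [A], so projective dimension can be read off any
    presentation. *)
Definition stable_retract A B :=
  exists P, projective P /\ retract A (B * P)%type.

Lemma om_stable_retract A B : stable_retract A B -> stable_retract (om A) (om B).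
Proof.
move=> [P [hP /om_retract h]]; pose BP : lmodType R := (B * P)%type.
exists (freemod BP); split; first exact: projective_free.
apply: retract_trans h _.
have hF : projective (freemod B * P)%type.
  by apply: projective_prod => //; apply: projective_free.
have [i iE] := inl_linear (freemod B) P.
(* Adding the identity of [P] to the cover of [B] does not change the kernel [om B]; Schanuel
   compares this presentation of B * P with the canonical one. *)
have [p pE] : exists p : {linear (freemod B * P)%type -> BP}, forall x, p x =
    (eps B x.1, x.2).
  have [f fE] := fst_linear (freemod B) P; have [g gE] := snd_linear (freemod B) P.
  have [h1 hE] := pair_linear (eps B \o f : {linear (freemod B * P)%type -> B}) g.
  by exists h1 => x; rewrite hE /= fE gE.
have [ji js jk] := om_ses B.
apply: (schanuel_retract (om_ses BP) (p' := p) (j' := i \o om_in B : {linear om B ->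
    (freemod B * P)%type})) => //; last exact: projective_free.
split.
- by move=> x y /=; rewrite !iE => -[] /ji.
- by move=> [b c]; have [x xb] := js b; exists (x, c); rewrite pE /= xb.
- move=> [x c]; rewrite pE /=; split.
    by move=> [] /jk[y <-] ->; exists y; rewrite iE.
  by move=> [y]; rewrite iE => -[<- <-]; congr pair; apply/jk; exists y.
Qed.

Lemma projective_stable_retract A B : stable_retract A B -> projective B -> projective A.
Proof.
move=> [P [hP h]] hB; apply: projective_retract h _; exact: projective_prod.
Qed.

Definition pdim n M := projective (iter n (@om R) M).

Lemma pdim_stable_retract n A B : stable_retract A B -> pdim n B -> pdim n A.
Proof.
move=> h; apply: projective_stable_retract.
by elim: n => //= n; apply: om_stable_retract.
Qed.

Lemma retract_stable A B : retract A B -> stable_retract A B.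
Proof.
move=> h; exists (freemod void); split; first exact: projective_free.
apply: retract_trans h _.
have [i iE] := inl_linear B (freemod void); have [r rE] := fst_linear B (freemod void).
by exists i, r => x; rewrite rE iE.
Qed.

Lemma pdim_retract n A B : retract A B -> pdim n B -> pdim n A.
Proof. by move=> /retract_stable; apply: pdim_stable_retract. Qed.

Lemma pdim_om n M : pdim n (om M) <-> pdim n.+1 M.
Proof. by rewrite /pdim iterSr. Qed.

Section Syzygy.
Variables (L F M : lmodType R) (j : {linear L -> F}) (p : {linear F -> M}).
Hypotheses (s : ses j p) (hF : projective F).

Lemma pdim_syzygy n : pdim n L <-> pdim n.+1 M.
Proof.
rewrite -pdim_om; split; apply: pdim_stable_retract.
  exists (freemod M); split; first exact: projective_free.
  by apply: (schanuel_retract (om_ses M) s) => //; apply: projective_free.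
exists F; split => //.
by apply: (schanuel_retract s (om_ses M)) => //; apply: projective_free.
Qed.
End Syzygy.

Lemma zero_linear A B : exists f : {linear A -> B}, forall x, f x = 0.
Proof. by exists (\0 : {linear A -> B}). Qed.

Lemma projective_pdim n M : projective M -> pdim n M.
Proof.
elim: n M => [//|n IH] M hM.
have [i iE] := zero_linear (freemod void) M.
have v0 (u : freemod void) : u = 0 by apply: fsupP => -[].
have s : ses i (idfun : {linear M -> M}).
  split=> [x y _|y|x]; first by rewrite [x]v0 [y]v0.
    by exists y.
  by split=> [/= ->|[y <-]]; [exists 0; rewrite iE | rewrite iE].
apply/(pdim_syzygy s hM)/IH; exact: projective_free.
Qed.

End Pdim2.

(** * Resolutions and canonical syzygies *)

Section Bridge.
Variable R : pzRingType.
Implicit Types M L A B P F U V : lmodType R.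

(** [Q] is left open so that the same splicing serves for projective terms and for small sums of
    countably generated projectives. *)
Definition has_resolution (Q : lmodType R -> Prop) n M :=
  exists F : resolution n M, forall k, (k <= n)%N -> Q (F k).

Section Cons.
Variables (L F M : lmodType R) (j : {linear L -> F}) (p : {linear F -> M}).
Hypothesis s : ses j p.
Variables (n : nat) (G : resolution n L).

Let obj k := match k with 0%N => F | k.+1 => G k end.
Let diff k : {linear obj k.+1 -> obj k} :=
  match k with
  | 0%N => (j \o res_aug G : {linear G 0%N -> F})
  | k.+1 => res_diff G k
  end.

Let exact0 y : p y = 0 <-> exists z, diff 0 z = y.
Proof.
have [ji _ jk] := s; rewrite jk; split=> [[x <-]|[z <-]]; last by exists (res_aug G z).
by have [z <-] := res_aug_surj G x; exists z.
Qed.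

Let exactS k (y : obj k.+1) : diff k y = 0 <-> exists z, diff k.+1 z = y.
Proof.
case: k y => [|k] y; last exact: (@res_exactS _ _ _ G).
have [ji _ _] := s; rewrite -(@res_exact0 _ _ _ G) /=; split=> [|->]; last exact: linear0.
by rewrite -(linear0 j) => /ji.
Qed.

Let length k : (n.+1 < k)%N -> forall y : obj k, y = 0.
Proof. by case: k => // k nk y; apply: (@res_length _ _ _ G k nk y). Qed.

Definition resolution_cons : resolution n.+1 M :=
  @Resolution R n.+1 M obj diff p (let: And3 _ h _ := s in h) exact0 exactS length.
End Cons.

Lemma has_resolution_cons Q n L F M (j : {linear L -> F}) (p : {linear F -> M}) :
  ses j p -> Q F -> has_resolution Q n L -> has_resolution Q n.+1 M.
Proof.
move=> s QF [G QG]; exists (resolution_cons s G) => -[|k] //=.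
by rewrite ltnS; apply: QG.
Qed.

Lemma has_resolution_uncons (Q : lmodType R -> Prop) n M : has_resolution Q n.+1 M ->
  exists L F (j : {linear L -> F}) (p : {linear F -> M}),
    [/\ ses j p, Q F & has_resolution Q n L].
Proof.
move=> [G QG]; have [L [j s]] := ker_ses (@res_aug_surj _ _ _ G).
exists L, (G 0%N), j, (res_aug G); split=> //; first exact: QG.
have [a aE] : exists h : {linear G 1%N -> L}, forall u, j (h u) = res_diff G 0 u.
  by apply: (ses_lift s) => u; apply/(@res_exact0 _ _ _ G); exists u.
have [ji js jk] := s.
have h1 x : exists y, a y = x.
  have [|z zx] := (@res_exact0 _ _ _ G (j x)).1; first by apply/jk; exists x.
  by exists z; apply: ji; rewrite aE.
have h2 y : a y = 0 <-> exists z, res_diff G 1 z = y.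
  rewrite -(@res_exactS _ _ _ G) -aE; split=> [->|]; first exact: linear0.
  by rewrite -(linear0 j) => /ji.
have h3 k : (n < k)%N -> forall y : G k.+1, y = 0.
  by move=> nk y; apply: (@res_length _ _ _ G k.+1 nk y).
exists (@Resolution R n L (fun k => G k.+1) (fun k => res_diff G k.+1) a h1 h2
  (fun k => @res_exactS _ _ _ G k.+1) h3) => k kn /=; exact: QG.
Qed.

Lemma has_resolution0 (Q : lmodType R -> Prop) M : Q M -> has_resolution Q 0 M.
Proof.
move=> QM.
pose obj k := if k is 0%N then M else freemod R void.
have v0 (u : freemod R void) : u = 0 by apply: fsupP => -[].
pose diff k : {linear obj k.+1 -> obj k} := \0.
have h0 (y : M) : idfun y = 0 <-> exists z, diff 0 z = y.
  by split=> [/= ->|[z <-]] //; exists 0.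
have hS k (y : obj k.+1) : diff k y = 0 <-> exists z, diff k.+1 z = y.
  by split=> // _; exists 0; rewrite [y]v0.
have hl k : (0 < k)%N -> forall y : obj k, y = 0 by case: k.
by exists (@Resolution R 0 M obj diff idfun (fun x => ex_intro _ x erefl) h0 hS hl) =>
    -[].
Qed.

Lemma has_resolution0_inv (Q : lmodType R -> Prop) M : has_resolution Q 0 M ->
  exists F (f : {linear F -> M}), [/\ Q F, injective f & forall y, exists x, f x = y].
Proof.
move=> [G QG]; exists (G 0%N), (res_aug G); split; first exact: QG.
  move=> x y e; apply/eqP; rewrite -subr_eq0; apply/eqP.
  have : res_aug G (x - y) = 0 by rewrite linearB /= e subrr.
  by move=> /(@res_exact0 _ _ _ G)[z <-]; rewrite (@res_length _ _ _ G 1%N isT z) linear0.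
exact: res_aug_surj.
Qed.

Lemma bijective_retract A B (f : {linear A -> B}) : injective f ->
  (forall y, exists x, f x = y) -> retract A B /\ retract B A.
Proof.
move=> fi fs; have /choice[g gE] := fs.
have gl : linear g by move=> a x y; apply: fi; rewrite linearP !gE.
have [G GE] := mk_linear gl; split; [exists f, G | exists G, f] => x; rewrite GE //.
by apply: fi.
Qed.

Lemma projdim_leE n M : projdim_le n M <-> pdim n M.
Proof.
elim: n M => [|n IH] M; split.
- move=> /(@has_resolution0_inv (@projective R))[F [f [hF fi fs]]].
  by have [_ /projective_retract] := bijective_retract fi fs; apply.
- exact: (@has_resolution0 (@projective R)).
- move=> /(@has_resolution_uncons (@projective R))[L [F [j [p [s hF hL]]]]].
  by apply/(pdim_syzygy s hF)/IH.
- move=> h; apply: (has_resolution_cons (om_ses M)); first exact: projective_free.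
  by apply/IH/pdim_om.
Qed.

End Bridge.

(** * Transfinite filtrations *)

Section Zorn.
Variables (C : Type) (H : set (set C)).

Definition chain_in (F : set (set C)) :=
  [/\ F `<=` H, F !=set0 & total_on F subset].

Definition filtration (U : Type) (N : set C -> set U) :=
  (forall D D', D `<=` D' -> N D `<=` N D') /\
  (forall F, chain_in F -> N (\bigcup_(D in F) D) `<=` \bigcup_(D in F) N D).

(** Zorn's lemma on pairs (D, g), ordered by inclusion and by agreement on the smaller [N D]. As [g]
    is total, the bound of a chain takes the values of [g0] outside all [N D]; hence the hypothesis
    that [ok] sees only the values on [N D]. *)
Lemma zorn_family (U : Type) (A : U -> Type) (N : set C -> set U)
    (ok : set C -> (forall u, A u) -> Prop) (D0 top : set C) (g0 : forall u, A u) :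
  filtration N ->
  (forall F, chain_in F -> H (\bigcup_(D in F) D)) ->
  (forall F g, chain_in F -> (forall D, F D -> ok D g) ->
     ok (\bigcup_(D in F) D) g) ->
  (forall D g g', H D -> (forall u, N D u -> g u = g' u) -> ok D g -> ok D g') ->
  H D0 -> ok D0 g0 ->
  (forall D g, H D -> ok D g -> D <> top -> exists D' g',
     [/\ H D', D `<=` D', D' <> D, ok D' g' & forall u, N D u -> g' u = g u]) ->
  exists g, ok top g.
Proof.
move=> [Nmono Ncont] Hch okch okloc HD0 ok0 step.
pose T := {x : set C * (forall u, A u) | H x.1 /\ ok x.1 x.2}.
pose rel_ (x y : T) := (sval x).1 `<=` (sval y).1 /\
  forall u, N (sval x).1 u -> (sval y).2 u = (sval x).2 u.
pose r (x y : T) := `[< rel_ x y >].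
pose t0 : T := exist _ (D0, g0) (conj HD0 ok0).
have [|||t tmax] := @ZL_preorder T t0 r.
- by move=> t; apply/asboolP; split.
- move=> y x z /asboolP[xy xy'] /asboolP[yz yz']; apply/asboolP; split.
    exact: subset_trans yz.
  by move=> u xu; rewrite yz' ?xy' //; apply: Nmono xu.
- move=> E Etot; have [[e0 Ee0]|nE] := pselect (E !=set0); last first.
    by exists t0 => s Es; case: nE; exists s.
  pose F := [set (sval x).1 | x in E].
  have Fch : chain_in F.
    split; first by move=> _ [x _ <-]; case: (svalP x).
      by exists (sval e0).1; exists e0.
    move=> _ _ [x Ex <-] [y Ey <-]; have [/asboolP[h _]|/asboolP[h _]] := Etot x y Ex Ey.
      by left.
    by right.
  have /(_ _)/cid pickE u : exists a : A u,
      forall x, E x -> N (sval x).1 u -> (sval x).2 u = a.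
    have [[x [Ex xu]]|nx] := pselect (exists x, E x /\ N (sval x).1 u); last first.
      by exists (g0 u) => x Ex xu; case: nx; exists x.
    exists ((sval x).2 u) => y Ey yu.
    by have [/asboolP[_ ->]|/asboolP[_ ->]] := Etot x y Ex Ey.
  pose g u := sval (pickE u).
  have gE x u : E x -> N (sval x).1 u -> g u = (sval x).2 u.
    by move=> Ex xu; rewrite (svalP (pickE u) x).
  have okg : ok (\bigcup_(D in F) D) g.
    apply: okch => // _ [x Ex <-]; have [Hx okx] := svalP x.
    by apply: okloc okx => // u xu; rewrite (gE x).
  exists (exist _ (_, g) (conj (Hch F Fch) okg)) => s Es; apply/asboolP; split => /=.
    by move=> c sc; exists (sval s).1 => //; exists s.
  by move=> u su; rewrite (gE s).
- case: t tmax => -[D g] [/= HD okD] tmax.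
  have [<-|Dtop] := pselect (D = top); first by exists g.
  have [D' [g' [HD' DD' nDD' okD' g'g]]] := step D g HD okD Dtop.
  have /asboolP[/= D'D _] := tmax (exist _ (D',
      g') (conj HD' okD')) (asboolT (conj DD' g'g)).
  by case: nDD'; apply/seteqP.
Qed.

(** Induction along a filtration when no map is being built: the families are indexed by [void]. *)
Lemma climb_ind (ok : set C -> Prop) (D0 top : set C) :
  (forall F, chain_in F -> H (\bigcup_(D in F) D)) ->
  (forall F, chain_in F -> (forall D, F D -> ok D) -> ok (\bigcup_(D in F) D)) ->
  H D0 -> ok D0 ->
  (forall D, H D -> ok D -> D <> top -> exists D',
     [/\ H D', D `<=` D', D' <> D & ok D']) ->
  ok top.
Proof.
move=> Hch okch HD0 ok0 step.
suff [] : exists g : void -> unit, ok top by [].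
apply: (@zorn_family void (fun _ => unit) (fun _ => set0) (fun D _ => ok D) D0 top (fun
    _ => tt)) => //.
- by split=> [D D' _ u []|F _ u []].
- by move=> F g; apply: okch.
- move=> D g HD okD Dtop; have [D' [HD' DD' nD okD']] := step D HD okD Dtop.
  by exists D', (fun _ => tt).
Qed.

End Zorn.

(** * Auslander's lemma: projective dimension along a filtration *)

Section PdimClimb.
Variable R : pzRingType.
Implicit Types M L A B P Q U V : lmodType R.
Local Notation freemod := (freemod R).

Lemma subquo_section M (N N' : set M) Q (q : M -> Q) : submod N' -> is_subquo N N' q ->
  projective Q -> exists s : {linear Q -> M}, forall z, N' (s z) /\ q (s z) = z.
Proof.
move=> hN' [ql qs qk] hQ; have [L [j [ji jP]]] := submod_lmod hN'.
have Nj x : N' (j x) by apply/jP; exists x.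
have [p pE] : exists p : {linear L -> Q}, forall x, p x = q (j x).
  by apply: (@mk_linear R L Q (fun x => q (j x))) => a x y; rewrite linearP ql.
have [|s sE] := hQ L Q p idfun.
  by move=> z; have [x /jP[y <-] <-] := qs z; exists y.
exists (j \o s : {linear Q -> M}) => z; split=> /=; first exact: Nj.
by rewrite -pE sE.
Qed.

(** A section [s] of [q] splits [N'] into [N] and the image of [s]. The new lift is [g] on the first
    summand and, on the second, a lift of [f] composed with [s]. *)
Lemma subquo_extend M (N N' : set M) Q (q : M -> Q) A B (p : {linear A -> B})
    (f : {linear M -> B}) (g : M -> A) :
  submod N -> submod N' -> N `<=` N' -> is_subquo N N' q -> projective Q ->
  (forall y, exists x, p x = y) ->
  linear_on N g -> (forall x, N x -> p (g x) = f x) ->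
  exists g' : M -> A, [/\ linear_on N' g', forall x, N' x -> p (g' x) = f x
    & forall x, N x -> g' x = g x].
Proof.
move=> hN hN' NN' hq hQ ps gl pg; have [s sP] := subquo_section hN' hq hQ.
have [ql qs qk] := hq.
have [h hE] := hQ A B p (f \o s : {linear Q -> B}) ps.
have sub x : N' x -> N (x - s (q x)).
  move=> Nx; have [Ns qsx] := sP (q x).
  by apply/qk; [apply: submodB | rewrite (linear_onB hN' ql) // qsx subrr].
exists (fun x => g (x - s (q x)) + h (q x)); split.
- move=> a x y Nx Ny; rewrite ql // (linearP s) (linearP h).
  have -> : a *: x + y - (a *: s (q x) + s (q y)) = a *: (x - s (q x)) + (y - s (q y)).
    by rewrite opprD addrACA scalerBr.
  by rewrite gl; [rewrite scalerDr addrACA | apply: sub..].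
- move=> x Nx; rewrite linearD pg; last exact: sub.
  by rewrite hE linearB /= subrK.
- move=> x Nx; have -> : q x = 0 by apply/qk => //; apply: NN'.
  by rewrite (linear0 s) (linear0 h) subr0 addr0.
Qed.

Definition on_om M (K : set M) : set (om M) := [set u | on K (om_in M u)].

Lemma on_om_submod M (K : set M) : submod (on_om K).
Proof. exact/submod_preimage/on_submod. Qed.

(** Since [q] kills the generators of [A] outside [Y], a word on [A] is seen by [q] only through its
    coordinates in [Y]. *)
Lemma subquo_eps M (N' A Y : set M) Q (q : M -> Q) : submod N' -> linear_on N' q ->
  A `<=` N' -> (forall x, A x -> ~ Y x -> q x = 0) ->
  forall (rY : {linear freemod M -> freemod {x | Y x}}),
  (forall u x, fval (rY u) x = fval u (sval x)) ->
  forall w, on A w -> N' (eps M w) /\ q (eps M w) =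
      gen (fun y : {x | Y x} => q (sval y)) (rY w).
Proof.
move=> hN' ql AN' q0 rY rYE w wN'; pose qY := gen (fun y : {x | Y x} => q (sval y)).
apply: (fsup_ind_sub (N := [set w | N' (eps M w) /\ q (eps M w) = qY (rY w)])).
  split; first by rewrite /= !linear0 (linear_on0 hN' ql); case: hN'.
  by move=> a x y [Nx qx] [Ny qy] /=; rewrite !linearP ql // qx qy; split=> //;
      case: hN' => _; apply.
move=> x /wN' Ax; have Nx := AN' _ Ax; set r := fval w x.
rewrite /= /eps gen_delta /=; split; first exact: submodZ.
rewrite (linear_onZ hN' ql) //; have [Yx|nYx] := pselect (Y x).
  have -> : rY (delta x r) = delta (exist _ x Yx) r.
    apply: fsupP => -[y Yy]; rewrite rYE !deltaE /=.
    case: asboolP => [e|ne]; case: asboolP => //.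
      by case; apply: eq_exist.
    by move=> e; case: ne; apply: (congr1 sval e).
  by rewrite /qY gen_delta.
rewrite q0 // scaler0; have -> : rY (delta x r) = 0; last by rewrite linear0.
apply: fsupP => -[y Yy]; rewrite rYE fval0 delta_diff //= => e.
by rewrite e in nYx.
Qed.

(** The free module on [Y] covers [Q], with a first syzygy [L] as kernel, and restricting
    coordinates to [Y] sends the relations supported on [N'] onto [L]: an element of [L] is a word
    on [Y] with value in [A], and subtracting a word outside [Y] of the same value turns it into a
    relation. *)
Lemma subquo_om n M (A N' Y : set M) Q (q : M -> Q) :
  submod N' -> is_subquo A N' q -> Y `<=` N' ->
  (forall x, N' x -> ~ Y x -> A x) ->
  (forall x, N' x -> A x -> exists d, on (N' `\` Y) d /\ eps M d = x) ->
  (forall z, z <> 0 -> exists2 x, Y x & q x = z) ->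
  pdim n.+1 Q ->
  exists L (r : om M -> L), is_subquo (on_om (N' `\` Y)) (on_om N') r /\ pdim n L.
Proof.
move=> hN' [ql qs qk] YN' YA Ad Ys hQ.
have [rY rYE] := fsup_restr R^o Y; have [eY [eYE eYon]] := fsup_ext R^o Y.
pose qY := gen (fun y : {x | Y x} => q (sval y)).
have q0 x : N' x -> ~ Y x -> q x = 0 by move=> Nx nY; apply/qk => //; apply: YA.
have key := subquo_eps hN' ql (@subset_refl _ N') q0 rYE.
have qYs z : exists x, qY x = z.
  have [->|/Ys[x Yx <-]] := pselect (z = 0); first by exists 0; rewrite linear0.
  by exists (bas (exist _ x Yx)); rewrite /qY gen_bas.
have [L [j s]] := ker_ses qYs; have [ji js jk] := s.
have hL : pdim n L by apply/(pdim_syzygy s) => //; apply: projective_free.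
have [om_inj _ om_ker] := om_ses M.
have eps0 u : eps M (om_in M u) = 0 by apply/om_ker; exists u.
have /choice[r rP] : forall u, exists z, on_om N' u -> j z = rY (om_in M u).
  move=> u; have [uN|nu] := pselect (on_om N' u); last by exists 0.
  have /jk[z <-] : qY (rY (om_in M u)) = 0; last by exists z.
  by have [_ <-] := key _ uN; rewrite eps0 (linear_on0 hN' ql).
exists L, r; split=> //; split.
- move=> a u v uN vN; apply: ji; rewrite linearP !rP ?linearP //.
  by have [_] := on_om_submod N'; apply.
- move=> z; pose w := eY (j z).
  have wY : on Y w by apply: eYon.
  have rYw : rY w = j z by apply: fsupP => x; rewrite rYE eYE.
  have [Nw qw] := key w (onS YN' wY).
  have qw0 : q (eps M w) = 0 by rewrite qw rYw; apply/jk; exists z.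
  have [d [dK de]] := Ad _ Nw ((qk _ Nw).1 qw0).
  have /om_ker[u uE] : eps M (w - d) = 0 by rewrite linearB /= de subrr.
  have uN : on_om N' u.
    rewrite /on_om /= uE; apply: (submodB (N := on N')); first exact: on_submod.
      exact: onS wY.
    by apply: onS dK => x [].
  exists u => //; apply: ji; rewrite rP // uE linearB /= rYw.
  suff -> : rY d = 0 by rewrite subr0.
  apply: fsupP => -[x Yx]; rewrite rYE fval0 /=.
  by apply: on_notin dK _ => -[].
- move=> u uN; have -> : r u = 0 <-> rY (om_in M u) = 0.
    rewrite -rP //; split=> [->|]; first exact: linear0.
    by rewrite -(linear0 j) => /ji.
  split=> [h x ux|h].
    split; first exact: uN.
    by move=> Yx; apply: ux; rewrite -(rYE _ (exist _ x Yx)) h fval0.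
  by apply: fsupP => -[x Yx]; rewrite rYE fval0 /=;
      apply: (on_notin (h : on (N' `\` Y) (om_in M u))) => -[].
Qed.

Lemma subquo_om_step n M (N N' : set M) Q (q : M -> Q) :
  submod N -> submod N' -> N `<=` N' -> is_subquo N N' q -> pdim n.+1 Q ->
  exists L (r : om M -> L), is_subquo (on_om N) (on_om N') r /\ pdim n L.
Proof.
move=> hN hN' NN' hq; have [ql qs qk] := hq.
have K : N' `\` (N' `\` N) = N.
  by rewrite setDD; apply/seteqP; split=> [x []|x Nx] //; split => //; apply: NN'.
move=> /(subquo_om hN' hq (Y := N' `\` N)); rewrite K; apply.
- by move=> x [].
- by move=> x Nx nY; apply: contrapT => nN; apply: nY.
- move=> x _ Nx; exists (bas x); split; first exact: on_delta.
  by rewrite /eps gen_bas.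
- move=> z z0; have [x Nx xz] := qs z; exists x => //; split => //.
  by move=> /(qk _ Nx) h; apply: z0; rewrite -xz.
Qed.

(** All of [N'], including 0, is taken as [Y]. The relations supported on {0} need not vanish, as
    the basis vector at 0 is one of them, so the bottom must be compared with the empty set of
    generators. *)
Lemma subquo_om_base n M (N' : set M) Q (q : M -> Q) :
  submod N' -> is_subquo [set 0] N' q -> pdim n.+1 Q ->
  exists L (r : om M -> L), is_subquo [set 0] (on_om N') r /\ pdim n L.
Proof.
move=> hN' hq; have [ql qs qk] := hq.
have K : on_om (N' `\` N') = [set 0].
  rewrite setDv; apply/seteqP; split=> [u h|u ->] /=; last first.
    by case: (on_om_submod (set0 : set M)).
  have [om_inj _ _] := om_ses M; apply: om_inj; rewrite linear0; apply: fsupP => x.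
  by rewrite fval0; apply: (on_notin (h : on set0 (om_in M u))).
move=> /(subquo_om hN' hq (Y := N')); rewrite K; apply => //.
by move=> x _ ->; exists 0; split; [case: (on_submod R^o (N' `\` N')) | rewrite linear0].
Qed.

Variables (C : Type) (H : set (set C)).
Hypothesis Hch : forall F, chain_in H F -> H (\bigcup_(D in F) D).

Lemma chain_finite F (D1 D2 : set C) : chain_in H F -> F D1 -> F D2 ->
  exists D, [/\ F D, D1 `<=` D & D2 `<=` D].
Proof.
by move=> [_ _ tot] F1 F2; have [h|h] := tot _ _ F1 F2; [exists D2 | exists D1];
    split=> // x.
Qed.

(** Continuity holds because a finite support inside the union of a chain is caught by a single
    member. *)
Lemma filtration_on (X : smallType) M (N : set C -> set X) : filtration H N ->
  filtration H (fun D => on (N D) : set (fsup X M)).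
Proof.
move=> [Nmono Ncont]; split=> [D D' DD' u|F hF u uN]; first by apply: onS; apply: Nmono.
have [s _ [sP _]] := fsup_sum u.
suff : forall t : seq {classic X}, (forall x : X, (x : {classic X}) \in t ->
    fval u x <> 0) -> exists2 D, F D &
    forall x : X, (x : {classic X}) \in t -> N D x.
  by move=> /(_ s)[x /sP//|D FD DN]; exists D => // x /sP; apply: DN.
elim=> [_|x t IH tP]; first by have [_ [D FD] _] := hF; exists D.
have [|D1 FD1 D1N] := IH; first by move=> y yt; apply: tP; rewrite inE yt orbT.
have [|D2 FD2 D2x] := Ncont F hF x; first by apply/uN/tP; rewrite inE eqxx.
have [D [FD h1 h2]] := chain_finite hF FD1 FD2.
exists D => // y; rewrite inE => /orP[/eqP ->|/D1N]; first exact: Nmono D2x.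
exact: Nmono.
Qed.

Lemma filtration_om M (N : set C -> set M) : filtration H N ->
  filtration H (fun D => on_om (N D)).
Proof.
move=> /(@filtration_on M R^o)[h1 h2]; split=> [D D' DD' u|F hF u]; first exact: h1.
exact: h2.
Qed.

(** The usual notion of a module filtered by [cls], indexed by sets instead of ordinals. The bottom
    [N D0] counts as a layer because it may be nonzero. *)
Definition climbs (cls : lmodType R -> Prop) M (N : set C -> set M) (D0 top : set C) :=
  [/\ forall D, H D -> submod (N D),
      exists Q (q : M -> Q), is_subquo [set 0] (N D0) q /\ cls Q,
      forall D, H D -> D <> top -> exists D', [/\ H D', D `<=` D', D' <> D &
        exists Q (q : M -> Q), is_subquo (N D) (N D') q /\ cls Q]
    & forall x, N top x].

Lemma projective_climb M (N : set C -> set M) (D0 top : set C) :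
  H D0 -> filtration H N -> climbs (@projective R) N D0 top -> projective M.
Proof.
move=> HD0 filtN [hN [Q0 [q0 [hq0 hQ0]]] step Ntop] A B p f ps.
have [Nmono Ncont] := filtN.
pose ok D (g : M -> A) := linear_on (N D) g /\ forall x, N D x -> p (g x) = f x.
have [g0 [gl pg _]] : exists g' : M -> A, [/\ linear_on (N D0) g',
    forall x, N D0 x -> p (g' x) = f x & forall x, x = 0 -> g' x = 0].
  apply: (subquo_extend (N := [set 0]) (g := fun _ => 0) _ _ _ hq0 hQ0 ps) => //.
  - exact: submod0.
  - exact: hN.
  - by move=> x ->; case: (hN _ HD0).
  - by move=> a x y _ _; rewrite scaler0 addr0.
  - by move=> x ->; rewrite !linear0.
have [g [gl' pg']] : exists g, ok top g.
  apply: (zorn_family (N := N) (ok := ok) (D0 := D0) (g0 := g0) (H := H)) => //.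
  - move=> F g hF okF; have [FH _ _] := hF; split.
      move=> a x y /(Ncont F hF)[D1 FD1 D1x] /(Ncont F hF)[D2 FD2 D2y].
      have [D [FD h1 h2]] := chain_finite hF FD1 FD2.
      by have [gl1 _] := okF D FD; apply: gl1; [apply: Nmono D1x | apply: Nmono D2y].
    by move=> x /(Ncont F hF)[D FD Dx]; have [_] := okF D FD; apply.
  - move=> D g g' HD gg' [gl' pg']; split=> [a x y Nx Ny|x Nx].
      by rewrite -!gg' // ?gl' //; have [_] := hN D HD; apply.
    by rewrite -gg' // pg'.
  - move=> D g HD [gl' pg'] Dtop; have [D' [HD' DD' nD [Q [q [hq hQ]]]]] :=
      step D HD Dtop.
    have [g' [? ? ?]] := subquo_extend (hN D HD) (hN D' HD') (Nmono _ _ DD') hq hQ ps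
        gl' pg'.
    by exists D', g'; split.
have [G GE] : exists G : {linear M -> A}, forall x, G x = g x.
  by apply: (@mk_linear R M A g) => a x y; apply: gl'.
by exists G => x; rewrite GE pg'.
Qed.

(** Dimension shifting: the relations supported on the [N D] filter [om M], and the layers of this
    filtration are first syzygies of the layers of [M]. The induction ends at projective layers,
    where lifts are extended stage by stage. *)
Lemma pdim_climb n M (N : set C -> set M) (D0 top : set C) :
  H D0 -> filtration H N -> climbs (@pdim R n) N D0 top -> pdim n M.
Proof.
move=> HD0; elim: n M N => [|n IH] M N filtN; first exact: projective_climb.
move=> [hN [Q0 [q0 [hq0 hQ0]]] step Ntop].
apply/pdim_om/(IH _ (fun D => on_om (N D))); first exact: filtration_om.
split=> [D _|||u x _]; [exact: on_om_submod | | | exact: Ntop].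
- exact: subquo_om_base (hN _ HD0) hq0 hQ0.
- move=> D HD /(step D HD)[D' [HD' DD' nD [Q [q [hq hQ]]]]]; exists D'; split=> //.
  by apply: subquo_om_step hq hQ => //; [apply: hN | apply: hN | apply: filtN.1].
Qed.

End PdimClimb.

(** * Complexes *)

Section SubquoComplex.
Variable R : pzRingType.
Implicit Types X W V : complex R.

Definition subcomplex X (Y : forall i, set (X i)) :=
  (forall i, submod (Y i)) /\ forall i x, Y (i + 1) x -> Y i (cdiff X i x).

Definition is_subquo_complex X (A B : forall i, set (X i)) W (q : forall i, X i -> W i) :=
  (forall i, is_subquo (A i) (B i) (q i)) /\
  forall i x, B (i + 1) x -> q i (cdiff X i x) = cdiff W i (q (i + 1) x).

Lemma is_subquo_complex_exists X (A B : forall i, set (X i)) :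
  subcomplex A -> subcomplex B ->
  exists W (q : forall i, X i -> W i), is_subquo_complex A B q.
Proof.
move=> [hA dA] [hB dB].
pose sg i := cid (is_subquo_exists (hA i) (hB i)); pose Q i := projT1 (sg i).
pose sg2 i := cid (projT2 (sg i)); pose q i : X i -> Q i := projT1 (sg2 i).
have hq i : is_subquo (A i) (B i) (q i) := projT2 (sg2 i).
have lift i : exists G : {linear Q (i + 1) -> Q i},
    forall x, B (i + 1) x -> G (q _ x) = q i (cdiff X i x).
  have [ql _ qk] := hq i.
  apply: (is_subquo_lift (hB _) (hq _) (g := fun x => q i (cdiff X i x))).
    by move=> a x y Bx By; rewrite linearP ql //; apply: dB.
  by move=> x Bx Ax; apply/qk; [apply: dB | apply: dA].
pose d i := projT1 (cid (lift i)).
have dE i x : B (i + 1) x -> d i (q _ x) = q i (cdiff X i x) := projT2 (cid (lift i)) x.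
have dd i x : d i (d (i + 1) x) = 0.
  have [_ qs _] := hq (i + 1 + 1); have [y By <-] := qs x.
  rewrite dE // dE; last exact: dB.
  by rewrite cdiffK; have [ql _ _] := hq i; apply: linear_on0 ql.
by exists (Complex dd), q; split=> // i x Bx /=; rewrite dE.
Qed.

Lemma is_subquo_complex_lift X (A B : forall i, set (X i)) W (q : forall i, X i -> W i)
    V (g : forall i, X i -> V i) :
  subcomplex B -> is_subquo_complex A B q -> (forall i, linear_on (B i) (g i)) ->
  (forall i x, B i x -> A i x -> g i x = 0) ->
  (forall i x, B (i + 1) x -> g i (cdiff X i x) = cdiff V i (g (i + 1) x)) ->
  exists G : chain_map W V, forall i x, B i x -> G i (q i x) = g i x.
Proof.
move=> [hB dB] [hq qd] gl gA gd.
pose sg i := cid (is_subquo_lift (hB i) (hq i) (gl i) (gA i)).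
pose G i : {linear W i -> V i} := projT1 (sg i).
have GE i x : B i x -> G i (q i x) = g i x := projT2 (sg i) x.
have Gd i x : G i (cdiff W i x) = cdiff V i (G (i + 1) x).
  have [_ qs _] := hq (i + 1); have [y By <-] := qs x.
  by rewrite -qd // !GE ?gd //; apply: dB.
by exists (ChainMap Gd).
Qed.

Lemma subcomplexT X : subcomplex (fun i => [set: X i]).
Proof. by split=> // i; apply: submodT. Qed.

Lemma subcomplex0 X : subcomplex (fun i => [set (0 : X i)]).
Proof. by split=> [i|i x ->]; [apply: submod0 | rewrite /= linear0]. Qed.

Lemma subcomplex_image X V (f : chain_map X V) (Y : forall i, set (X i)) :
  subcomplex Y -> subcomplex (fun i => f i @` Y i).
Proof.
move=> [hY dY]; split=> [i|i _ [x Yx <-]].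
  by apply: submod_image => //; apply: linear_onT.
by exists (cdiff X i x); [apply: dY | rewrite cmap_diff].
Qed.

Lemma subcomplex_preimage X V (f : chain_map X V) (Y : forall i, set (V i)) :
  subcomplex Y -> subcomplex (fun i => f i @^-1` Y i).
Proof.
move=> [hY dY]; split=> [i|i x Yx]; first exact: submod_preimage.
by rewrite /preimage /= cmap_diff; apply: dY.
Qed.

Lemma subcomplex_ker X V (f : chain_map X V) :
  subcomplex (fun i => f i @^-1` [set 0]).
Proof. exact/subcomplex_preimage/subcomplex0. Qed.

Definition exact_on X (Y : forall i, set (X i)) :=
  forall i (x : X (i + 1)), Y _ x -> cdiff X i x = 0 ->
  exists2 y, Y (i + 1 + 1) y & cdiff X (i + 1) y = x.

(** A cycle in [B] bounds in [W]; subtracting the boundary of a lift leaves a cycle in [A]. *)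
Lemma exact_on_step X (A B : forall i, set (X i)) W (q : forall i, X i -> W i) :
  subcomplex B -> (forall i, A i `<=` B i) -> is_subquo_complex A B q ->
  exact_on A -> exact_complex W -> exact_on B.
Proof.
move=> [hB dB] AB [hq qd] eA eW i x Bx dx.
have [|w wx] := eW i (q _ x).
  by rewrite -qd // dx; have [ql _ _] := hq i; apply: linear_on0 ql.
have [_ qs _] := hq (i + 1 + 1); have [y By yw] := qs w.
have [ql _ qk] := hq (i + 1).
have [||z Az zE] := eA i (x - cdiff X (i + 1) y).
- apply/qk; first by apply: submodB => //; apply: dB.
  by rewrite (linear_onB (hB _) ql) ?qd ?yw ?wx ?subrr //; apply: dB.
- by rewrite linearB /= cdiffK dx subrr.
exists (y + z); first by apply: submodD => //; apply: AB.
by rewrite linearD /= zE [LHS]addrC subrK.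
Qed.

Section Climb.
Variables (C : Type) (H : set (set C)).
Hypothesis Hch : forall F, chain_in H F -> H (\bigcup_(D in F) D).

Definition climbs_complex (cls : complex R -> Prop) X
    (N : set C -> forall i, set (X i)) (D0 top : set C) :=
  [/\ forall D, H D -> subcomplex (N D),
      exists W (q : forall i, X i -> W i),
        is_subquo_complex (fun i => [set 0]) (N D0) q /\ cls W,
      forall D, H D -> D <> top -> exists D', [/\ H D', D `<=` D', D' <> D &
        exists W (q : forall i, X i -> W i), is_subquo_complex (N D) (N D') q /\ cls W]
    & forall i x, N top i x].

Lemma exact_climb X (N : set C -> forall i, set (X i)) (D0 top : set C) :
  H D0 -> (forall i, filtration H (fun D => N D i)) ->
  climbs_complex (@exact_complex R) N D0 top -> exact_complex X.
Proof.
move=> HD0 filtN [hN [W0 [q0 [hq0 eW0]]] step Ntop].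
suff h : exact_on (N top) by move=> i x dx; have [y _] := h i x (Ntop _ _) dx; exists y.
apply: (climb_ind (H := H) (ok := fun D => exact_on (N D)) (D0 := D0)) => //.
- move=> F hF eF i x /((filtN _).2 F hF)[D FD Dx] dx.
  have [y Dy <-] := eF D FD i x Dx dx; exists y => //.
  by apply: (filtN _).1 Dy => c Dc; exists D.
- apply: exact_on_step hq0 _ eW0; first exact: hN.
    by move=> i _ ->; have [h _] := hN D0 HD0; case: (h i).
  by move=> i x -> _; exists 0; rewrite ?linear0.
- move=> D HD eD Dtop; have [D' [HD' DD' nD [W [q [hq eW]]]]] := step D HD Dtop.
  exists D'; split=> //; apply: exact_on_step hq eD eW; first exact: hN.
  by move=> i; apply: (filtN i).1.
Qed.

Lemma ex_tilde_climb n X (N : set C -> forall i, set (X i)) (D0 top : set C) :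
  H D0 -> (forall i, filtration H (fun D => N D i)) ->
  climbs_complex (ex_tilde (@projdim_le R n)) N D0 top -> ex_tilde (@projdim_le R n) X.
Proof.
move=> HD0 filtN [hN [W0 [q0 [hq0 [eW0 pW0]]]] step Ntop]; split.
  apply: (exact_climb (N := N) HD0 filtN (top := top)); split=> //.
    by exists W0, q0.
  move=> D HD /(step D HD)[D' [HD' DD' nD [W [q [hq [eW _]]]]]].
  by exists D'; split=> //; exists W, q.
move=> i; apply/projdim_leE.
apply: (pdim_climb (N := fun D => N D i) Hch HD0 (filtN i) (top := top)); split=> //.
- by move=> D /hN[].
- by exists (W0 i), (q0 i); split; [apply: hq0.1 | apply/projdim_leE].
- move=> D HD /(step D HD)[D' [HD' DD' nD [W [q [hq [_ pW]]]]]].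
  exists D'; split=> //; exists (W i), (q i).
  by split; [apply: hq.1 | apply/projdim_leE].
Qed.

End Climb.

Lemma ex_tilde_extension n (A B C : complex R) (f : chain_map A B) (g : chain_map B C) :
  short_exact f g -> ex_tilde (@projdim_le R n) A -> ex_tilde (@projdim_le R n) C ->
  ex_tilde (@projdim_le R n) B.
Proof.
move=> [fi gs gk] hA hC.
(* An extension is a filtration with two layers, indexed by the two subsets of [unit]. *)
pose N (D : set unit) i : set (B i) := [set x | D tt \/ exists a, f i a = x].
have NT D i : D tt -> N D i = setT by move=> Dt; apply/seteqP; split=> // x _; left.
have NF D i : ~ D tt -> N D i = f i @` setT.
  move=> nD; apply/seteqP; split=> [x [//|[a <-]]|x [a _ <-]]; first by exists a.
  by right; exists a.
have tot D : D <> setT -> ~ D tt by move=> h Dt; apply: h; apply/seteqP; split=> // -[].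
have sN D : subcomplex (N D).
  have [Dt|nDt] := pselect (D tt).
    have -> : N D = fun i => setT by apply: functional_extensionality_dep => i; apply: NT.
    exact: subcomplexT.
  have -> : N D = fun i => f i @` setT by apply: functional_extensionality_dep => i;
      apply: NF.
  exact/subcomplex_image/subcomplexT.
apply: (@ex_tilde_climb unit setT _ n B N set0 setT) => //.
  move=> i; split=> [D D' DD' x [Dt|]|F [_ [D FD] _] x [[D1 FD1 Dt]|h]].
  - by left; apply: DD'.
  - by right.
  - by exists D1 => //; left.
  - by exists D => //; right.
split=> [D _|||i x]; [exact: sN | | |by left].
- pose q i x := xget 0 [set a | f i a = x].
  have qf i a : q i (f i a) = a.
    by apply: (fi i); apply: (@xgetPex _ 0 [set b | f i b = f i a]); exists a.
  have N0 i x : N set0 i x -> exists a, f i a = x by case.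
  exists A, q; split=> //; split=> [i|i x /N0[a <-]]; last by rewrite -cmap_diff !qf.
  split=> [c x y /N0[a <-] /N0[b <-]|a|x /N0[a <-]].
  + by rewrite -linearP !qf.
  + by exists (f i a); [right; exists a | apply: qf].
  + by rewrite qf; split=> [->|/=]; [rewrite linear0 | rewrite -(linear0 (f i)) => /fi].
- move=> D _ /tot nD; exists setT; split=> //.
    by move=> e; apply: nD; rewrite -e.
  exists C, (fun i x => g i x); split=> //; split=> [i|i x _]; last exact: cmap_diff.
  split; first by move=> a x y _ _; rewrite linearP.
    by move=> z; have [y <-] := gs i z; exists y; first by left.
  by move=> x _; rewrite gk; split=> [h|[/nD|]] //; right.
Qed.
End SubquoComplex.

(** * Extensions, retractions, quotients and pushouts of complexes *)

Section ChainMaps.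
Variable R : pzRingType.
Implicit Types X Z L V W : complex R.

Lemma mk_chain_map X Z (f : forall i, X i -> Z i) : (forall i, linear (f i)) ->
  (forall i x, f i (cdiff X i x) = cdiff Z i (f (i + 1) x)) ->
  exists F : chain_map X Z, forall i x, F i x = f i x.
Proof.
move=> fl fd; pose F i := projT1 (cid (mk_linear (fl i))).
have FE i x : F i x = f i x := projT2 (cid (mk_linear (fl i))) x.
have Fd i x : F i (cdiff X i x) = cdiff Z i (F (i + 1) x) by rewrite !FE fd.
by exists (ChainMap Fd).
Qed.

(** A retraction paired with [ext_proj] is an equivalence with the split extension. The vanishing of
    Ext thus becomes the existence of a single map, which can be built by stages. *)
Lemma Ext1_retraction X Z : Ext1_eq0 X Z <->
  forall E : extension X Z, exists r : chain_map (ext_mid E) Z,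
    forall i z, r i (ext_inj E i z) = z.
Proof.
split=> h E.
  have [f [fi _]] := h E.
  have [||r rE] := @mk_chain_map (ext_mid E) Z (fun i x => (f i x).1).
  - by move=> i a x y; rewrite linearP.
  - by move=> i x; rewrite cmap_diff.
  by exists r => i z; rewrite rE fi.
have [r rE] := h E; have [_ _ ek] := ext_exact E.
have [||f fE] := @mk_chain_map (ext_mid E) (ext_mid (split_extension X Z))
  (fun i x => (r i x, ext_proj E i x)).
- by move=> i a x y; apply: injective_projections; rewrite /= linearP.
- by move=> i x; apply: injective_projections; rewrite /= cmap_diff.
exists f; split=> i x; rewrite fE //= rE; congr pair.
by apply/ek; exists x.
Qed.

Lemma ex_tilde_retract n X Z (f : chain_map Z X) (g : chain_map X Z) :
  (forall i z, g i (f i z) = z) ->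
  ex_tilde (@projdim_le R n) X -> ex_tilde (@projdim_le R n) Z.
Proof.
move=> gf [eX pX]; split=> [i z dz|i].
  have [|y yz] := eX i (f _ z); first by rewrite -cmap_diff dz linear0.
  by exists (g _ y); rewrite -cmap_diff yz gf.
apply/projdim_leE; apply: (pdim_retract (B := X i)); last exact/projdim_leE.
by exists (f i), (g i).
Qed.

Lemma kernel_complex X Z (g : chain_map X Z) : (forall i z, exists y, g i y = z) ->
  exists L (f : chain_map L X), short_exact f g.
Proof.
move=> gs; have hK := subcomplex_ker g.
have [L [q hq]] := is_subquo_complex_exists (@subcomplex0 _ X) hK.
have [|||f fE] := is_subquo_complex_lift (V := X) (g := fun i x => x) hK hq => //.
have [hq' _] := hq.
exists L, f; split=> // i.
- move=> x y; have [ql qs qk] := hq' i; have [a Ka <-] := qs x; have [b Kb <-] := qs y.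
  by rewrite !fE // => ->.
- move=> y; split=> [gy|[x <-]]; first by exists (q i y); rewrite fE.
  by have [_ qs _] := hq' i; have [a Ka <-] := qs x; rewrite fE.
Qed.

Lemma quotient_complex X (A : forall i, set (X i)) : subcomplex A ->
  exists W (q : chain_map X W), (forall i z, exists x, q i x = z) /\
    forall i x, q i x = 0 <-> A i x.
Proof.
move=> hA; have [W [q [hq qd]]] := is_subquo_complex_exists hA (@subcomplexT _ X).
have [||p pE] := mk_chain_map (f := q).
- by move=> i a x y; have [ql _ _] := hq i; apply: ql.
- by move=> i x; apply: qd.
exists W, p; split=> i x; have [_ qs qk] := hq i.
  by have [y _ <-] := qs x; exists y; rewrite pE.
by rewrite pE; apply: qk.
Qed.

Lemma quotient_lift X W V (q : chain_map X W) (g : chain_map X V) :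
  (forall i z, exists x, q i x = z) -> (forall i x, q i x = 0 -> g i x = 0) ->
  exists G : chain_map W V, forall i x, G i (q i x) = g i x.
Proof.
move=> qs qg.
have hq : is_subquo_complex (fun i => q i @^-1` [set 0]) (fun i => setT) (fun i => (q i
    : X i -> W i)).
  split=> [i|i x _]; last exact: cmap_diff.
  split=> //; first exact: linear_onT.
  by move=> z; have [x <-] := qs i z; exists x.
have [|||G GE] := is_subquo_complex_lift (V := V) (g := fun i => (g i : X i ->
    V i)) (@subcomplexT _ X) hq.
- by move=> i; apply: linear_onT.
- by move=> i x _; apply: qg.
- by move=> i x _; apply: cmap_diff.
by exists G => i x; apply: GE.
Qed.

(** [C] is the pushout of [f] and [b]: the sum of [B] and [X] modulo the pairs (b l, - f l). Both
    given cokernels, [Z] and [A], survive. *)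
Lemma pushout_short_exact L X B Z A (f : chain_map L X) (g : chain_map X Z)
    (b : chain_map L B) (c : chain_map B A) :
  short_exact f g -> short_exact b c ->
  exists C (f' : chain_map B C) (g' : chain_map C Z) (b' : chain_map X C) (c' :
      chain_map C A),
    short_exact f' g' /\ short_exact b' c'.
Proof.
move=> [fi gs gk] [bi cs ck]; pose V := dsum X B.
have [||d dE] := @mk_chain_map L V (fun i l => (b i l, - f i l)).
- by move=> i a x y; apply: injective_projections; rewrite /= linearP // opprD scalerN.
- by move=> i x; apply: injective_projections; rewrite /= cmap_diff // linearN.
have [C [p [ps pk]]] := quotient_complex (subcomplex_image d (@subcomplexT _ L)).
have pkE i x y : p i (x, y) = 0 <-> exists l, b i l = x /\ - f i l = y.
  rewrite pk; split=> [[l _]|[l [<- <-]]]; last by exists l; rewrite ?dE.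
  by rewrite dE => -[<- <-]; exists l.
have [||gV gVE] := @mk_chain_map V Z (fun i x => g i x.2).
- by move=> i a x y; rewrite linearP.
- by move=> i x; rewrite /= cmap_diff.
have [||cV cVE] := @mk_chain_map V A (fun i x => c i x.1).
- by move=> i a x y; rewrite linearP.
- by move=> i x; rewrite /= cmap_diff.
have [||f' f'E] := @mk_chain_map B C (fun i x => p i (x, 0)).
- move=> i a x y; rewrite -linearP; congr (p i _).
  by apply: injective_projections; rewrite //= scaler0 addr0.
- move=> i x; rewrite -cmap_diff; congr (p i _).
  by apply: injective_projections; rewrite //= linear0.
have [||b' b'E] := @mk_chain_map X C (fun i x => p i (0, x)).
- move=> i a x y; rewrite -linearP; congr (p i _).
  by apply: injective_projections; rewrite //= scaler0 addr0.
- move=> i x; rewrite -cmap_diff; congr (p i _).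
  by apply: injective_projections; rewrite //= linear0.
have [|g' g'E] := quotient_lift (g := gV) ps.
  move=> i [x y] /pkE[l [_ <-]]; rewrite gVE linearN /=.
  by apply/eqP; rewrite oppr_eq0; apply/eqP/gk; exists l.
have [|c' c'E] := quotient_lift (g := cV) ps.
  by move=> i [x y] /pkE[l [<- _]]; rewrite cVE; apply/ck; exists l.
exists C, f', g', b', c'; split; split=> i.
- move=> x y; rewrite !f'E => /eqP; rewrite -subr_eq0 -linearB => /eqP.
  rewrite /= => /pkE[l [e1 e2]]; apply/eqP; rewrite -subr_eq0 -e1.
  move: e2; rewrite subrr => /eqP; rewrite oppr_eq0 -(linear0 (f i)) => /eqP/fi ->.
  by rewrite linear0.
- by move=> z; have [y <-] := gs i z; exists (p i (0, y)); rewrite g'E gVE.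
- move=> y; have [[u v] <-] := ps i y; rewrite g'E gVE /=; split=> [/gk[l lv]|[x]].
    exists (u + b i l); rewrite f'E; apply/eqP; rewrite -subr_eq0 -linearB; apply/eqP/pkE.
    by exists l; rewrite /= lv sub0r [u + _]addrC addrK.
  rewrite f'E => /eqP; rewrite -subr_eq0 -linearB => /eqP/pkE[l [_]].
  by rewrite /= sub0r => /oppr_inj <-; apply/gk; exists l.
- move=> x y; rewrite !b'E => /eqP; rewrite -subr_eq0 -linearB => /eqP.
  rewrite /= => /pkE[l [e1 e2]]; apply/eqP; rewrite -subr_eq0 -e2.
  move: e1; rewrite subrr -(linear0 (b i)) => /bi ->.
  by rewrite linear0 oppr0.
- by move=> z; have [y <-] := cs i z; exists (p i (y, 0)); rewrite c'E cVE.
- move=> y; have [[u v] <-] := ps i y; rewrite c'E cVE /=; split=> [/ck[l lv]|[x]].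
    exists (v + f i l); rewrite b'E; apply/eqP; rewrite -subr_eq0 -linearB; apply/eqP/pkE.
    by exists (- l); rewrite /= !linearN /= lv sub0r opprK [v + _]addrC addrK.
  rewrite b'E => /eqP; rewrite -subr_eq0 -linearB => /eqP/pkE[l [e _]].
  by move: e; rewrite /= sub0r => /eqP; rewrite eq_sym eqr_oppLR => /eqP ->; apply/ck;
      exists (- l); rewrite linearN.
Qed.

End ChainMaps.

(** * Free disk complexes, used as projective covers *)

Section Disk.
Variables (R : pzRingType) (G : int -> smallType).

(** The second factor holds the generators of degree [i], the first the boundaries of those of
    degree i + 1. *)
Let obj i : lmodType R := (freemod R (G (i + 1)) * freemod R (G i))%type.

Let d_subproof i : exists f : {linear obj (i + 1) -> obj i}, forall x, f x = (x.2, 0).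
Proof.
have [f fE] := inl_linear (freemod R (G (i + 1))) (freemod R (G i)).
have [g gE] := snd_linear (freemod R (G (i + 1 + 1))) (freemod R (G (i + 1))).
by exists (f \o g : {linear obj (i + 1) -> obj i}) => x; rewrite /= fE gE.
Qed.

Let d i := projT1 (cid (d_subproof i)).

Let dE i x : d i x = (x.2, 0).
Proof. exact: (projT2 (cid (d_subproof i))). Qed.

Let dd i x : d i (d (i + 1) x) = 0.
Proof. by rewrite !dE. Qed.

Definition disk : complex R := Complex dd.

Definition disk_gen i (x : G i) : disk i := (0, bas x).

Lemma disk_diffE i (x : disk (i + 1)) : cdiff disk i x = (x.2, 0).
Proof. exact: dE. Qed.

Lemma disk_map (E : complex R) (g : forall i, G i -> E i) :
  exists F : chain_map disk E,
    forall i x, F i x = cdiff E i (gen (g (i + 1)) x.1) + gen (g i) x.2.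
Proof.
apply: mk_chain_map => [i a x y|i x].
  by rewrite !linearP scalerDr [RHS]addrACA.
by rewrite disk_diffE /= linear0 addr0 linearD cdiffK add0r.
Qed.

Lemma disk_map_gen (E : complex R) (g : forall i, G i -> E i) (F : chain_map disk E) :
  (forall i x, F i x = cdiff E i (gen (g (i + 1)) x.1) + gen (g i) x.2) ->
  forall i x, F i (disk_gen x) = g i x.
Proof. by move=> FE i x; rewrite FE /= !linear0 add0r gen_bas. Qed.

Lemma disk_map_eq (E : complex R) (F F' : chain_map disk E) :
  (forall i x, F i (disk_gen x) = F' i (disk_gen x)) -> forall i x, F i x = F' i x.
Proof.
move=> h.
have h2 i (u : freemod R (G i)) : F i ((0, u) : disk i) = F' i ((0, u) : disk i).
  have [k kE] := inr_linear (freemod R (G (i + 1))) (freemod R (G i)).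
  have := @free_eq _ _ _ (F i \o k : {linear _ -> _}) (F' i \o k : {linear _ -> _}).
  by move=> /(_ _ u); rewrite /= kE; apply=> x; rewrite /= kE; apply: h.
move=> i [a b]; have -> : (a, b) = cdiff disk i ((0, a) : disk (i + 1)) + ((0, b) :
    disk i).
  by rewrite disk_diffE; apply: injective_projections; rewrite /= ?addr0 ?add0r.
by rewrite !linearD !cmap_diff !h2.
Qed.

Lemma disk_projective (E V : complex R) (p : chain_map E V) (f : chain_map disk V) :
  (forall i z, exists x, p i x = z) ->
  exists h : chain_map disk E, forall i x, p i (h i x) = f i x.
Proof.
move=> ps; have /(_ _)/choice cg i : forall x : G i, exists y, p i y = f i (disk_gen x).
  by move=> x; apply: ps.
pose g i := projT1 (cg i).
have gE i x : p i (g i x) = f i (disk_gen x) := projT2 (cg i) x.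
have [h hE] := disk_map g; exists h => i x.
have [||k kE] := @mk_chain_map _ disk V (fun i x => p i (h i x)).
- by move=> j a u v; rewrite !linearP.
- by move=> j u; rewrite !cmap_diff.
by rewrite -kE; apply: disk_map_eq => j u; rewrite kE (disk_map_gen hE).
Qed.

Lemma disk_ex_tilde n : ex_tilde (@projdim_le R n) disk.
Proof.
split=> [i [a b]|i].
  rewrite disk_diffE => -[->]; exists (0, a); by rewrite disk_diffE.
apply/projdim_leE/projective_pdim/projective_prod; exact: projective_free.
Qed.

End Disk.
Arguments disk_gen R {G i} x.

Lemma disk_cover (R : pzRingType) (Z : complex R) :
  exists f : chain_map (disk R (fun i => Z i)) Z, forall i z, exists x, f i x = z.
Proof.
have [f fE] := disk_map (fun i (z : Z i) => z).
by exists f => i z; exists (disk_gen R (z : (fun i => Z i) i)); rewrite (disk_map_gen fE).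
Qed.

(** * Embedding a complex into an orthogonal class *)

Section FsupComplex.
Variables (R : pzRingType) (X : smallType) (P : complex R).

Let d i := projT1 (cid (fsup_map X (cdiff P i))).
Let dE i u x : fval (d i u) x = cdiff P i (fval u x).
Proof. exact: (projT2 (cid (fsup_map X (cdiff P i)))). Qed.
Let dd i u : d i (d (i + 1) u) = 0.
Proof. by apply: fsupP => x; rewrite !dE cdiffK fval0. Qed.

Definition fsup_complex : complex R := Complex dd.

Lemma fsup_cdiffE i (u : fsup_complex (i + 1)) x :
  fval (cdiff fsup_complex i u) x = cdiff P i (fval u x).
Proof. exact: dE. Qed.

Lemma fsup_cdiff_delta i x m :
  cdiff fsup_complex i (delta x m) = delta x (cdiff P i m).
Proof.
by apply: fsupP => y; rewrite fsup_cdiffE !deltaE; case: asboolP => // _; rewrite linear0.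
Qed.
End FsupComplex.

Section Cells.
Variables (R : pzRingType) (P Z : complex R) (J : smallType).
Variable K : J -> forall i, set (P i).
Hypothesis hK : forall j, subcomplex (K j).

(* A cell is a recipe for attaching a copy of P along K j: it maps each p in P
   to a formal sum of an element of Z and of elements of copies of P attached
   by previous cells. Well-founded trees thus replace a transfinite recursion. *)
Inductive cell : smallType :=
  Cell (j : J) (z : forall i, P i -> Z i) (l : forall i, P i -> nat)
    (s : forall i (p : P i), 'I_(l i p) -> cell)
    (c : forall i (p : P i), 'I_(l i p) -> P i).

Let V := dsum (fsup_complex cell P) Z.

Definition cell_index (c : cell) := let: Cell j _ _ _ _ := c in j.

Definition attach (c : cell) i (p : P i) : V i :=
  let: Cell _ z l s f := c in (z i p, \sum_(t < l i p) delta (s i p t) (f i p t)).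

Definition subcell (c' c : cell) :=
  let: Cell _ _ l s _ := c in exists i (p : P i) (t : 'I_(l i p)), c' = s i p t.

Definition cell_copy (c : cell) i (p : P i) : V i := (0, delta c p).

Definition cell_rel (c : cell) i (k : P i) : V i := cell_copy c k - attach c k.

Definition hered (D : set cell) := forall c c', D c -> subcell c' c -> D c'.

(** The submodule generated by the attaching relations of the cells in [D], as an intersection:
    applying a membership proof is an induction on generation. *)
Definition relspan (D : set cell) i (v : V i) :=
  forall S, submod S -> (forall c k, D c -> K (cell_index c) k -> S (cell_rel c k)) ->
      S v.

Definition supported (D : set cell) i (v : V i) := on D v.2.

(** The hereditary closure of the subcells of [c], again as an intersection. *)
Definition below (c c' : cell) :=
  forall D, hered D -> (forall c'', subcell c'' c -> D c'') -> D c'.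

(** A cell carries bare functions. Its attaching function has to become a chain map on [K], but only
    in the quotient by the relations of earlier cells, which has not been formed yet; hence
    linearity and compatibility with differentials are asked modulo [relspan (below c)]. *)
Definition admissible (c : cell) :=
  (forall i a (p q : P i), K (cell_index c) p -> K (cell_index c) q ->
     relspan (below c) (attach c (a *: p + q) - (a *: attach c p + attach c q))) /\
  (forall i (p : P (i + 1)), K (cell_index c) p ->
     relspan (below c) (attach c (cdiff P i p) - cdiff V i (attach c p))).

Definition good_cells (D : set cell) := hered D /\ forall c, D c -> admissible c.

(** A union of good sets is good, so this is the largest one; recipes that are not hereditarily
    admissible are discarded here. *)
Definition all_cells (c : cell) := exists2 D, good_cells D & D c.

Lemma relspan_submod D i : submod (@relspan D i).
Proof.
split; first by move=> S [].
move=> a x y hx hy S hS hg; have [_ h] := hS.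
by apply: h; [apply: hx | apply: hy].
Qed.

Lemma relspan_rel (D : set cell) c i (k : P i) : D c -> K (cell_index c) k ->
    relspan D (cell_rel c k).
Proof. by move=> Dc Kk S _; apply. Qed.

Lemma relspan_mono (D D' : set cell) i : D `<=` D' -> @relspan D i `<=` @relspan D' i.
Proof. by move=> DD' v h S hS hg; apply: h => // c k Dc; apply: hg; apply: DD'. Qed.

Lemma supported_submod D i : submod (@supported D i).
Proof.
have [h0 h] := on_submod (P i) D.
by split=> [|a x y]; [apply: h0 | apply: h].
Qed.

Lemma supported_mono (D D' : set cell) i : D `<=` D' ->
    @supported D i `<=` @supported D' i.
Proof. by move=> DD' v; apply: onS. Qed.

Lemma supported_attach (D : set cell) c i (p : P i) : (forall c', subcell c' c ->
    D c') -> supported D (attach c p).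
Proof.
case: c => j z l s f h; rewrite /supported /=.
apply: (@submod_sum _ _ _ _ _ _ (on D)); first exact: on_submod.
by move=> t _; apply: on_delta; apply: h; exists i, p, t.
Qed.

Lemma supported_copy (D : set cell) c i (p : P i) : D c -> supported D (cell_copy c p).
Proof. exact: on_delta. Qed.

Lemma supported_diff D i (v : V (i + 1)) : supported D v -> supported D (cdiff V i v).
Proof.
move=> h c; rewrite /supported /= /dsum_diff /= fsup_cdiffE => hc.
by apply: h => v0; apply: hc; rewrite v0 linear0.
Qed.

Lemma relspan_supported (D : set cell) i (v : V i) : hered D -> relspan D v ->
    supported D v.
Proof.
move=> hD; apply; first exact: supported_submod.
move=> c k Dc Kk; apply: (submodB (@supported_submod D i)); first exact: supported_copy.
by apply: supported_attach => c'; apply: hD.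
Qed.

Lemma below_hered c : hered (below c).
Proof. by move=> c1 c2 h1 h2 D hD hc; apply: (hD c1) => //; apply: h1. Qed.

Lemma below_sub (D : set cell) c : hered D -> (forall c', subcell c' c -> D c') ->
    below c `<=` D.
Proof. by move=> hD h c'; apply. Qed.

Lemma subcell_below c c' : subcell c' c -> below c c'.
Proof. by move=> h D _; apply. Qed.

Lemma good_all_cells : good_cells all_cells.
Proof.
split=> [c c' [D gD Dc] cc'|c [D [_ h] Dc]]; last exact: h.
by exists D => //; have [h _] := gD; apply: h cc'.
Qed.

Lemma good_cells_set0 : good_cells set0.
Proof. by split=> [c c' []|c []]. Qed.

Lemma cell_copy_lin c i : linear (@cell_copy c i).
Proof.
move=> a p q; apply: injective_projections => /=; first by rewrite scaler0 addr0.
exact: delta_lin.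
Qed.

Lemma cell_copy_diff c i (p : P (i + 1)) : cell_copy c (cdiff P i p) =
    cdiff V i (cell_copy c p).
Proof.
apply: injective_projections; rewrite /= /dsum_diff /=; first by rewrite linear0.
by rewrite fsup_cdiff_delta.
Qed.

Lemma attach0 (D : set cell) c i : admissible c -> below c `<=` D ->
    relspan D (attach c (0 : P i)).
Proof.
move=> [h _] bD; have [K0 _] := (hK (cell_index c)).1 i.
have := h i 1 0 0 K0 K0; rewrite scaler0 addr0 scale1r opprD addrA subrr sub0r.
move=> /(relspan_mono bD)/(submodN (relspan_submod D i)).
by rewrite opprK.
Qed.

Lemma relspan_diff D i (v : V (i + 1)) : good_cells D -> relspan D v ->
    relspan D (cdiff V i v).
Proof.
move=> [hD okD] h; apply: (h (cdiff V i @^-1` @relspan D i)).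
  exact/submod_preimage/relspan_submod.
move=> c k Dc Kk; rewrite /preimage /= /cell_rel linearB -cell_copy_diff.
have bD : below c `<=` D by apply: below_sub => // c'; apply: hD.
have -> : cell_copy c (cdiff P i k) - cdiff V i (attach c k) =
    cell_rel c (cdiff P i k) + (attach c (cdiff P i k) - cdiff V i (attach c k)).
  by rewrite /cell_rel addrA subrK.
apply: (submodD (relspan_submod D i)).
  by apply: relspan_rel => //; apply: (hK _).2.
by apply: relspan_mono bD _ _; apply: (okD c Dc).2.
Qed.

Lemma cell_rel0 (D : set cell) c i : admissible c -> below c `<=` D ->
    relspan D (cell_rel c (0 : P i)).
Proof.
move=> h1 h2; have -> : cell_rel c 0 = - attach c (0 : P i).
  rewrite /cell_rel; have -> : cell_copy c (0 : P i) = 0; last by rewrite sub0r.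
  apply: injective_projections => //=.
  by apply: fsupP => x; rewrite fval0 deltaE; case: asboolP.
by apply: (submodN (relspan_submod D i)); apply: attach0.
Qed.

Lemma step_identity (U : zmodType) (x x' p p' s s' t : U) :
  x + (p - s) + (x' + (p' - s')) = x + x' + (t - (s + s')) + (p + p' - t).
Proof.
rewrite addrACA -[RHS]addrA; congr (_ + _).
by rewrite addrACA -opprD [RHS]addrC addrA subrK.
Qed.

Section Step.
Variables (D : set cell) (c : cell).
Hypotheses (gD : good_cells D) (okcc : admissible c) (cD : forall c', subcell c' c ->
    D c').

Let D' := D `|` [set c].

Let bD : below c `<=` D.
Proof. by apply: below_sub => //; case: gD. Qed.

Lemma good_cells_step : good_cells D'.
Proof.
have [hD okD] := gD; split=> [c1 c2 [D1|->] c21|c1 [D1|->]] //.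
- by left; apply: hD c21.
- by left; apply: cD.
- exact: okD.
Qed.

(** Admissibility makes the relations of the new cell closed under linear combinations modulo old
    relations, so a single [cell_rel c k] suffices. *)
Lemma relspan_step i (v : V i) : relspan D' v ->
  exists y k, [/\ relspan D y, K (cell_index c) k & v = y + cell_rel c k].
Proof.
have [[K0 KK] RD] := ((hK (cell_index c)).1 i, relspan_submod D i).
have mk k0 (y : V i) : relspan D (y - cell_rel c k0) -> K (cell_index c) k0 ->
    exists y' k,
    [/\ relspan D y', K (cell_index c) k & y = y' + cell_rel c k].
  by move=> h Kk; exists (y - cell_rel c k0), k0; rewrite subrK.
move=> h; apply: (h (fun v => exists y k, [/\ relspan D y, K (cell_index c) k & v =
    y + cell_rel c k])).
  split.
    by apply: (mk 0) => //; rewrite sub0r; apply: (submodN RD); apply: cell_rel0.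
  move=> a _ _ [y [k [Ry Kk ->]]] [y' [k' [Ry' Kk' ->]]].
  exists (a *: y + y' + (attach c (a *: k + k') - (a *: attach c k + attach c k'))),
      (a *: k + k').
  split.
  - apply: (submodD RD); first by have [_] := RD; apply.
    by apply: relspan_mono bD _ _; apply: okcc.1.
  - exact: KK.
  - rewrite /cell_rel cell_copy_lin scalerDr scalerBr; exact: step_identity.
move=> c1 k [D1|->] Kk; last by exists 0, k; split=> //; [case: RD | rewrite add0r].
by apply: (mk 0) => //; apply: (submodB RD); [apply: relspan_rel | apply: cell_rel0].
Qed.

Lemma supported_val0 i (v : V i) : supported D v -> ~ D c -> fval v.2 c = 0.
Proof. exact: on_notin. Qed.

Lemma cell_rel_val i (k : P i) : ~ D c -> fval (cell_rel c k).2 c = k.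
Proof.
move=> nD; rewrite fvalB /= delta_same (supported_val0 (supported_attach cD)) // subr0 //.
Qed.

Lemma relspan_step_val i (v : V i) : ~ D c -> relspan D' v ->
    K (cell_index c) (fval v.2 c).
Proof.
move=> nD /relspan_step[y [k [Ry Kk ->]]]; rewrite fvalD cell_rel_val //.
by rewrite (supported_val0 (relspan_supported _ Ry)) ?add0r //; case: gD.
Qed.

(** The coordinate at [c] of an old relation plus [cell_rel c k] is [k]; where it vanishes, old
    relations alone remain. *)
Lemma relspan_step_supported i (v : V i) : ~ D c -> relspan D' v -> supported D v ->
    relspan D v.
Proof.
move=> nD /relspan_step[y [k [Ry Kk ->]]] hv.
have k0 : k = 0.
  have := supported_val0 hv nD; rewrite fvalD cell_rel_val //.
  by rewrite (supported_val0 (relspan_supported _ Ry)) ?add0r //; case: gD.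
by rewrite k0; apply: (submodD (relspan_submod D i)) => //; apply: cell_rel0.
Qed.

End Step.

(** Cells are well-founded trees, so a descent along subcells that stay in [D] and outside [E] must
    stop. *)
Lemma min_cell (D E : set cell) : hered D -> ~ (D `<=` E) ->
  exists c, [/\ D c, ~ E c & forall c', subcell c' c -> E c'].
Proof.
move=> hD nDE; apply: contrapT => nh; apply: nDE => c Dc; apply: contrapT; move: Dc.
elim: c => j z l s IH f Dc nE; apply: nh.
exists (Cell j z s f); split=> // c' [i [p [t ->]]].
by apply: contrapT => ns; apply: (IH i p t) => //; apply: hD Dc _; exists i, p, t.
Qed.

Lemma relspan_chain (F : set (set cell)) i : F !=set0 -> total_on F subset ->
  @relspan (\bigcup_(D in F) D) i `<=` \bigcup_(D in F) @relspan D i.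
Proof.
move=> [D0 FD0] tot v h; apply: (h (\bigcup_(D in F) @relspan D i)); last first.
  by move=> c k [D FD Dc] Kk; exists D => //; apply: relspan_rel.
split; first by exists D0 => //; case: (relspan_submod D0 i).
move=> a x y [D1 F1 R1] [D2 F2 R2]; have [s|s] := tot _ _ F1 F2.
  by exists D2 => //; have [_] := relspan_submod D2 i; apply=> //; apply: relspan_mono R1.
by exists D1 => //; have [_] := relspan_submod D1 i; apply=> //; apply: relspan_mono R2.
Qed.

Lemma good_cells_chain F : chain_in good_cells F -> good_cells (\bigcup_(D in F) D).
Proof.
move=> [Fg _ _]; split=> [c c' [D FD Dc] cc'|c [D FD Dc]].
  by exists D => //; have [h _] := Fg D FD; apply: h cc'.
by have [_] := Fg D FD; apply.
Qed.

(** Attaching further cells imposes no new relation on the old part: minimal missing cells are added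
    one at a time, each conservatively. With [D] empty this gives the injectivity of [Z] into the
    quotient. *)
Lemma relspan_restrict (D D' : set cell) i (v : V i) : good_cells D -> good_cells D' ->
    D `<=` D' ->
  relspan D' v -> supported D v -> relspan D v.
Proof.
move=> gD gD' DD'; move: i v.
pose ok E := forall i (v : V i), relspan E v -> supported D v -> relspan D v.
apply: (@climb_ind _ [set E | [/\ good_cells E, D `<=` E & E `<=` D']] ok D D') => //.
- move=> F [Fh [E0 FE0] tot]; split.
  + by apply: good_cells_chain; split=> [E /Fh[]||] //; exists E0.
  + by move=> c Dc; exists E0 => //; have [_ h _] := Fh E0 FE0; apply: h.
  + by move=> c [E FE Ec]; have [_ _ h] := Fh E FE; apply: h.
- move=> F [Fh F0 tot] okF i v /(relspan_chain F0 tot)[E FE RE]; exact: okF RE.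
- by split=> // x.
- move=> E [gE DE ED'] okE nED'; have [|c [D'c nE cE]] := @min_cell D' E gD'.1.
    by move=> h; apply: nED'; apply/seteqP.
  have [_ /(_ c D'c) okcc] := gD'.
  exists (E `|` [set c]); split.
  + split; first exact: good_cells_step.
      by move=> x Dx; left; apply: DE.
    by move=> x [/ED'//|->].
  + by move=> x Ex; left.
  + by move=> h; apply: nE; rewrite -h; right.
  + move=> i v RE hv; apply: okE => //; apply: relspan_step_supported RE _ => //.
    exact: supported_mono DE _ hv.
Qed.

Lemma relspan_set0 i (v : V i) : relspan set0 v -> v = 0.
Proof. by move=> h; apply: (h [set 0]); [apply: submod0 | move=> c k]. Qed.

(** Every value of [f] is a finite sum over available cells, so one [Cell] records the whole of [f].
    This closure of the tree type takes the place of the cofinality argument that usually ends the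
    small object argument. *)
Lemma attach_surj j (f : forall i, P i -> V i) : (forall i p,
    supported all_cells (f i p)) ->
  exists c, [/\ cell_index c = j, forall i p, attach c p = f i p & forall c',
      subcell c' c -> all_cells c'].
Proof.
move=> hf.
have S i (p : P i) := cid2 (fsup_sum (f i p).2).
pose s i p : seq {classic cell} := s2val (S i p).
have sP i p : forall x : cell, fval (f i p).2 x <> 0 <->
    (x : {classic cell}) \in s i p := (s2valP' (S i p)).1.
have sE i p : (f i p).2 = \sum_(x <- s i p) delta x (fval (f i p).2 x) :=
    (s2valP' (S i p)).2.
exists (@Cell j (fun i p => (f i p).1) (fun i p => size (s i p))
  (fun i p t => tnth (in_tuple (s i p)) t)
  (fun i p t => fval (f i p).2 (tnth (in_tuple (s i p)) t))); split=> //.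
  move=> i p; apply: injective_projections => //=.
  by rewrite [RHS]sE [RHS]big_tnth.
move=> c' [i [p [t ->]]]; apply: (hf i p); apply/sP; exact: mem_tnth.
Qed.

Lemma subcomplex_relspan D : good_cells D -> subcomplex (fun i => @relspan D i).
Proof. by move=> gD; split=> [i|i v]; [apply: relspan_submod | apply: relspan_diff]. Qed.

Lemma subcomplex_supported D : subcomplex (fun i => @supported D i).
Proof. by split=> [i|i v]; [apply: supported_submod | apply: supported_diff]. Qed.

Lemma filtration_supported i : filtration good_cells (fun D => @supported D i).
Proof.
have [|h1 h2] := @filtration_on R cell good_cells cell (P i) id.
  by split=> [//|F _ c].
by split=> [D D' DD' v|F hF v]; [apply: h1 | apply: h2].
Qed.

(** [B] is made of the elements supported on good cells, modulo all relations. A partial map on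
    [K j] is extended by the copy of [P] belonging to the cell that records it, and the cokernel of
    [Z] is filtered by good sets of cells, with layers [P] modulo [K j]. *)
Lemma cells_extension : exists B A (z : chain_map Z B) (p : chain_map B A),
  [/\ short_exact z p,
    forall j (f : forall i, P i -> B i), (forall i, linear_on (@K j i) (f i)) ->
      (forall i (x : P (i + 1)), K j x -> f i (cdiff P i x) = cdiff B i (f (i + 1) x)) ->
      exists g : chain_map P B, forall i x, K j x -> g i x = f i x
  & forall n, (forall j, exists L (r : chain_map P L), [/\ forall i z, exists x,
      r i x = z,
        forall i x, r i x = 0 <-> K j x & ex_tilde (@projdim_le R n) L]) ->
      ex_tilde (@projdim_le R n) A].
Proof.
have [B [q hq]] := is_subquo_complex_exists (subcomplex_relspan good_all_cells)
    (subcomplex_supported all_cells).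
have [hq' qd] := hq.
have ql i : linear_on (@supported all_cells i) (q i) by have [] := hq' i.
have qk i v : supported all_cells v -> (q i v = 0 <->
    relspan all_cells v) by have [_ _ h] := hq' i; apply: h.
have qs i b : exists2 v, supported all_cells v & q i v = b by have [_ h _] := hq' i;
    apply: h.
have hV i := @supported_submod all_cells i.
have VZ D i (z : Z i) : supported D ((z, 0) : V i) by move=> c; rewrite fval0.
have [||z zE] := @mk_chain_map R Z B (fun i x => q i ((x, 0) : V i)).
- move=> i a x y; rewrite -ql; [|exact: VZ|exact: VZ]; congr (q i _).
  by apply: injective_projections; rewrite //= scaler0 addr0.
- move=> i x; rewrite -qd; last exact: VZ.
  by congr (q i _); apply: injective_projections; rewrite //= linear0.
have zi i : injective (z i).
  move=> x y; rewrite !zE => e.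
  have : q i ((x - y, 0) : V i) = 0.
    have -> : ((x - y, 0) : V i) = (x, 0) - (y, 0).
      by apply: injective_projections; rewrite //= subr0.
    by rewrite (linear_onB (hV i) (ql i)) ?e ?subrr //; apply: VZ.
  move=> /(qk i _ (VZ _ _ _)) h.
  have := relspan_restrict good_cells_set0 good_all_cells (fun _ => False_ind _) h (VZ
      _ _ _).
  by move=> /relspan_set0[] /eqP; rewrite subr_eq0 => /eqP.
have [A [p [ps pk]]] := quotient_complex (subcomplex_image z (@subcomplexT _ Z)).
have pkz i x : p i x = 0 <-> exists a, z i a = x.
  by rewrite pk; split=> [[a _ <-]|[a <-]]; exists a.
exists B, A, z, p; split=> //.
  move=> j f fl fd.
  have S i x : exists v, supported all_cells v /\ (K j x -> q i v = f i x).
    by have [v hv <-] := qs i (f i x); exists v.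
  pose v i x := sval (cid (S i x)).
  have vV i x : supported all_cells (v i x) by have [] := svalP (cid (S i x)).
  have vE i x : K j x -> q i (v i x) = f i x by have [_] := svalP (cid (S i x)).
  have [c [cj cv ct]] := attach_surj j vV.
  have bt : below c `<=` all_cells by apply: below_sub => //; case: good_all_cells.
  have gb : good_cells (below c).
    split; first exact: below_hered.
    by move=> c' /bt h; have [_] := good_all_cells; apply.
  have bV i x : supported (below c) (v i x).
    by rewrite -cv; apply: supported_attach => c'; apply: subcell_below.
  have hb i := @supported_submod (below c) i.
  (* The pointwise lift [v] of [f] respects the structure of [K j] modulo all relations. As its
     values are supported on [below c], conservativity brings these relations down to [below c]. *)
  have okcc : admissible c.
    split.
      rewrite cj => i a x y Kx Ky; rewrite !cv.
      have [_ KK] := (hK j).1 i.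
      have ? : supported (below c) (a *: v i x + v i y) by have [_] := hb i; apply;
          apply: bV.
      apply: (relspan_restrict gb good_all_cells bt); last by apply: (submodB (hb i)).
      apply/qk; first by apply: (submodB (hV i)) => //; apply: supported_mono bt _ _.
      rewrite (linear_onB (hV i) (ql i)) //; last exact: supported_mono bt _ _.
      by rewrite ql // !vE ?fl ?subrr //; apply: KK.
    rewrite cj => i x Kx; rewrite !cv.
    apply: (relspan_restrict gb good_all_cells bt); last first.
      by apply: (submodB (hb i)) => //; apply: supported_diff.
    apply/qk; first by apply: (submodB (hV i)) => //; apply: supported_diff.
    rewrite (linear_onB (hV i) (ql i)) //; last exact: supported_diff.
    by rewrite qd // !vE // ?fd ?subrr //; apply: (hK j).2.
  have tc : all_cells c.
    by exists (all_cells `|` [set c]); [apply: good_cells_step => //;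
        apply: good_all_cells | right].
  have cV i (x : P i) : supported all_cells (cell_copy c x) by apply: supported_copy.
  have [||g gE] := @mk_chain_map R P B (fun i x => q i (cell_copy c x)).
  - by move=> i a x y; rewrite cell_copy_lin ql.
  - by move=> i x; rewrite cell_copy_diff qd.
  exists g => i x Kx; rewrite gE -(vE i x Kx) -cv; apply/eqP; rewrite -subr_eq0.
  have aV : supported all_cells (attach c x) by rewrite cv.
  rewrite -(linear_onB (hV i) (ql i)) //; apply/eqP/qk.
    exact: (submodB (hV i)).
  by apply: relspan_rel; rewrite // cj.
move=> n hL.
pose pq i v := p i (q i v).
have pql i D : D `<=` all_cells -> linear_on (@supported D i) (pq i).
  by move=> Dt a x y hx hy; rewrite /pq ql ?linearP //; apply: supported_mono Dt _ _.
have pq0 i D (v : V i) : D `<=` all_cells -> good_cells D -> supported D v -> pq i v =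
    0 ->
    exists x : Z i, relspan D (v - ((x, 0) : V i)).
  move=> Dt gD hv /pkz[x xv]; exists x.
  apply: (relspan_restrict gD good_all_cells Dt);
      last by apply: (submodB (@supported_submod D i)).
  apply/qk; first by apply: (submodB (hV i)) => //; apply: supported_mono Dt _ _.
  by rewrite (linear_onB (hV i) (ql i)) // -?zE ?xv ?subrr //;
      apply: supported_mono Dt _ _.
have Ht D : good_cells D -> D `<=` all_cells by move=> gD c Dc; exists D.
pose N (D : set cell) i := pq i @` (@supported D i).
have pqd i D (v : V (i + 1)) : D `<=` all_cells -> supported D v ->
    pq i (cdiff V i v) = cdiff A i (pq (i + 1) v).
  by move=> Dt hv; rewrite /pq qd ?cmap_diff //; apply: supported_mono Dt _ hv.
apply: (@ex_tilde_climb R cell good_cells good_cells_chain n A N set0 all_cells) => //.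
- exact: good_cells_set0.
- move=> i; have [h1 h2] := filtration_supported i;
    split=> [D D' DD' _ [v hv <-]|F hF _ [v hv <-]].
    by exists v => //; apply: h1 hv.
  by have [D FD Dv] := h2 F hF v hv; exists D => //; exists v.
split.
- move=> D gD; split=> [i|i _ [v hv <-]].
    by apply: submod_image; [apply: supported_submod | apply: pql; apply: Ht].
  by exists (cdiff V i v); [apply: supported_diff | apply: (pqd i D) => //; apply: Ht].
(* Without cells the filtration of the cokernel starts at 0, realised as the disk complex on no
   generators. *)
- exists (disk R (fun _ => void)), (fun _ _ => 0); split; last exact: disk_ex_tilde.
  have d0 i (x : disk R (fun _ => void) i) : x = 0.
    by apply: injective_projections; apply: fsupP => -[].
  have N0 i x : N set0 i x -> x = 0.
    move=> [[u v] hv <-]; have -> : v = 0.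
      by apply: fsupP => c; rewrite fval0; apply: on_notin hv _.
    by apply/pkz; exists u; rewrite zE.
  split=> [i|i x _]; last by rewrite linear0.
  split=> [a x y _ _|x|x /N0 ->] //.
  exists 0; last exact/esym/d0.
  exists 0; first by case: (@supported_submod set0 i).
  rewrite /pq (linear_on0 (hV i) (ql i)); exact: linear0.
- move=> D gD nDt; have [|c [tc nDc cD]] := @min_cell all_cells D good_all_cells.1.
    by move=> h; apply: nDt; apply/seteqP; split=> //; apply: Ht.
  have [_ /(_ c tc) okcc] := good_all_cells; have gD' := good_cells_step gD okcc cD.
  pose D' := D `|` [set c]; exists D'; split=> //.
  + by move=> x Dx; left.
  + by move=> h; apply: nDc; rewrite -h; right.
  have [L [r [rs rk eL]]] := hL (cell_index c); have [hD okD] := gD.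
  have bD : below c `<=` D by apply: below_sub => //; case: gD.
  have DD' : D `<=` D' by move=> x Dx; left.
  have D't := Ht D' gD'; have Dt := Ht D gD.
  (* The layer is identified with [L] by the coordinate at the new cell, read modulo [K]; this is
     well defined since relations have their coordinate at [c] in [K]. *)
  pose rr i (v : V i) := r i (fval v.2 c).
  have rrl i B' : linear_on B' (rr i) by move=> a x y _ _; rewrite /rr fval_lin linearP.
  have S i : exists r' : A i -> L i, is_subquo (N D i) (N D' i) r' /\ forall v,
      supported D' v -> r' (pq i v) = rr i v.
    apply: is_subquo_image => //; first exact: supported_submod.
    + exact: pql.
    + move=> y; have [x <-] := rs i y; exists (cell_copy c x).
        by apply: supported_copy; right.
      by rewrite /rr delta_same.
    + move=> v hv /(pq0 i D' v D't gD' hv)[x /(relspan_step_val gD okcc cD nDc)].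
      by rewrite fvalB fval0 subr0 => /rk.
    + move=> v hv; split=> [/rk Kv|[w hw e]].
        have hrel : relspan D' (cell_rel c (fval v.2 c)) by apply: relspan_rel => //;
            right.
        exists (v - cell_rel c (fval v.2 c)).
          have : supported D' (v - cell_rel c (fval v.2 c)).
            by apply: (submodB (@supported_submod D' i)) => //;
                apply: relspan_supported hrel; case: gD'.
          move=> h c' hc'; have [//|e] := h c' hc'; case: hc'; rewrite e.
          by rewrite fvalB (cell_rel_val cD) // subrr.
        have ht := relspan_mono D't hrel.
        have hvt := relspan_supported good_all_cells.1 ht.
        rewrite /pq (linear_onB (hV i) (ql i)) //; last exact: supported_mono D't _ hv.
        by rewrite (_ : q i (cell_rel c _) = 0) ?subr0 //; apply/qk.
      have hw' := supported_mono DD' hw.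
      have [||x] := pq0 i D' (v - w) D't gD'.
      * by apply: (submodB (@supported_submod D' i)).
      * by rewrite (linear_onB (@supported_submod D' i) (pql i D' D't)) // e subrr.
      move=> /(relspan_step_val gD okcc cD nDc).
      rewrite !fvalB fval0 subr0 (supported_val0 hw) // subr0 => h; exact/rk.
  exists L, (fun i => sval (cid (S i))); split=> //; split=> [i|i _ [v hv <-]].
    by have [] := svalP (cid (S i)).
  have [_ h1] := svalP (cid (S i)); have [_ h2] := svalP (cid (S (i + 1))).
  rewrite -(pqd i D') // h1; last exact: supported_diff.
  by rewrite h2 // /rr fsup_cdiffE cmap_diff.
- move=> i x; have [b <-] := ps i x; have [v hv <-] := qs i b; by exists v.
Qed.

End Cells.

(** * Cardinality *)

Section Cardinality.

Definition inj_into (T U : Type) (A : set T) (B : set U) (f : T -> U) :=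
  (forall x, A x -> B (f x)) /\ forall x y, A x -> A y -> f x = f y -> x = y.

(** Comparability of cardinals. If [B] does not inject into [A], a partial injection from [A] always
    misses a point of [B], as otherwise its inverse would inject [B] into [A]; so it can be enlarged
    until it is defined on [A]. *)
Lemma inj_into_total (T : Type) (A B : set T) :
  (exists f, inj_into A B f) \/ (exists f, inj_into B A f).
Proof.
have [BA|nBA] := pselect (exists f, inj_into B A f); [by right | left].
apply: (@zorn_family T [set E | E `<=` A] T (fun _ => T) id (fun E g => inj_into E B g)
    set0 A id).
- by split=> // F _ x.
- by move=> F [FA _ _] x [E FE Ex]; apply: FA Ex.
- move=> F g hF okF; split=> [x [E /okF[h _] Ex]|x y [E1 F1 x1] [E2 F2 y2]];
    first exact: h.
  have [E [FE h1 h2]] := chain_finite hF F1 F2.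
  by have [_] := okF E FE; apply; [apply: h1 | apply: h2].
- move=> E g g' _ gg' [h1 h2]; split=> [x Ex|x y Ex Ey]; rewrite -!gg' //;
    first exact: h1.
  exact: h2.
- by [].
- by split.
move=> E g EA [gB gi] nEA.
have [x Ax nEx] : exists2 x, A x & ~ E x.
  apply: contrapT => h; apply: nEA; apply/seteqP; split=> // x Ax.
  by apply: contrapT => nEx; apply: h; exists x.
have [y By yg] : exists2 y, B y & forall e, E e -> g e <> y.
  apply: contrapT => h; apply: nBA.
  have /choice[f fP] : forall y, exists e, B y -> E e /\ g e = y.
    move=> y; have [By|nBy] := pselect (B y); last by exists y.
    apply: contrapT => ne; apply: h; exists y => // e Ee gy.
    by apply: ne; exists e.
  exists f; split=> [y /fP[/EA]//|y z /fP[_ h1] /fP[_ h2] e].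
  by rewrite -h1 -h2 e.
exists (E `|` [set x]), (fun z => if `[< z = x >] then y else g z); split.
- by move=> z [/EA//|->].
- by move=> z; left.
- by move=> h; apply: nEx; rewrite -h; right.
- split=> [z [Ez|->]|z w].
  + by case: asboolP => // _; apply: gB.
  + by case: asboolP.
  + move=> hz hw; case: asboolP => [->|zx]; case: asboolP => [->|wx] //.
    * by case: hw => // Ew /esym/(yg _ Ew).
    * by case: hz => // Ez /(yg _ Ez).
    * by case: hz => // Ez; case: hw => // Ew; apply: gi.
- by move=> z Ez; case: asboolP => // zx; rewrite zx in Ez.
Qed.

(* Zorn's lemma on the injections D * D -> D with D infinite. *)
Lemma square_inj (T : Type) (e : nat -> T) : injective e ->
  exists g : T * T -> T, injective g.
Proof.
move=> ei.
have e01 : e 0%N <> e 1%N by move=> /ei.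
pose sq (D : set T) := [set p : T * T | D p.1 /\ D p.2].
pose D0 := range e.
have [e' e'E] : exists e' : T -> nat, forall m, e' (e m) = m.
  have /choice[e' e'P] : forall x, exists m, forall k, e k = x -> k = m.
    move=> x; have [[m <-]|nx] := pselect (exists m, e m = x); first by exists m => k /ei.
    by exists 0%N => k kx; case: nx; exists k.
  by exists e' => m; apply/esym/e'P.
pose ok (D : set T) (g : T * T -> T) := inj_into (sq D) D g.
apply: contrapT => nsq.
have [g [_ gi]] : exists g, ok setT g.
  apply: (@zorn_family T [set D | D0 `<=` D] (T * T) (fun _ => T) sq ok D0 setT
    (fun p => e (choice.pickle (e' p.1, e' p.2)))).
  - split=> [D D' DD' p [h1 h2]|F hF p [[D1 F1 p1] [D2 F2 p2]]]; first by split;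
      apply: DD'.
    have [D [FD h1 h2]] := chain_finite hF F1 F2.
    by exists D => //; split; [apply: h1 | apply: h2].
  - by move=> F [Fh [D FD] _] x /(Fh D FD) Dx; exists D.
  - move=> F g hF okF; split=> [p [[D1 F1 p1] [D2 F2 p2]]|p q [[D1 F1 p1] [D2 F2 p2]]
      [[D3 F3 q1] [D4 F4 q2]]].
      have [D [FD h1 h2]] := chain_finite hF F1 F2; exists D => //.
      by have [h _] := okF D FD; apply: h; split; [apply: h1 | apply: h2].
    have [D [FD h1 h2]] := chain_finite hF F1 F2.
    have [D' [FD' h3 h4]] := chain_finite hF F3 F4.
    have [E [FE h5 h6]] := chain_finite hF FD FD'.
    have [_] := okF E FE; apply; split.
    + exact/h5/h1.
    + exact/h5/h2.
    + exact/h6/h3.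
    + exact/h6/h4.
  - move=> D g g' _ gg' [h1 h2]; split=> [p Dp|p q Dp Dq]; rewrite -!gg' //;
      first exact: h1.
    exact: h2.
  - by [].
  - split=> [p _|[p1 p2] [q1 q2] [/= [a _ <-] [b _ <-]] [/= [c _ <-] [d _ <-]]].
      by exists (choice.pickle (e' p.1, e' p.2)).
    by rewrite !e'E => /ei/(pcan_inj choice.pickleK)[-> ->].
  move=> D g D0D [gD gi] nDT.
  have De m : D (e m) by apply: D0D; exists m.
  (* If the complement of [D] injects into [D], then T injects into [D] and so does T * T. Otherwise
     the complement contains a copy of [D], into which the injection is enlarged. *)
  have [[h [hD hi]]|[f [fD fi]]] := inj_into_total D (~` D); last first.
    case: nsq; pose k x := if `[< D x >] then g (x, e 0%N) else g (f x, e 1%N).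
    have kD x : D (k x) by rewrite /k; case: asboolP => ?; apply: gD; split=> //=;
        apply: fD.
    have ki : injective k.
      have sqD z m : D z -> sq D (z, e m) by move=> Dz; split=> /=.
      move=> x y; rewrite /k; case: asboolP => Dx; case: asboolP => Dy e1.
      - by have [] := gi _ _ (sqD _ _ Dx) (sqD _ _ Dy) e1.
      - by have [_ /ei] := gi _ _ (sqD _ _ Dx) (sqD _ _ (fD _ Dy)) e1.
      - by have [_ /ei] := gi _ _ (sqD _ _ (fD _ Dx)) (sqD _ _ Dy) e1.
      - by have [e2] := gi _ _ (sqD _ _ (fD _ Dx)) (sqD _ _ (fD _ Dy)) e1; apply: fi.
    exists (fun p => g (k p.1, k p.2)) => -[x y] [x' y'] e1.
    by have [/ki -> /ki ->] := gi (k x, k y) (k x',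
        k y') (conj (kD x) (kD y)) (conj (kD x') (kD y')) e1.
  pose D' := D `|` (h @` D).
  have /choice[c cP] : forall x, exists y, (D x -> y = x) /\ (~ D x -> D' x -> D y /\
      h y = x).
    move=> x; have [Dx|nDx] := pselect (D x); first by exists x.
    have [[y Dy <-]|nx] := pselect ((h @` D) x); first by exists y;
        split=> [h1|_ _] //; case: (hD y Dy).
    by exists x; split=> // _ [].
  (* A point of [D'] is coded in [D] by its counterpart [c x] and a tag telling its half. Pairs not
     in D * D can then be sent injectively into the image of [h], away from the old values. *)
  pose u x := g (c x, if `[< D x >] then e 0%N else e 1%N).
  have cD x : D' x -> D (c x).
    move=> D'x; have [Dx|nDx] := pselect (D x); first by rewrite (cP x).1.
    by have [] := (cP x).2 nDx D'x.
  have uD x : D' x -> D (u x) by move=> /cD ?; apply: gD; split=> //=; case: ifP.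
  have ui x y : D' x -> D' y -> u x = u y -> x = y.
    have sqD z : D' z -> sq D (c z, if `[< D z >] then e 0%N else e 1%N).
      by move=> D'z; split=> /=; [apply: cD | case: ifP].
    move=> D'x D'y /(gi _ _ (sqD _ D'x) (sqD _ D'y))[].
    move=> cxy; case: asboolP => Dx; case: asboolP => Dy //; try by move=> /ei.
      by rewrite -(cP x).1 // cxy (cP y).1.
    by have [[_ <-] [_ <-]] := ((cP x).2 Dx D'x, (cP y).2 Dy D'y); rewrite cxy.
  exists D', (fun p => if `[< sq D p >] then g p else h (g (u p.1, u p.2))); split.
  - by move=> x /D0D; left.
  - by move=> x Dx; left.
  - move=> e1; have : D' (h (e 0%N)) by right; exists (e 0%N).
    by rewrite e1; apply: hD.
  - have gu p : sq D' p -> D (g (u p.1, u p.2)).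
      by move=> [? ?]; apply: gD; split; apply: uD.
    split=> [p Dp|p q Dp Dq].
      by case: asboolP => [/gD|_]; [left | right; exists (g (u p.1, u p.2)) => //;
          apply: gu].
    case: asboolP => sp; case: asboolP => sq_.
    + exact: gi.
    + by move=> e1; case: (hD _ (gu q Dq)); rewrite -e1; apply: gD.
    + by move=> e1; case: (hD _ (gu p Dp)); rewrite e1; apply: gD.
    + move=> e1; have {e1} := hi _ _ (gu _ Dp) (gu _ Dq) e1.
      case: p q Dp Dq {sp sq_} => [p1 p2] [q1 q2] [/= p1D p2D] [/= q1D q2D] e1.
      have [] := gi (_, _) (_, _) (conj (uD _ p1D) (uD _ p2D)) (conj (uD _ q1D) (uD _
          q2D)) e1.
      by move=> /(ui _ _ p1D q1D) -> /(ui _ _ p2D q2D) ->.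
  - by move=> p sp; case: asboolP.
by case: nsq; exists g => p q; apply: gi.
Qed.

End Cardinality.

(** * Sets of cardinality at most that of [K] *)

Section Small.
Variable K : smallType.
Hypothesis K_infinite : infinite_set [set: K].

(** A partial enumeration by [K], allowed to take values outside [A]; [option] accommodates the
    empty type. *)
Definition small (T : Type) (A : set T) :=
  exists f : K -> option T, forall x, A x -> exists k, f k = Some x.

Lemma nat_inj : exists e : nat -> K, injective e.
Proof.
have /infiniteP/card_leP/injfunPex[f _ fi] := K_infinite.
exists (fun m => set_val (f (to_setT m))) => m m' /val_inj h.
have := fi (to_setT m) (to_setT m') _ _ h.
rewrite !inE => /(_ I I) e; exact: (congr1 set_val e).
Qed.

Lemma card_le_inj (T U : Type) : ([set: T] #<= [set: U]) ->
  exists f : T -> U, injective f.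
Proof.
move=> /card_leP/injfunPex[f _ fi].
exists (fun m => set_val (f (to_setT m))) => m m' /val_inj h.
have := fi (to_setT m) (to_setT m') _ _ h.
by rewrite !inE => /(_ I I) e; exact: (congr1 set_val e).
Qed.

Lemma inj_small (T : Type) (f : T -> K) : injective f -> small [set: T].
Proof.
move=> fi; have /choice[g gP] : forall k, exists y, forall x, f x = k -> y = Some x.
  move=> k; have [[x <-]|nx] := pselect (exists x, f x = k).
    by exists (Some x) => x' /fi ->.
  by exists None => x xk; case: nx; exists x.
by exists g => x _; exists (f x); apply: gP.
Qed.

Lemma small_nat : small [set: nat].
Proof. by have [e ei] := nat_inj; apply: inj_small ei. Qed.

Lemma pair_surj : exists p : K -> K * K, forall x, exists k, p k = x.
Proof.
have [e ei] := nat_inj; have [g gi] := square_inj ei.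
have /choice[p pP] : forall k, exists x, forall y, g y = k -> x = y.
  move=> k; have [[x <-]|nx] := pselect (exists x, g x = k); first by exists x => y /gi.
  by exists (k, k) => y yk; case: nx; exists y.
by exists p => x; exists (g x); apply: pP.
Qed.

Lemma small_sub (T : Type) (A B : set T) : A `<=` B -> small B -> small A.
Proof. by move=> AB [f fP]; exists f => x /AB/fP. Qed.

Lemma small_rel (T U : Type) (B : set U) (A : set T) (rho : U -> T -> Prop) :
  (forall u x y, rho u x -> rho u y -> x = y) ->
  (forall x, A x -> exists2 u, B u & rho u x) -> small B -> small A.
Proof.
move=> rhof AB [f fP].
have /choice[g gP] : forall k, exists y, forall u x, f k = Some u -> rho u x -> y =
    Some x.
  move=> k; have [[u [x [fk ux]]]|nx] := pselect (exists u x, f k = Some u /\ rho u x).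
    by exists (Some x) => u' x'; rewrite fk => -[<-] /(rhof _ _ _ ux) ->.
  by exists None => u x fk ux; case: nx; exists u, x.
exists g => x /AB[u /fP[k ku] ux]; exists k; exact: gP ku ux.
Qed.

Lemma small_image (T U : Type) (B : set U) (f : U -> T) : small B -> small (f @` B).
Proof.
apply: (small_rel (rho := fun u x => f u = x)); first by move=> u x y <-.
by move=> _ [u Bu <-]; exists u.
Qed.

Lemma small_bigcup (I T : Type) (A : set I) (F : I -> set T) :
  small A -> (forall i, A i -> small (F i)) -> small (\bigcup_(i in A) F i).
Proof.
move=> [f fP] hF; have [p pP] := pair_surj.
have /choice[g gP] : forall i, exists g : K -> option T,
    A i -> forall x, F i x -> exists k, g k = Some x.
  by move=> i; have [/hF[g gP]|nA] := pselect (A i); [exists g | exists (fun _ => None)].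
exists (fun k => obind (fun i => g i (p k).2) (f (p k).1)) => x [i Ai Fx].
have [[k ki] [k' k'x]] := (fP i Ai, gP i Ai x Fx); have [l lE] := pP (k, k').
by exists l; rewrite lE /= ki.
Qed.

Lemma small_prod (T U : Type) (A : set T) (B : set U) :
  small A -> small B -> small (A `*` B).
Proof.
move=> hA hB; apply: (small_sub (B := \bigcup_(x in A) (pair x @` B))).
  by move=> [x y] [/= Ax By]; exists x => //; exists y.
by apply: small_bigcup => // x _; apply: small_image.
Qed.

Lemma small_setU (T : Type) (A B : set T) : small A -> small B -> small (A `|` B).
Proof.
move=> hA hB.
apply: (small_sub (B := \bigcup_(m in [set: nat]) (if m is 0%N then A else B))).
  by move=> x [Ax|Bx]; [exists 0%N | exists 1%N].
by apply: small_bigcup => [|[|m]] //; apply: small_nat.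
Qed.

Lemma small_set1 (T : Type) (x : T) : small [set x].
Proof. by have [e _] := nat_inj; exists (fun _ => Some x) => y ->; exists (e 0%N). Qed.

Fixpoint all_in (T : Type) (A : set T) (s : seq T) :=
  if s is x :: s' then A x /\ all_in A s' else True.

Lemma small_seq (T : Type) (A : set T) : small A -> small (all_in A).
Proof.
move=> hA.
apply: (small_sub (B := \bigcup_(m in [set: nat]) [set s | all_in A s /\ size s = m])).
  by move=> s As; exists (size s).
apply: small_bigcup => [|m _]; first exact: small_nat.
elim: m => [|m IH].
  by apply: small_sub (small_set1 [::]) => -[|x s] [].
apply: small_sub (small_image (fun p => p.1 :: p.2) (small_prod hA IH)) => -[|x s] [] //=.
by move=> [Ax As] [sm]; exists (x, s).
Qed.

Lemma small_mem (T : Type) (s : seq {classic T}) :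
  small (fun x : T => (x : {classic T}) \in s).
Proof.
elim: s => [|y s IH]; first by exists (fun _ => None).
apply: small_sub (small_setU (small_set1 (y : T)) IH) => x.
by rewrite inE => /orP[/eqP|]; [left | right].
Qed.

Lemma small_card (I : smallType) : small [set: I] -> ([set: I] #<= [set: K]).
Proof.
move=> [f fP]; have /choice[g gP] : forall x, exists k, f k = Some x by move=> x;
    apply: fP.
have gi : injective g by move=> x y e; apply: Some_inj; rewrite -!gP e.
apply: inj_card_le; apply: unsquash; apply/injfunPex; exists g => // x y _ _; exact: gi.
Qed.

Lemma card_small (I : Type) : ([set: I] #<= [set: K]) -> small [set: I].
Proof. by move=> /card_le_inj[f]; apply: inj_small. Qed.

Variable R : pzRingType.
Hypothesis card_R_le_K : [set: R] #<= [set: K].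

(** An element is the sum of a finite list of pairs of a scalar and a basis element; the bound on
    [R] enters here. *)
Lemma small_on (X : smallType) (A : set X) : small A -> small (on A : set (freemod R X)).
Proof.
move=> hA; pose sum (l : seq (R * X)) : freemod R X :=
    \sum_(p <- l) delta p.2 (p.1 : R^o).
apply: (small_sub (B := sum @` all_in ([set: R] `*` A))); last first.
  by apply/small_image/small_seq/small_prod => //; apply: card_small.
move=> u uA; have [s _ [sP ->]] := fsup_sum u.
exists [seq (fval u x : R, x) | x <- s]; last by rewrite /sum big_map.
have : forall x : X, (x : {classic X}) \in s -> A x by move=> x /sP/uA.
elim: s {sP} => //= x s IH h; split; first by split=> //=; apply: h; rewrite inE eqxx.
by apply: IH => y ys; apply: h; rewrite inE ys orbT.
Qed.

Definition mspan (M : lmodType R) (A : set M) : set M := eps M @` on A.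

Lemma small_freemod (X : smallType) : small [set: X] -> small [set: freemod R X].
Proof. by move=> /small_on; apply: small_sub. Qed.

Lemma small_om (M : lmodType R) : small [set: M] -> small [set: om M].
Proof.
move=> /small_freemod; apply: (small_rel (rho := fun u x => om_in M x = u)).
  by have [ji _ _] := om_ses M; move=> u x y <- /ji.
by move=> x _; exists (om_in M x).
Qed.

End Small.

(** * Small modules of finite projective dimension have small resolutions *)

Section SmallResolution.
Variables (R : pzRingType) (K : smallType).
Hypothesis K_infinite : infinite_set [set: K].
Hypothesis card_R_le_K : [set: R] #<= [set: K].
Implicit Types M L A B P : lmodType R.

Definition is_iso A B (f : A -> B) := injective f /\ forall y, exists x, f x = y.

Lemma bij_inv A B (f : {linear A -> B}) : is_iso f -> exists g : {linear B -> A},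
    is_iso g.
Proof.
move=> [fi fs]; have /choice[g gE] := fs.
have gl : linear g by move=> a x y; apply: fi; rewrite linearP !gE.
have [G GE] := mk_linear gl; exists G; split=> [x y|x].
  by rewrite !GE => e; rewrite -(gE x) e gE.
by exists (f x); rewrite GE; apply: fi.
Qed.

Lemma small_sum_bij A B (f : {linear A -> B}) : is_iso f ->
  small_sum_cg_projective K A -> small_sum_cg_projective K B.
Proof.
move=> [fi fs] [I [P [inj [cI hP [h1 h2]]]]].
exists I, P, (fun i => f \o inj i : {linear P i -> B}); split=> //; split.
  move=> y; have [x <-] := fs y; have [m [i [v ->]]] := h1 x.
  by exists m, i, v; rewrite linear_sum.
move=> m i v ii; rewrite -(linear_sum f) /= -(linear0 f) => /fi; exact: h2.
Qed.

Lemma regular_projective : projective (R^o : lmodType R).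
Proof.
move=> A B p f ps; have [a pa] := ps (f 1).
have [g gE] : exists g : {linear R^o -> A}, forall r, g r = (r : R) *: a.
  by apply: (@mk_linear R R^o A (fun r => (r : R) *: a)) => c r s;
      rewrite scalerDl scalerA.
by exists g => r; rewrite gE linearZ /= pa -linearZ; congr (f _); apply: mulr1.
Qed.

Lemma small_sum_freemod (X : smallType) : small K [set: X] ->
  small_sum_cg_projective K (freemod R X).
Proof.
move=> hX; have inj_ x := cid (mk_linear (@delta_lin R X R^o x)).
pose inj x : {linear R^o -> freemod R X} := projT1 (inj_ x).
have injE x r : inj x r = delta x r := projT2 (inj_ x) r.
exists X, (fun _ => R^o), inj; split; first exact: small_card.
  move=> _; split; first exact: regular_projective.
  exists (fun _ => 1) => x; exists 1%N, (fun _ => x).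
  by rewrite big_ord1; apply/esym/(mulr1 (x : R)).
split=> [u|m i v ii].
  have [s _ [_ ->]] := fsup_sum u; exists (size s), (fun t => tnth (in_tuple s) t).
  exists (fun t => fval u (tnth (in_tuple s) t)); rewrite big_tnth.
  by apply: eq_bigr => t _; rewrite injE.
move=> e j; have := congr1 (fun u => fval u (i j)) e.
rewrite /= fsum_val fval0 (bigD1 j) //= injE delta_same big1 ?addr0 // => k kj.
by rewrite injE delta_diff // => /ii /eqP; rewrite (negPf kj).
Qed.

Lemma fsup_curry (X Y : smallType) :
  exists f : {linear fsup X (freemod R Y) -> freemod R (X * Y)%type}, is_iso f.
Proof.
have [|f fE] := @fsup_lift R X (freemod R Y) (freemod R (X * Y)%type)
  (fun x u => gen (fun y => bas (x, y)) u); first by move=> x a u v; rewrite linearP.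
exists f.
have fv u x y : fval (f u) (x, y) = fval (fval u x) y.
  apply: (fsup_ind_sub (N := [set u | fval (f u) (x, y) = fval (fval u x) y])).
    split=> [|a v w hv hw] /=; first by rewrite linear0 !fval0.
    by rewrite linearP !fval_lin hv hw.
  move=> x' _; set w := fval u x'; rewrite /= fE.
  apply: (fsup_ind_sub (N := [set w | fval (gen (fun y => bas (x', y)) w) (x, y) =
      fval (fval (delta x' w) x) y])).
    split=> [|a v v' hv hw] /=.
      by rewrite linear0 deltaE; case: asboolP => _; rewrite !fval0.
    by rewrite linearP fval_lin hv hw delta_lin !fval_lin.
  move=> y' _; set r := fval w y'; rewrite /= gen_delta -delta_bas !deltaE.
  case: asboolP => [[-> ->]|ne].
    by case: asboolP => // _; rewrite delta_same.
  case: asboolP => [xx|_]; last by rewrite fval0.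
  by rewrite delta_diff // => yy; apply: ne; rewrite xx yy.
split=> [u v e|w].
  by apply: fsupP => x; apply: fsupP => y; rewrite -!fv e.
apply: (fsup_ind_sub (N := [set w | exists u, f u = w])).
  split=> [|a _ _ [u <-] [v <-]]; first by exists 0; rewrite linear0.
  by exists (a *: u + v); rewrite linearP.
move=> [x y] _; exists (delta x (delta y (fval w (x, y)))).
by rewrite fE gen_delta -delta_bas.
Qed.

Lemma freemod_sum (X Y : smallType) :
  exists f : {linear (freemod R X * freemod R Y)%type -> freemod R (X + Y)%type},
      is_iso f.
Proof.
have [f fE] := copair_linear (gen (fun x : X => (bas (inl x) : freemod R (X + Y)%type)))
  (gen (fun y : Y => (bas (inr y) : freemod R (X + Y)%type))).
exists f.
have fl u v x : fval (f (u, v)) (inl x) = fval u x.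
  rewrite fE fvalD /=.
  have -> : fval (gen (fun y : Y => (bas (inr y) :
      freemod R (X + Y)%type)) v) (inl x) = 0.
    apply: (fsup_ind_sub (N := [set v | fval (gen (fun y : Y => (bas (inr y) :
        freemod R (X + Y)%type)) v) (inl x) = 0])).
      split=> [|a w w' hw hw'] /=; first by rewrite linear0 fval0.
      by rewrite linearP fval_lin hw hw' scaler0 addr0.
    by move=> y _; rewrite /= gen_delta -delta_bas delta_diff.
  rewrite addr0.
  apply: (fsup_ind_sub (N := [set u | fval (gen (fun x : X => (bas (inl x) :
      freemod R (X + Y)%type)) u) (inl x) = fval u x])).
    split=> [|a w w' hw hw'] /=; first by rewrite linear0 !fval0.
    by rewrite linearP !fval_lin hw hw'.
  move=> x' _; rewrite /= gen_delta -delta_bas !deltaE.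
  by case: asboolP => [[->]|ne]; case: asboolP => // e; case: ne; rewrite e.
have fr u v y : fval (f (u, v)) (inr y) = fval v y.
  rewrite fE fvalD /=.
  have -> : fval (gen (fun x : X => (bas (inl x) :
      freemod R (X + Y)%type)) u) (inr y) = 0.
    apply: (fsup_ind_sub (N := [set u | fval (gen (fun x : X => (bas (inl x) :
        freemod R (X + Y)%type)) u) (inr y) = 0])).
      split=> [|a w w' hw hw'] /=; first by rewrite linear0 fval0.
      by rewrite linearP fval_lin hw hw' scaler0 addr0.
    by move=> x _; rewrite /= gen_delta -delta_bas delta_diff.
  rewrite add0r.
  apply: (fsup_ind_sub (N := [set v | fval (gen (fun y : Y => (bas (inr y) :
      freemod R (X + Y)%type)) v) (inr y) = fval v y])).
    split=> [|a w w' hw hw'] /=; first by rewrite linear0 !fval0.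
    by rewrite linearP !fval_lin hw hw'.
  move=> y' _; rewrite /= gen_delta -delta_bas !deltaE.
  by case: asboolP => [[->]|ne]; case: asboolP => // e; case: ne; rewrite e.
split=> [[u v] [u' v'] e|w].
  by congr pair; apply: fsupP => x; [rewrite -(fl u v) e fl | rewrite -(fr u v) e fr].
apply: (fsup_ind_sub (N := [set w | exists u, f u = w])).
  split=> [|a _ _ [u <-] [v <-]]; first by exists 0; rewrite linear0.
  by exists (a *: u + v); rewrite linearP.
move=> [x|y] _.
  by exists (delta x (fval w (inl x)), 0); rewrite fE /=
      linear0 addr0 gen_delta -delta_bas.
by exists (0, delta y (fval w (inr y))); rewrite fE /= linear0 add0r gen_delta -delta_bas.
Qed.

Lemma shift_linear M : exists S T : {linear fsup nat M -> fsup nat M},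
  [/\ forall u, fval (S u) 0%N = 0, forall u m, fval (S u) m.+1 = fval u m
    & forall u m, fval (T u) m = fval u m.+1].
Proof.
have hS (u : fsup nat M) : exists v : fsup nat M, forall m, fval v m =
    if m is k.+1 then fval u k else 0.
  apply: mk_fsup; have [s sP] := fsup_finsupp u.
  exists (map (succn : {classic nat} -> {classic nat}) s) => -[|m] // /sP ms.
  by apply/mapP; exists (m : {classic nat}).
have hT (u : fsup nat M) : exists v : fsup nat M, forall m, fval v m = fval u m.+1.
  apply: mk_fsup; have [s sP] := fsup_finsupp u.
  exists (map (predn : {classic nat} -> {classic nat}) s) => m /sP ms.
  by apply/mapP; exists (m.+1 : {classic nat}).
have [[f fE] [g gE]] := (choice hS, choice hT).
have fl : linear f.
  by move=> a u v; apply: fsupP => -[|m]; rewrite fval_lin !fE ?fval_lin ?scaler0 ?addr0.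
have gl : linear g by move=> a u v; apply: fsupP => m; rewrite fval_lin !gE fval_lin.
have [[F FE] [G GE]] := (mk_linear fl, mk_linear gl).
by exists F, G; split=> u *; rewrite ?FE ?GE ?fE ?gE.
Qed.

(* Eilenberg's swindle: P + (C + P) + (C + P) + ... = (P + C) + (P + C) + ...
   where P + C is the free module on P. *)
Lemma swindle P : projective P ->
  exists f : {linear (P * fsup nat (freemod R P))%type -> fsup nat (freemod R P)},
      is_iso f.
Proof.
move=> hP; pose G : lmodType R := fsup nat (freemod R P).
have [s sE] := hP _ _ (eps P) idfun (@eps_surj _ P).
have [E EE] := @fsup_map R nat (freemod R P) (freemod R P) (s \o eps P : {linear _ -> _}).
have [S [T [S0 SS TE]]] := shift_linear (freemod R P).
have [i iE] := mk_linear (@delta_lin R nat (freemod R P) 0%N).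
(* [E] projects each copy of [freemod R P] onto its summand [P]. The map fixes the complementary
   parts and shifts the [P] parts up by one index, the extra [P] entering at 0; [T] shifts back. *)
have [f fE] : exists f : {linear (P * G)%type -> G},
    forall x, f x = i (s x.1) + ((x.2 - E x.2) + S (E x.2)).
  apply: (@mk_linear R (P * G)%type G (fun x => i (s x.1) + ((x.2 - E x.2) + S (E
      x.2)))) => a x y.
  rewrite (linearP s) (linearP i) (linearP E) (linearP S) /=.
  rewrite !scalerDr scalerN [RHS]addrACA; congr (_ + _).
  rewrite [RHS]addrACA; congr (_ + _).
  by rewrite [RHS]addrACA opprD.
have f0 p g : fval (f (p, g)) 0%N = s p + (fval g 0%N - s (eps P (fval g 0%N))).
  by rewrite fE 2!fvalD iE delta_same /= S0 addr0 fvalB EE.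
have fS p g m : fval (f (p, g)) m.+1 =
    (fval g m.+1 - s (eps P (fval g m.+1))) + s (eps P (fval g m)).
  by rewrite fE 2!fvalD iE delta_diff //= SS add0r fvalB !EE.
have es x : eps P (s x) = x by rewrite sE.
have ec u : eps P (u - s (eps P u)) = 0 by rewrite linearB /= es subrr.
exists f; split=> [[p g] [p' g'] e|h].
  have e0 p1 g1 : eps P (fval (f (p1, g1)) 0%N) = p1 by rewrite f0 linearD /= ec es addr0.
  have eS p1 g1 m : eps P (fval (f (p1, g1)) m.+1) = eps P (fval g1 m).
    by rewrite fS linearD /= ec es add0r.
  have epp : p = p' by rewrite -(e0 p g) e e0.
  have egg m : eps P (fval g m) = eps P (fval g' m) by rewrite -(eS p g) e eS.
  congr pair => //; apply: fsupP => -[|m].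
    have := congr1 (fun h => fval h 0%N) e; rewrite /= !f0 epp egg => /addrI.
    exact: addIr.
  have := congr1 (fun h => fval h m.+1) e; rewrite /= !fS !egg => /addIr.
  exact: addIr.
exists (eps P (fval h 0%N), (h - E h) + T (E h)).
have gE m : fval ((h - E h) + T (E h)) m =
    (fval h m - s (eps P (fval h m))) + s (eps P (fval h m.+1)).
  by rewrite fvalD fvalB !TE !EE.
have ge m : eps P (fval ((h - E h) + T (E h)) m) = eps P (fval h m.+1).
  by rewrite gE linearD /= ec es add0r.
apply: fsupP => -[|m].
  by rewrite f0 ge gE addrK addrC subrK.
by rewrite fS !ge gE addrK subrK.
Qed.

(** In dimension 1 the kernel [P] of the canonical cover is projective. Adding [G] to [P], and a
    free copy of [G] to the cover, makes both terms free on small sets by the swindle. In higher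
    dimension the first syzygy is again small. *)
Lemma small_has_resolution n M : small K [set: M] -> pdim n.+1 M ->
  has_resolution (small_sum_cg_projective K) n.+1 M.
Proof.
elim: n M => [|n IH] M hM hn; last first.
  apply: (has_resolution_cons (om_ses M)); first exact: small_sum_freemod.
  by apply: IH; [apply: small_om | apply/pdim_om].
pose P := om M; have hP : projective P by apply/(pdim_om 0).
have sP : small K [set: P] by apply: small_om.
have sNP : small K [set: nat * P].
  by apply: small_sub (small_prod K_infinite (small_nat K_infinite) sP).
pose G : lmodType R := fsup nat (freemod R P).
have [c cb] := fsup_curry nat P.
have [c' cb'] := bij_inv cb.
have sG : small_sum_cg_projective K G by apply: (small_sum_bij cb');
    apply: small_sum_freemod.
have [w wb] := swindle hP; have [w' wb'] := bij_inv wb.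
have sPG : small_sum_cg_projective K (P * G)%type by apply: (small_sum_bij wb').
pose F : lmodType R := (freemod R M * freemod R (nat * P)%type)%type.
have [d db] := freemod_sum M (nat * P)%type; have [d' db'] := bij_inv db.
have sF : small_sum_cg_projective K F.
  apply: (small_sum_bij db'); apply: small_sum_freemod.
  apply: small_sub (small_setU K_infinite (small_image inl hM) (small_image inr sNP)).
  by move=> [x|y] _; [left; exists x | right; exists y].
have [j jE] : exists j : {linear (P * G)%type -> F}, forall x, j x = (om_in M x.1, c x.2).
  have [[p1 p1E] [p2 p2E]] := (fst_linear P G, snd_linear P G).
  have [h hE] := pair_linear (om_in M \o p1 : {linear _ -> _}) (c \o p2 : {linear _ ->
      _}).
  by exists h => x; rewrite hE /= p1E p2E.
have [p pE] : exists p : {linear F -> M}, forall x, p x = eps M x.1.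
  have [p1 p1E] := fst_linear (freemod R M) (freemod R (nat * P)%type).
  by exists (eps M \o p1 : {linear _ -> _}) => x; rewrite /= p1E.
have [ji js jk] := om_ses M; have [ci cs] := cb.
have hs : ses j p.
  split=> [[x g] [x' g']|y|[u v]].
  - by rewrite !jE /= => -[/ji -> /ci ->].
  - by have [u <-] := js y; exists (u, 0); rewrite pE.
  - rewrite pE /= jk; split=> [[x <-]|[[x g]]]; last by rewrite jE => -[<- _]; exists x.
    by have [g <-] := cs v; exists (x, g); rewrite jE.
by apply: (has_resolution_cons hs sF); apply: has_resolution0.
Qed.

Lemma small_projdim_le_small n M : small K [set: M] -> projdim_le n.+1 M ->
  projdim_le_small K n.+1 M.
Proof.
move=> hM hn; split=> //; have /projdim_leE hn' := hn.
by have [G GP] := small_has_resolution hM hn'; exists G.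
Qed.

Lemma small_sum_small M : small_sum_cg_projective K M -> small K [set: M].
Proof.
move=> [I [P [inj [cI hP [h1 _]]]]].
have sPi i : small K [set: P i].
  have [_ [g gP]] := hP i.
  have sRn : small K (all_in [set: R * nat]).
    apply: small_seq => //; apply: small_sub (small_prod K_infinite (card_small
        card_R_le_K) (small_nat K_infinite)).
    by [].
  apply: (small_sub _ (small_image (fun l : seq (R * nat) => \sum_(p <- l) p.1 *: g
      p.2) sRn)).
  move=> x _; have [m [c ->]] := gP x.
  exists [seq (c j, nat_of_ord j) | j <- enum 'I_m]; last by rewrite big_map big_enum.
  by elim: (enum _).
pose T := {i : I & P i}.
have sT : small K [set: T].
  apply: (small_sub (B := \bigcup_(i in [set: I]) (existT _ i @` [set: P i]))).
    by move=> [i x] _; exists i => //; exists x.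
  apply: small_bigcup => // [|i _]; first exact: card_small.
  exact: small_image.
apply: (small_sub _ (small_image (fun l : seq T => \sum_(p <- l) inj (tag p) (tagged
    p)) (small_seq K_infinite sT))).
move=> x _; have [m [i [v ->]]] := h1 x.
exists [seq (existT _ (i j) (v j) : T) | j <- enum 'I_m];
    last by rewrite big_map big_enum.
by elim: (enum _).
Qed.

Lemma projdim_le_small_small n M : projdim_le_small K n M -> small K [set: M].
Proof.
move=> [_ [G /(_ 0%N isT)/small_sum_small hG]].
apply: (small_sub _ (small_image (res_aug G) hG)) => x _.
by have [y <-] := res_aug_surj G x; exists y.
Qed.

End SmallResolution.

(** * Layers between spans of sets of elements, and their syzygies *)

Section Span.
Variable R : pzRingType.
Implicit Types M L P Q : lmodType R.

Lemma span_submod M (A : set M) : submod (mspan A).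
Proof. by apply: submod_image; [apply: on_submod | apply: linear_onT]. Qed.

Lemma span_in M (A : set M) x : A x -> mspan A x.
Proof.
by move=> Ax; exists (bas x); [apply: on_delta | rewrite /eps gen_bas].
Qed.

Lemma span_min M (A N : set M) : submod N -> A `<=` N -> mspan A `<=` N.
Proof.
move=> hN AN _ [u uA <-].
apply: (fsup_ind_sub (N := eps M @^-1` N)); first exact: submod_preimage.
move=> x /uA/AN Nx; rewrite /preimage /= /eps gen_delta; exact: submodZ.
Qed.

Lemma spanS M (A B : set M) : A `<=` B -> mspan A `<=` mspan B.
Proof. by move=> AB; apply: span_min => [|x /AB/span_in]; first exact: span_submod. Qed.

Lemma on_setU (X : smallType) M (A B : set X) (u : fsup X M) : on (A `|` B) u ->
  exists v w, [/\ on A v, on B w & u = v + w].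
Proof.
move=> uAB; have [hA hB] := (on_submod M A, on_submod M B).
apply: (fsup_ind_sub (N := [set u | exists v w, [/\ on A v, on B w & u = v + w]])).
  split=> [|a _ _ [v [w [Av Bw ->]]] [v' [w' [Av' Bw' ->]]]].
    by exists 0, 0; split; [case: hA | case: hB | rewrite addr0].
  exists (a *: v + v'), (a *: w + w'); split; [by have [_] := hA;
      apply | by have [_] := hB; apply |].
  by rewrite scalerDr addrACA.
move=> x /uAB[Ax|Bx].
  by exists (delta x (fval u x)), 0; split; [apply: on_delta | case: hB | rewrite addr0].
by exists 0, (delta x (fval u x)); split; [case: hA | apply: on_delta | rewrite add0r].
Qed.

Section Subquo.
Variables (M : lmodType R) (A A' : set M) (AA' : A `<=` A').

Lemma subquo_gen Q (q : M -> Q) (rY : {linear freemod R M ->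
    freemod R {x | (A' `\` A) x}}) :
  is_subquo (mspan A) (mspan A') q -> (forall u x, fval (rY u) x = fval u (sval x)) ->
  forall w, on A' w -> q (eps M w) =
      gen (fun y : {x | (A' `\` A) x} => q (sval y)) (rY w).
Proof.
move=> [ql qs qk] rYE w wA'.
apply: (subquo_eps (span_submod A') ql _ _ rYE wA').2; first by move=> x /span_in.
move=> x A'x nY; have Ax : A x by apply: contrapT => nA; apply: nY.
by apply/qk; apply: span_in.
Qed.

Lemma subquo_gen_surj Q (q : M -> Q) : is_subquo (mspan A) (mspan A') q ->
  forall z, exists x, gen (fun y : {x | (A' `\` A) x} => q (sval y)) x = z.
Proof.
move=> hq z; have [ql qs qk] := hq; have [_ [w wA' <-] <-] := qs z.
have [rY rYE] := fsup_restr R^o (A' `\` A).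
by exists (rY w); rewrite -(subquo_gen hq rYE).
Qed.

Lemma restr_on (rY : {linear freemod R M -> freemod R {x | (A' `\` A) x}}) :
  (forall u x, fval (rY u) x = fval u (sval x)) ->
  forall u, on A u -> rY u = 0.
Proof.
move=> rYE u uA; apply: fsupP => -[x [A'x nAx]]; rewrite rYE fval0 /=.
exact: on_notin uA nAx.
Qed.

(** As [s] respects the supports [A] and [A'], it induces a map from the layer to the free module on
    [A'] minus [A], of which the layer becomes a retract. *)
Lemma subquo_projective (s : {linear M -> freemod R M}) :
  (forall x, eps M (s x) = x) -> (forall x, A x -> on A (s x)) ->
  (forall x, A' x -> on A' (s x)) ->
  exists Q (q : M -> Q), is_subquo (mspan A) (mspan A') q /\ projective Q.
Proof.
move=> es sA sA'.
have [Q [q hq]] := is_subquo_exists (span_submod A) (span_submod A').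
exists Q, q; split=> //; have [rY rYE] := fsup_restr R^o (A' `\` A).
have spA x : mspan A x -> on A (s x).
  apply: (span_min (N := s @^-1` on A)) => //; exact/submod_preimage/on_submod.
have spA' x : mspan A' x -> on A' (s x).
  apply: (span_min (N := s @^-1` on A')) => //; exact/submod_preimage/on_submod.
have [||a aE] := is_subquo_lift (g := fun x => rY (s x)) (span_submod A') hq.
- by move=> c x y _ _; rewrite !linearP.
- by move=> x _ /spA; apply: restr_on rYE _.
apply: (projective_retract (B := freemod R {x | (A' `\` A) x}));
    last exact: projective_free.
exists a, (gen (fun y : {x | (A' `\` A) x} => q (sval y))) => z.
have [_ qs _] := hq; have [x Ax <-] := qs z.
by rewrite aE // -(subquo_gen hq rYE) ?es //; apply: spA'.
Qed.

(** The relations on [A'] modulo those on [A] are the kernel of the free module on [A'] minus [A]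
    over the layer: a word in this kernel has its value in the span of [A], and subtracting a word
    on [A] makes it a relation. *)
Lemma subquo_pdim_step m :
  (exists Q (q : om M -> Q), is_subquo (on_om A) (on_om A') q /\ pdim m Q) ->
  exists Q (q : M -> Q), is_subquo (mspan A) (mspan A') q /\ pdim m.+1 Q.
Proof.
move=> [Q1 [q1 [hq1 hQ1]]].
have [Q [q hq]] := is_subquo_exists (span_submod A) (span_submod A').
exists Q, q; split=> //; have [rY rYE] := fsup_restr R^o (A' `\` A).
have [eY [eYE eYon]] := fsup_ext R^o (A' `\` A).
have [om_inj _ om_ker] := om_ses M; have [ql qs qk] := hq; have [ql1 qs1 qk1] := hq1.
have [||j jE] := is_subquo_lift (g := fun u => rY (om_in M u)) (on_om_submod A') hq1.
- by move=> c x y _ _; rewrite !linearP.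
- by move=> u _; apply: restr_on rYE _.
pose p := gen (fun y : {x | (A' `\` A) x} => q (sval y)).
have key := subquo_gen hq rYE.
suff s : ses j p by apply/(pdim_syzygy s) => //; apply: projective_free.
have eps0 u : eps M (om_in M u) = 0 by apply/om_ker; exists u.
have q0 : q 0 = 0 by apply: linear_on0 ql; apply: span_submod.
split.
- have j0 z : j z = 0 -> z = 0.
    have [u uA' <-] := qs1 z; rewrite jE // => ru.
    apply/(qk1 _ uA') => x ux; apply: contrapT => nA.
    have Yx : (A' `\` A) x by split=> //; apply: (uA' x ux).
    apply: ux.
    by rewrite -(rYE _ (exist _ x Yx)) ru fval0.
  by move=> x y e; apply/eqP; rewrite -subr_eq0; apply/eqP/j0; rewrite linearB /= e subrr.
- exact: subquo_gen_surj.
- move=> v; split=> [pv|[z <-]]; last first.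
    by have [u uA' <-] := qs1 z; rewrite jE // -key // eps0.
  pose w := eY v; have wA' : on A' w by apply: onS (eYon v) => x [].
  have rw : rY w = v by apply: fsupP => x; rewrite rYE eYE.
  have : mspan A (eps M w).
    by apply/qk; [exists w | rewrite key // rw].
  move=> [d dA de]; have dA' := onS AA' dA.
  have /om_ker[u uE] : eps M (w - d) = 0 by rewrite linearB /= de subrr.
  have uA' : on_om A' u by rewrite /on_om /= uE; apply: (submodB (on_submod R^o A')).
  by exists (q1 u); rewrite jE // uE linearB /= rw (restr_on rYE dA) subr0.
Qed.

End Subquo.

Lemma is_subquo_retract M (A B : set M) Q Q' (q : M -> Q) (q' : M -> Q') :
  submod B -> is_subquo A B q -> is_subquo A B q' -> retract Q Q'.
Proof.
move=> hB hq hq'; have [ql qs qk] := hq; have [ql' _ qk'] := hq'.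
have [|f fE] := is_subquo_lift hB hq ql'; first by move=> x Bx Ax; apply/qk'.
have [|g gE] := is_subquo_lift hB hq' ql; first by move=> x Bx Ax; apply/qk.
by exists f, g => z; have [x Bx <-] := qs z; rewrite fE // gE.
Qed.

End Span.

(** * Deconstruction of the complexes of bounded projective dimension *)

Section Deconstruction.
Variables (R : pzRingType) (K : smallType).
Hypothesis K_infinite : infinite_set [set: K].
Hypothesis card_R_le_K : [set: R] #<= [set: K].
Variables (n : nat) (X : complex R).
Hypothesis hX : ex_tilde (@projdim_le R n) X.

(* O i k is the k-th syzygy of X i, so that the freemod R (O i k), k < n, start
   a free resolution of X i, whose last term O i n is projective. A set D of
   basis elements of all these free modules is good when it generates an exact
   subcomplex of X and a subresolution in each degree. *)
Let O i k : lmodType R := iter k (@om R) (X i).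

Let T : smallType := {ik : int * nat & O ik.1 ik.2}.

Let tk i k (x : O i k) : T := existT (fun ik : int * nat => O ik.1 ik.2 : Type) (i, k) x.

Let tk_inj i k : injective (@tk i k).
Proof. by move=> x y /eqP; rewrite /tk eq_Tagged => /eqP. Qed.

Let J (D : set T) i k : set (O i k) := [set x | D (tk x)].

Let Y (D : set T) i : set (X i) := mspan (@J D i 0%N).

(** The zero map is the default at non-projective syzygies, so that [sec] exists for all [k]; its
    section property is used at k = n. *)
Let section_exists i k : exists s : {linear O i k -> freemod R (O i k)},
  projective (O i k) -> forall x, eps (O i k) (s x) = x.
Proof.
have [hp|np] := pselect (projective (O i k)).
  by have [s sE] := hp _ _ (eps (O i k)) idfun (@eps_surj _ _); exists s => _ x;
      rewrite sE.
by have [s _] := zero_linear (O i k) (freemod R (O i k)); exists s.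
Qed.

Let sec i k := projT1 (cid (section_exists i k)).
Let secE i x : eps (O i n) (sec i n x) = x.
Proof.
apply: (projT2 (cid (section_exists i n))).
by have [_ /(_ i)/projdim_leE] := hX.
Qed.

(** By [good_supp] and [good_syz], the relations among generators in [D] are exactly those that [D]
    spans. The span is asked for, and not membership in [D], because a small closure can adjoin only
    one relation per class modulo those of the previous set. [good_exact] speaks of boundaries,
    which are the cycles of [X] and need no differential out of degree [i]. *)
Record good_gens (D : set T) : Prop := GoodGens {
  good_supp : forall i k (u : O i k.+1), J D u -> on (@J D i k) (om_in _ u);
  good_syz : forall i k (u : O i k.+1), on (@J D i k) (om_in _ u) ->
      mspan (@J D i k.+1) u;
  good_sec : forall i k (x : O i k), J D x -> on (@J D i k) (sec i k x);
  good_diff : forall i (x : X (i + 1)), @J D (i + 1) 0%N x -> @J D i 0%N (cdiff X i x);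
  good_exact : forall i (x : X i), @Y D i x -> (exists y, cdiff X i y = x) ->
    exists2 y, @Y D (i + 1) y & cdiff X i y = x }.

Let J_filtration H i k : filtration H (fun D => @J D i k).
Proof.
by split=> [D D' DD' x|F hF x [D FD Dx]]; [apply: DD' | exists D].
Qed.

Let on_filtration H i k : filtration H (fun D => on (@J D i k) : set (freemod R (O i k))).
Proof. exact/filtration_on/J_filtration. Qed.

Let span_filtration H i k : filtration H (fun D => mspan (@J D i k)).
Proof.
have [h1 h2] := @on_filtration H i k.
split=> [D D' DD' _ [u uD <-]|F hF _ [u uD <-]]; first by exists u => //; apply: h1 uD.
by have [D FD Du] := h2 F hF u uD; exists D => //; exists u.
Qed.

Let good_chain_gens F : chain_in good_gens F -> good_gens (\bigcup_(D in F) D).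
Proof.
move=> hF; have [Fg _ _] := hF.
have sub D : F D -> D `<=` \bigcup_(D in F) D by move=> FD x Dx; exists D.
split.
- move=> i k u [D FD Du]; apply: (onS _ (good_supp (Fg D FD) Du)) => x; exact: sub.
- move=> i k u /((on_filtration _ i k).2 F hF)[D FD /(good_syz (Fg D FD))].
  by apply: spanS => x; apply: sub.
- move=> i k u [D FD Du]; apply: (onS _ (good_sec (Fg D FD) Du)) => x; exact: sub.
- by move=> i u [D FD Du]; exists D => //; apply: good_diff (Fg D FD) _ _ Du.
- move=> i x /((span_filtration _ i 0%N).2 F hF)[D FD Dx] /(good_exact (Fg D FD) Dx)[y
    Dy <-].
  by exists y => //; apply: (spanS _ Dy) => z; apply: sub.
Qed.

Let good_set0_gens : good_gens set0.
Proof.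
have s0 (M : lmodType R) (A : set M) x : (forall x, ~ A x) -> mspan A x -> x = 0.
  move=> nA; apply: (span_min (N := [set 0])); first exact: submod0.
  by move=> y /nA.
split=> // [i k u h|i x Yx _].
  have [om_inj _ _] := om_ses (O i k).
  have -> : u = 0; last by have [] := span_submod (@J set0 i k.+1).
  apply: om_inj; rewrite linear0; apply: fsupP => x; rewrite fval0.
  by apply: on_notin h _.
have -> : x = 0 by apply: s0 Yx => y.
by exists 0; [have [] := span_submod (@J set0 (i + 1) 0%N) | rewrite linear0].
Qed.

Let on_om_span D i k : good_gens D -> on_om (@J D i k) = mspan (@J D i k.+1).
Proof.
move=> gD; apply/seteqP; split=> u; first exact: good_syz.
apply: (span_min (N := on_om (@J D i k))); first exact: on_om_submod.
by move=> v; apply: good_supp.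
Qed.

Let Y_subcomplex D : good_gens D -> subcomplex (@Y D).
Proof.
move=> gD; split=> [i|i x]; first exact: span_submod.
apply: (span_min (N := cdiff X i @^-1` @Y D i)); first exact/submod_preimage/span_submod.
by move=> y /(good_diff gD)/span_in.
Qed.

(** At k = n the layer is projective thanks to [sec]; each step back towards [X i] raises the
    dimension by one. *)
Let subquo_pdim D D' i m k : good_gens D -> good_gens D' -> D `<=` D' -> (m + k = n)%N ->
  exists (Q : lmodType R) (q : O i k -> Q),
      is_subquo (mspan (@J D i k)) (mspan (@J D' i k)) q /\ pdim m Q.
Proof.
move=> gD gD' DD'; have JJ k' : @J D i k' `<=` @J D' i k' by move=> x; apply: DD'.
elim: m k => [|m IH] k mk.
  have [|||Q [q [hq hQ]]] := @subquo_projective R _ (@J D i k) (@J D' i k) (sec i k);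
      last by exists Q, q.
  - by rewrite add0n in mk; rewrite mk; apply: secE.
  - by move=> x; apply: good_sec.
  - by move=> x; apply: good_sec.
apply: (subquo_pdim_step (JJ k)); rewrite !on_om_span //.
have e : (m + k.+1 = n)%N by rewrite addnS -addSn.
exact: (IH k.+1 e).
Qed.

(** A cycle of [W] lifts to x with boundary in the span of [D]. By [good_exact] this is the boundary
    of some y in that span, and the cycle x - y bounds in the span of [D']. *)
Let subquo_ex_tilde D D' (W : complex R) (q : forall i, X i -> W i) : good_gens D ->
    good_gens D' ->
  D `<=` D' -> is_subquo_complex (@Y D) (@Y D') q -> ex_tilde (@projdim_le R n) W.
Proof.
move=> gD gD' DD' [hq qd]; have [hY dY] := Y_subcomplex gD; have [hY' dY'] :=
    Y_subcomplex gD'.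
have YY i : @Y D i `<=` @Y D' i by apply: spanS => x; apply: DD'.
split=> [i w dw|i].
  have [[ql qs qk] [ql1 qs1 qk1]] := (hq i, hq (i + 1)).
  have [x Yx xw] := qs1 w; have Yd : @Y D i (cdiff X i x).
    by apply/qk; [apply: dY' | rewrite qd // xw].
  have [|y Yy dy] := good_exact gD Yd; first by exists x.
  have [|z zxy] := hX.1 i (x - y); first by rewrite linearB /= dy subrr.
  have Yxy : @Y D' (i + 1) (x - y) by apply: (submodB (hY' _)) => //; apply: YY.
  have [|z' Yz' z'E] := good_exact gD' Yxy; first by exists z.
  exists (q _ z'); rewrite -qd // z'E (linear_onB (hY' _) ql1) //; last exact: YY.
  by rewrite xw (_ : q _ y = 0) ?subr0 //; apply/qk1 => //; apply: YY.
apply/projdim_leE; have [Q [r [hr hQ]]] := subquo_pdim i gD gD' DD' (addn0 n).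
by apply: pdim_retract hQ; apply: is_subquo_retract (hq i) hr.
Qed.

Let subquo_small D A i (Q : lmodType R) (q : X i -> Q) : small K A ->
  is_subquo (@Y D i) (@Y (D `|` A) i) q -> small K [set: Q].
Proof.
move=> hA hq; have gs := subquo_gen_surj hq.
pose S := {x | (@J (D `|` A) i 0 `\` @J D i 0) x}.
have hS : small K [set: S].
  apply: (small_rel (rho := fun (t : T) (x : S) => t = tk (sval x)) _ _ hA).
    move=> t x y -> /tk_inj e; case: x y e => [x p] [y p'] /= e; exact: eq_exist.
  by move=> [x [h nD]] _; exists (tk x) => //; case: h.
apply: small_sub (small_image (gen (fun y : S => q (sval y))) (small_freemod K_infinite
    card_R_le_K hS)).
by move=> z _; have [x xz] := gs z; exists x.
Qed.

Let small_J A i k : small K A -> small K (@J A i k).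
Proof.
apply: (small_rel (rho := fun t x => t = tk x)); first by move=> t x y -> /tk_inj.
by move=> x Ax; exists (tk x).
Qed.

Let small_index : small K [set: int * nat].
Proof.
apply: (small_rel (rho := fun m x => choice.unpickle m =
    Some x) _ _ (small_nat K_infinite)).
  by move=> m x y -> [].
by move=> x _; exists (choice.pickle x) => //; apply: choice.pickleK.
Qed.

Let small_supp i k (u : freemod R (O i k)) : small K (@tk i k @` [set x | fval u x <> 0]).
Proof.
apply: small_image; have [s _ [sP _]] := fsup_sum u.
by apply: small_sub (small_mem K_infinite s) => x /sP.
Qed.

Let small_closure D (t : T) : good_gens D ->
  exists A, [/\ small K A, A t & good_gens (D `|` A)].
Proof.
move=> gD.
(* For each word [v] in new generators, one relation [u] is fixed that completes [v] by a word on
   [D], if there is any. All other completions differ from it by a relation supported on [D],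
   already spanned by [D]. [S2] does the same for boundaries. *)
have S1 i k (v : freemod R (O i k)) : exists u : O i k.+1, forall (u' : O i k.+1) w,
    on (@J D i k) w -> v + w = om_in _ u' ->
    exists2 w', on (@J D i k) w' & v + w' = om_in _ u.
  have [[u [w [h1 h2]]]|no] := pselect (exists (u : O i k.+1) w, on (@J D i k) w /\
      v + w = om_in _ u).
    by exists u => _ _ _ _; exists w.
  by exists 0 => u' w h1 h2; case: no; exists u', w.
have S2 i (v : freemod R (X i)) : exists y : X (i + 1), forall y' w,
    @Y D i w -> eps _ v + w = cdiff X i y' ->
    exists2 w', @Y D i w' & eps _ v + w' = cdiff X i y.
  have [[y [w [h1 h2]]]|no] := pselect (exists y w, @Y D i w /\ eps _ v + w =
      cdiff X i y).
    by exists y => _ _ _ _; exists w.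
  by exists 0 => y' w h1 h2; case: no; exists y', w.
pose ub i k v := projT1 (cid (S1 i k v)); pose ubP i k v := projT2 (cid (S1 i k v)).
pose yb i v := projT1 (cid (S2 i v)); pose ybP i v := projT2 (cid (S2 i v)).
pose f1 A i k : set T := \bigcup_(u in @J A i k.+1) (@tk i k @` [set x | fval (om_in _
    u) x <> 0]).
pose f2 A i k : set T := \bigcup_(x in @J A i k) (@tk i k @` [set y | fval (sec i k x)
    y <> 0]).
pose f3 A i : set T := (fun x => @tk i 0 (cdiff X i x)) @` @J A (i + 1) 0%N.
pose f4 A i k : set T := (fun v => tk (ub i k v)) @` on (@J A i k).
pose f5 A i : set T := (fun v => @tk (i + 1) 0 (yb i v)) @` on (@J A i 0%N).
pose st A (ik : int * nat) : set T :=
  f1 A ik.1 ik.2 `|` f2 A ik.1 ik.2 `|` f3 A ik.1 `|` f4 A ik.1 ik.2 `|` f5 A ik.1.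
pose step A := A `|` \bigcup_(ik in [set: int * nat]) st A ik.
have small_step A : small K A -> small K (step A).
  move=> hA; apply: small_setU => //; apply: small_bigcup => // -[i k] _ /=.
  apply: small_setU => //; last by apply/small_image/small_on => //; apply: small_J.
  apply: small_setU => //; last by apply/small_image/small_on => //; apply: small_J.
  apply: small_setU => //; last by apply/small_image/small_J.
  by apply: small_setU => //; apply: small_bigcup => [//||x _]; try exact: small_supp;
      exact: small_J.
pose A m := iter m step [set t].
have smallA m : small K (A m).
  by elim: m => [|m IH]; [exact: small_set1 | exact: small_step].
have A_step m : A m `<=` A m.+1 by move=> x; left.
have A_mono m m' : (m <= m')%N -> A m `<=` A m'.
  by move=> /subnK <-; elim: (m' - m)%N => // d IH x /IH; apply: A_step.
pose F := range A.
have chF : chain_in setT F.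
  split=> //; first by exists (A 0%N); exists 0%N.
  by move=> _ _ [a _ <-] [b _ <-]; have [h|/ltnW h] := leqP a b; [left | right];
      apply: A_mono.
pose B := \bigcup_(D in F) D.
have BE x : B x -> exists m, A m x by move=> [_ [m _ <-] Ax]; exists m.
have AB m : A m `<=` B by move=> x Ax; exists (A m) => //; exists m.
have onB i k (v : freemod R (O i k)) : on (@J B i k) v -> exists m, on (@J (A m) i k) v.
  by move=> vB; have [_ [m _ <-] h] := (on_filtration setT i k).2 F chF v vB; exists m.
have stB m i k : st (A m) (i, k) `<=` B by move=> x h; apply: (AB m.+1); right;
    exists (i, k).
have stB1 m i k x : st (A m) (i, k) x -> (D `|` B) x by move=> /stB; right.
exists B; split; [|by apply: (AB 0%N)|split].
- apply: (small_sub (B := \bigcup_(m in [set: nat]) A m)); first by move=> x /BE[m];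
    exists m.
  by apply: small_bigcup => //; apply: small_nat.
- move=> i k u [Du x ux|/BE[m Au] x ux]; first by left; apply: (good_supp gD Du).
  by apply: (stB1 m i k); do 4!left; exists u => //; exists x.
- move=> i k u uDB; have [w [v [wD vB e]]] :=
    on_setU (uDB : on (@J D i k `|` @J B i k) _).
  have [m vA] := onB _ _ _ vB; rewrite [w + v]addrC in e.
  have [w' wD' e'] := ubP i k v u w wD (esym e).
  have h1 : mspan (@J D i k.+1) (u - ub i k v).
    apply: (good_syz gD); rewrite linearB /= e -e' opprD addrACA subrr add0r.
    exact: (submodB (on_submod _ _)).
  have h2 : mspan (@J (D `|` B) i k.+1) (ub i k v).
    by apply: span_in; apply: (stB1 m i k); left; right; exists v.
  rewrite -[u](subrK (ub i k v)); apply: (submodD (span_submod _)) => //.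
  by apply: (spanS _ h1) => x; left.
- move=> i k u [Du x ux|/BE[m Au] x ux]; first by left; apply: (good_sec gD Du).
  by apply: (stB1 m i k); do 3!left; right; exists u => //; exists x.
- move=> i x [Dx|/BE[m Ax]]; first by left; apply: good_diff gD _ _ Dx.
  by apply: (stB1 m i 0%N); do 2!left; right; exists x.
- move=> i x [u uDB <-] [y dy].
  have [w [v [wD vB e]]] := on_setU (uDB : on (@J D i 0%N `|` @J B i 0%N) _).
  have [m vA] := onB _ _ _ vB.
  have Yw : @Y D i (eps _ w) by exists w.
  have ee : eps _ u = eps _ v + eps _ w by rewrite e linearD addrC.
  have [w' Yw' e'] := ybP i v y (eps _ w) Yw (etrans (esym ee) (esym dy)).
  have h : @Y D i (eps _ u - cdiff X i (yb i v)).
    rewrite ee -e' opprD addrACA subrr add0r; exact: (submodB (span_submod _)).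
  have [|z Yz dz] := good_exact gD h; first by exists (y - yb i v); rewrite linearB /= dy.
  exists (z + yb i v); last by rewrite linearD /= dz subrK.
  apply: (submodD (span_submod _)); first by apply: (spanS _ Yz) => t'; left.
  by apply: span_in; apply: (stB1 m i 0%N); right; exists v.
Qed.

(** Partial retractions live on the preimages, in the middle term, of the subcomplexes spanned by
    good sets. Each enlargement of a good set adds a layer [W] that is small and has bounded
    projective dimension, hence lies in the class tested by the hypothesis on [Z]. *)
Lemma right_orth_small_Ext1_eq0 (Z : complex R) : (0 < n)%N ->
  right_orth (ex_tilde (projdim_le_small K n)) Z -> Ext1_eq0 X Z.
Proof.
move=> n0 hZ; apply/Ext1_retraction => E; have [ei es ek] := ext_exact E.
pose M := ext_mid E; pose inj := ext_inj E; pose pr := ext_proj E.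
have prinj i z : pr i (inj i z) = 0 by apply/ek; exists z.
(* All degrees are packed into one index type, so that a graded map is a single family for Zorn's
   lemma. *)
pose U := {i : int & M i}.
pose N (D : set T) : set U := [set u | @Y D (tag u) (pr _ (tagged u))].
pose PY (D : set T) i : set (M i) := pr i @^-1` @Y D i.
pose at_ (g : forall u : U, Z (tag u)) i (x : M i) : Z i :=
    g (existT (fun i => M i : Type) i x).
pose ok (D : set T) (g : forall u : U, Z (tag u)) :=
  [/\ forall i, linear_on (PY D i) (at_ g i),
      forall i x, PY D (i + 1) x -> at_ g i (cdiff M i x) = cdiff Z i (at_ g (i + 1) x)
    & forall i z, at_ g i (inj i z) = z].
have hPY D : good_gens D -> subcomplex (PY D).
  by move=> gD; apply/subcomplex_preimage/Y_subcomplex.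
have PYinj D i z : PY D i (inj i z).
  by rewrite /PY /preimage /= prinj; have [] := span_submod (@J D i 0%N).
have PYS D D' i : D `<=` D' -> PY D i `<=` PY D' i.
  by move=> DD' x; apply: spanS => y; apply: DD'.
have Ncont F i : chain_in good_gens F ->
    PY (\bigcup_(D in F) D) i `<=` \bigcup_(D in F) PY D i.
  by move=> hF x h; exact: (span_filtration _ i 0%N).2 F hF _ h.
have [g0 g0P] : exists g0, forall i z, at_ g0 i (inj i z) = z.
  have S (u : U) : exists z, forall z', inj _ z' = tagged u -> z' = z.
    have [[z zu]|nz] := pselect (exists z, inj _ z = tagged u).
      by exists z => z' z'u; apply: (ei (tag u)); rewrite z'u.
    by exists 0 => z zu; case: nz; exists z.
  exists (fun u => projT1 (cid (S u))) => i z; apply/esym.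
  exact: (projT2 (cid (S (existT (fun i => M i : Type) i (inj i z)))) z erefl).
have PY0 i x : PY set0 i x -> exists z, inj i z = x.
  move=> h; apply/ek; apply: (span_min (N := [set 0]) (@submod0 _ _) _ h).
  by move=> y.
have [g [gl gd gi]] : exists g, ok setT g.
  apply: (zorn_family (H := good_gens) (N := N) (D0 := set0) (g0 := g0)) => //.
  - split=> [D D' DD' [i x]|F hF [i x] h]; first exact: PYS.
    by have [D FD Dx] := Ncont F i hF x h; exists D.
  - move=> F g hF okF; have [Fg [D0 FD0] _] := hF; split.
    + move=> i a x y /(Ncont F i hF)[D1 F1 D1x] /(Ncont F i hF)[D2 F2 D2y].
      have [D [FD h1 h2]] := chain_finite hF F1 F2; have [gl _ _] := okF D FD.
      by apply: gl; [apply: PYS h1 _ D1x | apply: PYS h2 _ D2y].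
    + move=> i x /(Ncont F (i + 1) hF)[D FD Dx].
      by have [_ gd _] := okF D FD; apply: gd.
    + by have [_ _] := okF D0 FD0.
  - move=> D g g' gD gg' [gl gd gi]; have [hP dP] := hPY D gD.
    have e i x : PY D i x -> at_ g i x = at_ g' i x by move=> h;
        exact: (gg' (existT (fun i => M i : Type) i x) h).
    split.
    + move=> i a x y Dx Dy; rewrite -!e // ?gl //; first by have [_] := hP i; apply.
    + by move=> i x Dx; rewrite -!e // ?gd //; apply: dP.
    + by move=> i z; rewrite -e.
  - split=> // [i a x y /PY0[z <-] /PY0[z' <-]|i x /PY0[z <-]].
      by rewrite -linearP !g0P.
    by rewrite -cmap_diff !g0P.
  move=> D g gD [gl gd gi] nDT.
  have [t nDt] : exists t, ~ D t.
    apply: contrapT => h; apply: nDT; apply/seteqP; split=> // t _.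
    by apply: contrapT => nDt; apply: h; exists t.
  have [A [sA At gD']] := small_closure t gD; pose D' := D `|` A.
  have DD' : D `<=` D' by move=> x; left.
  have [hY dY] := Y_subcomplex gD; have [hY' dY'] := Y_subcomplex gD'.
  have [W [q hq]] := is_subquo_complex_exists (Y_subcomplex gD) (Y_subcomplex gD').
  have hW : ex_tilde (projdim_le_small K n) W.
    have [eW pW] := subquo_ex_tilde gD gD' DD' hq; split=> // i.
    case: (n) n0 (pW i) => // m _; apply: small_projdim_le_small => //.
    exact: subquo_small sA (hq.1 i).
  have [hP dP] := hPY D gD; have [hP' dP'] := hPY D' gD'.
  (* Dividing [PY D'] by the kernel of the partial retraction is the pushout along [g]: the quotient
     [E'] is an extension of [W] by [Z]. A retraction of [E'], composed with [q'], extends [g]. *)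
  pose Kg i : set (M i) := [set e | PY D i e /\ at_ g i e = 0].
  have hKg : subcomplex Kg.
    split=> [i|i x [Dx gx]]; last first.
      by split; [apply: dP | rewrite gd // gx linear0].
    have [P0 PP] := hP i; split; first by split=> //; apply: linear_on0 (gl i).
    move=> a x y [Dx gx] [Dy gy]; split; first exact: PP.
    by rewrite gl // gx gy scaler0 addr0.
  have [E' [q' hq']] := is_subquo_complex_exists hKg (hPY D' gD').
  have [[hqi qd] [hqi' qd']] := (hq, hq').
  have ql' i : linear_on (PY D' i) (q' i) by have [] := hqi' i.
  have [||inj' inj'E] := @mk_chain_map R Z E' (fun i z => q' i (inj i z)).
  + by move=> i a x y; rewrite linearP ql'.
  + by move=> i x; rewrite cmap_diff qd'.
  have [|||pr' pr'E] := is_subquo_complex_lift (V := W) (g :=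
      fun i e => q i (pr i e)) (hPY D' gD') hq'.
  + by move=> i a x y Dx Dy; rewrite linearP; have [ql _ _] := hqi i; apply: ql.
  + move=> i x D'x [Dx _]; have [_ _ qk] := hqi i; exact/qk.
  + by move=> i x Dx; rewrite cmap_diff qd.
  have q'eq i x : PY D i x -> q' i x = inj' i (at_ g i x).
    move=> Dx; rewrite inj'E; apply/(is_subquo_eq (hP' i) (hqi' i)) => //;
        first exact: PYS DD' _ Dx.
    split; first by apply: (submodB (hP i)).
    by rewrite (linear_onB (hP i) (gl i)) // gi subrr.
  have hs : short_exact inj' pr'.
    split=> i.
    + move=> z z'; rewrite !inj'E => /(is_subquo_eq (hP' i) (hqi' i))[] // _.
      by rewrite -linearB gi => /eqP; rewrite subr_eq0 => /eqP.
    + move=> w; have [_ qs _] := hqi i; have [x Yx <-] := qs w.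
      have [e ex] := es i x; have D'e : PY D' i e by rewrite /PY /preimage /= [pr i e]ex.
      by exists (q' i e); rewrite pr'E // [pr i e]ex.
    + move=> y; have [_ qs' _] := hqi' i; have [e D'e <-] := qs' y.
      have [_ _ qk] := hqi i; rewrite pr'E // qk //; split=> [De|[z]].
        by exists (at_ g i e); rewrite q'eq.
      rewrite inj'E => /(is_subquo_eq (hP' i) (hqi' i))[] // h _.
      have := submodN (hP i) h; rewrite opprB => h'.
      by rewrite -[e](subrK (inj i z)) linearD prinj addr0.
  have /Ext1_retraction/(_ (Extension hs))[r rE] := hZ W hW.
  exists D', (fun u => r _ (q' _ (tagged u))); split=> //.
  + by move=> h; apply: nDt; rewrite -h; right.
  + split=> [i a x y Dx Dy|i x Dx|i z]; rewrite /at_ /=.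
    * by rewrite ql' // linearP.
    * by rewrite qd' // cmap_diff.
    * by rewrite -inj'E [RHS](esym (rE i z)).
  + by move=> [i x] Dx /=; rewrite q'eq // [LHS]rE.
have PT i x : PY setT i x by apply: span_in.
have [||r rE] := @mk_chain_map R M Z (fun i x => at_ g i x).
- by move=> i a x y; apply: gl.
- by move=> i x; apply: gd.
by exists r => i z; rewrite rE gi.
Qed.

End Deconstruction.

(** * Special preenvelopes, special precovers and the cotorsion pair *)

Section Main.
Variable R : pzRingType.

(** By projectivity [p] lifts to the middle term, which is then a quotient of the sum of [B] and the
    disk complex. The lift maps the kernel of [p] into [B]; once this map extends to [g] on the
    whole disk complex, (b, x) |-> b + g x descends to a retraction. *)
Lemma disk_Ext1_eq0 (G : int ->
    smallType) (L B : complex R) (p : chain_map (disk R G) L) :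
  (forall i z, exists x, p i x = z) ->
  (forall f : forall i, disk R G i -> B i,
    (forall i, linear_on (p i @^-1` [set 0]) (f i)) ->
    (forall i (x : disk R G (i + 1)), p (i + 1) x = 0 ->
      f i (cdiff (disk R G) i x) = cdiff B i (f (i + 1) x)) ->
    exists g : chain_map (disk R G) B, forall i x, p i x = 0 -> g i x = f i x) ->
  Ext1_eq0 L B.
Proof.
move=> ps hext; apply/Ext1_retraction => E; have [ei es ek] := ext_exact E.
pose inj := ext_inj E; pose pr := ext_proj E.
have prinj i z : pr i (inj i z) = 0 by apply/ek; exists z.
have [h hE] := disk_projective p es.
have S i x : exists b, p i x = 0 -> inj i b = h i x.
  have [px|npx] := pselect (p i x = 0); last by exists 0.
  by have [b bE] : exists b, inj i b = h i x by [apply/ek; rewrite hE]; exists b.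
pose phi i x := projT1 (cid (S i x)).
have phiE i x : p i x = 0 -> inj i (phi i x) = h i x := projT2 (cid (S i x)).
have [||g gE] := hext phi.
- move=> i a x y px py; apply: (ei i); rewrite linearP -/(inj) !phiE ?linearP //.
  by rewrite px py scaler0 addr0.
- move=> i x px; apply: (ei i); rewrite -/(inj) phiE ?cmap_diff ?phiE ?px ?linear0 //.
have [||q qE] := @mk_chain_map R (dsum (disk R G) B) (ext_mid E) (fun i x => inj i x.1
    + h i x.2).
- by move=> i a x y; rewrite /= !linearP scalerDr [RHS]addrACA.
- by move=> i x; rewrite /= !cmap_diff linearD.
have [||k kE] := @mk_chain_map R (dsum (disk R G) B) B (fun i x => x.1 + g i x.2).
- by move=> i a x y; rewrite /= linearP scalerDr [RHS]addrACA.
- by move=> i x; rewrite /= cmap_diff linearD.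
have [||r rE] := quotient_lift (q := q) (g := k).
- move=> i e; have [x xe] := ps i (pr i e).
  have /ek[b bE] : pr i (e - h i x) = 0 by rewrite linearB /= [pr i (h i x)]hE xe subrr.
  by exists (b, x); rewrite qE /= [inj i b]bE subrK.
- move=> i [b x]; rewrite qE kE /= => e.
  have px : p i x = 0.
    by have := congr1 (pr i) e; rewrite linearD prinj linear0 add0r [pr i (h i x)]hE.
  rewrite gE //; apply: (ei i); rewrite linear0 linearD.
  by rewrite -[X in _ + X](phiE i x px) in e.
by exists r => i z; have := rE i (z, 0); rewrite qE kE /= !linear0 !addr0.
Qed.

Lemma isomorphic_quotients (X W W' : complex R) (q : chain_map X W) (q' : chain_map X
    W') :
  (forall i z, exists x, q i x = z) -> (forall i z, exists x, q' i x = z) ->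
  (forall i x, q i x = 0 <-> q' i x = 0) -> isomorphic W W'.
Proof.
move=> qs qs' qq'.
have [|f fE] := quotient_lift (g := q') qs; first by move=> i x /qq'.
have [|g gE] := quotient_lift (g := q) qs'; first by move=> i x /qq'.
exists f, g; split=> i x.
  by have [y <-] := qs i x; rewrite fE gE.
by have [y <-] := qs' i x; rewrite gE fE.
Qed.

Variables (K : smallType) (n : nat).
Hypothesis K_infinite : infinite_set [set: K].
Hypothesis card_R_le_K : [set: R] #<= [set: K].
Hypothesis n_gt0 : (0 < n)%N.

Let P := disk R (fun _ => K).
Let S : complex R -> Prop := ex_tilde (projdim_le_small K n).
Let X : complex R -> Prop := ex_tilde (@projdim_le R n).

Let presents (N : forall i, set (P i)) (L : complex R) (r : chain_map P L) :=
  (forall i z, exists x, r i x = z) /\ (forall i x, r i x = 0 <-> N i x).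

(** A presentation is recorded by its kernel alone: the complex [L] occurs under an existential in
    [Prop], which keeps the type in [smallType]. *)
Let index : smallType := {N : forall i, set (P i) |
  subcomplex N /\ exists (L : complex R) (r : chain_map P L), presents N r /\ S L}.

Let S_X L : S L -> X L.
Proof. by move=> [eL hL]; split=> // i; have [] := hL i. Qed.

Let S_presented L : S L -> exists (j : index) (r : chain_map P L), presents (sval j) r.
Proof.
move=> hL; have [eL pL] := hL.
have sg i : exists g : K -> L i, forall z, exists k, g k = z.
  have [f fP] := projdim_le_small_small K_infinite card_R_le_K (pL i).
  exists (fun k => odflt 0 (f k)) => z; have [k kz] := fP z I.
  by exists k; rewrite kz.
pose g i := projT1 (cid (sg i)).
have gP i z : exists k, g i k = z := projT2 (cid (sg i)) z.
have [r rE] := disk_map g.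
have rs i z : exists x, r i x = z.
  by have [k <-] := gP i z; exists (disk_gen R (k : (fun _ => K) i));
      rewrite (disk_map_gen rE).
pose N i : set (P i) := r i @^-1` [set 0].
have hN : subcomplex N /\ exists (L : complex R) (r : chain_map P L), presents N r /\ S L.
  by split; [apply: subcomplex_ker | exists L, r].
by exists (exist _ N hN), r.
Qed.

Lemma essentially_small_ex_tilde : essentially_small S.
Proof.
have F (j : index) := cid (svalP j).2.
exists index, (fun j => projT1 (F j)); split=> [j|L hL].
  by have [r [_ h]] := projT2 (F j).
have [j [r [rs rk]]] := S_presented hL; exists j.
have [r' [[rs' rk'] _]] := projT2 (F j).
by apply: (isomorphic_quotients rs rs') => i x; rewrite rk rk'.
Qed.

Let right_orth_S_X Z : right_orth S Z -> right_orth X Z.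
Proof.
by move=> hZ L hL; apply: (right_orth_small_Ext1_eq0 K_infinite card_R_le_K hL n_gt0 hZ).
Qed.

Lemma special_preenvelope Z : exists B A (f : chain_map Z B) (g : chain_map B A),
  [/\ X A, right_orth X B & short_exact f g].
Proof.
have [B [A [z [p [zp hext hA]]]]] :=
    @cells_extension R P Z index (fun j => sval j) (fun j => (svalP j).1).
exists B, A, z, p; split=> //.
  apply: hA => j; have [_ [L [r [[rs rk] hL]]]] := svalP j.
  by exists L, r; split=> //; apply: S_X.
apply: right_orth_S_X => L hL; have [j [r [rs rk]]] := S_presented hL.
apply: (disk_Ext1_eq0 rs) => f fl fd.
have [||g gE] := hext j f.
- by move=> i a x y /rk Nx /rk Ny; apply: fl.
- by move=> i x /rk; apply: fd.
by exists g => i x /rk; apply: gE.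
Qed.

(* Salce's trick: push out, along the kernel of a free cover of Z, a special
   preenvelope of this kernel. *)
Lemma special_precover Z : exists B A (f : chain_map B A) (g : chain_map A Z),
  [/\ X A, right_orth X B & short_exact f g].
Proof.
have [q qs] := disk_cover Z; have [L [l lq]] := kernel_complex qs.
have [B [A [f [g [XA YB fg]]]]] := special_preenvelope L.
have [C [f' [g' [b' [c' [h1 h2]]]]]] := pushout_short_exact lq fg.
exists B, C, f', g'; split=> //.
by apply: (ex_tilde_extension h2) => //; apply: disk_ex_tilde.
Qed.

(** The special precover of [Z] has its kernel in the right orthogonal, so it splits. With a
    retraction [r], the map 1 - f r kills the image of [f] and descends to a section of [g], making
    [Z] a retract of [A]. *)
Lemma left_orth_right_orth Z : left_orth (right_orth X) Z -> X Z.
Proof.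
move=> hZ; have [B [A [f [g [XA YB fg]]]]] := special_precover Z.
have /Ext1_retraction/(_ (Extension fg))[r rE] := hZ B YB.
have [fi gs gk] := fg; have gf i b : g i (f i b) = 0 by apply/gk; exists b.
have [||k kE] := @mk_chain_map R A A (fun i x => x - f i (r i x)).
- by move=> i a x y; rewrite (linearP (r i)) (linearP (f i)) opprD addrACA scalerBr.
- by move=> i x; rewrite !cmap_diff linearB.
have [|s sE] := quotient_lift (g := k) gs.
  by move=> i x /gk[b <-]; rewrite kE [r i _]rE subrr.
apply: (ex_tilde_retract (f := s) (g := g) _ XA) => i z.
by have [x <-] := gs i z; rewrite sE kE linearB /= gf subr0.
Qed.

End Main.

Theorem mainTheorem4 (R : pzRingType) (n : nat) (K : smallType)
    (R_noetherian : noetherian_ring R) (n_gt0 : (0 < n)%N)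
    (K_infinite : infinite_set [set: K])
    (card_R_le_K : [set: R] #<= [set: K]) :
  let X : complex R -> Prop := ex_tilde (projdim_le n) in
  let Y : complex R -> Prop := right_orth X in
  [/\ cotorsion_pair X Y,
      complete_pair X Y
    & cogenerated_by X Y (ex_tilde (projdim_le_small K n))].
Proof.
move=> X Y; split.
- split=> // Z; split=> [XZ W YW|hZ]; first exact: YW.
  exact: (left_orth_right_orth K_infinite card_R_le_K n_gt0 hZ).
- move=> Z; split; [exact: (special_precover K_infinite card_R_le_K n_gt0)
    | exact: (special_preenvelope K_infinite card_R_le_K n_gt0)].
- split; first exact: (essentially_small_ex_tilde n K_infinite card_R_le_K).
    by move=> Z [eZ hZ]; split=> // i; have [] := hZ i.
  move=> Z; split=> [YZ L [eL hL]|hZ L hL];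
      last exact: (right_orth_small_Ext1_eq0 K_infinite card_R_le_K hL n_gt0 hZ).
  by apply: YZ; split=> // i; have [] := hL i.
Qed.
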